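(* Let $G$ be a finite almost quasisimple group with unique non-abelian composition factor $S=\mathrm{PSL}_n(q)$, where $n\ge3$ and $(n,q)\notin\{(3,2),(3,3),(3,4)\}$, let $V$ be a faithful irreducible $\mathbb{C}G$-module, and let $g\in G$ have simple spectrum on $V$. Assume we are in the case where $E(G)$ is a quotient of $\mathrm{SL}_n(q)$ and $V|_{E(G)}$ is one of the $q-1$ Weil modules, of dimension $(q^n-1)/(q-1)$ or $(q^n-q)/(q-1)$. Then $\bar{\mathsf{o}}(g)=(q^n-1)/(q-1)$, $\bar g\in\mathrm{PGL}_n(q)$, and $\bar g$ generates the unique, up to $\mathrm{PGL}_n(q)$-conjugacy, maximal torus of order $(q^n-1)/(q-1)$ of $\mathrm{PGL}_n(q)$.
   Context: Almost quasisimple: $S\lhd G/\mathbf{Z}(G)\le\mathrm{Aut}(S)$ with $S$ non-abelian simple; $E(G)$ is the unique quasisimple normal subgroup of $G$ with $E(G)/\mathbf{Z}(E(G))\cong S$. $g$ has simple spectrum on $V$ if each eigenvalue has multiplicity one. $\bar g:=g\mathbf{Z}(G)\in G/\mathbf{Z}(G)\le\mathrm{Aut}(S)$, and $\bar{\mathsf{o}}(g)$ is its order; $\mathrm{PGL}_n(q)\le\mathrm{Aut}(\mathrm{PSL}_n(q))$ is the group of inner-diagonal automorphisms. Weil modules of $\mathrm{SL}_n(q)$: the irreducible constituents (restrictions of $\tau^i_{n,q}$, $0\le i\le q-2$) of the permutation module of $\mathrm{GL}_n(q)$ on $\mathbb{F}_q^n\smallsetminus\{0\}$. *)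

(* Defs.v *)
From HB Require Import structures.
From mathcomp Require Import all_boot all_order all_fingroup all_algebra.
From mathcomp Require Import all_solvable all_field all_character.
From mathcomp Require Import reals complex.
Set Implicit Arguments.
Unset Strict Implicit.
Unset Printing Implicit Defensive.
Import GroupScope GRing.Theory.
Local Open Scope ring_scope.

(* The library type {'GL_n[F]} consists of matrices of size n.-1.+1, so n >= 1
   is needed for it to be GL_n(F). *)

Section LinearGroups.
Variables (n : nat) (F : finFieldType).

Definition SL : {set {'GL_n[F]}} := [set x | \det (GLval x) == 1].

Lemma SL_group_set : group_set SL.
Proof.
apply/group_setP; split=> [|x y]; rewrite !inE ?GL_1E ?det1 //.
by move=> /eqP dx /eqP dy; rewrite GL_MxE det_mulmx dx dy mulr1.
Qed.
Canonical SL_group := Group SL_group_set.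

Lemma SL_subGL : SL_group \subset 'GL_n[F]%G.
Proof. exact: subsetT. Qed.

Definition PSL := (SL_group / 'Z(SL_group))%G.

(* PGL_n(F) inside Aut(PSL_n(F)): the automorphisms induced by conjugation by
   elements of GL_n(F).  The centre of SL_n(F) consists of scalar matrices,
   hence is normalised by GL_n(F), and coset_of 'Z(SL) contains the image of
   all of GL_n(F); scalar matrices induce the identity. *)
Definition PGL_aut_of (A : {set {'GL_n[F]}}) : {set {perm coset_of 'Z(SL_group)}} :=
  conj_aut PSL @* (A / 'Z(SL_group))%g.

Definition PGL_aut := PGL_aut_of 'GL_n[F].

End LinearGroups.

Section AlmostQuasisimple.
Variables (gT sT : finGroupType).

(* phi realises the inclusion S <| G / Z(G) <= Aut(S), where S is identified
   with the group of inner automorphisms Inn(S) = conj_aut S @* S. *)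
Definition almost_quasisimple (G : {group gT}) (S : {group sT})
    (phi : {morphism (G / 'Z(G))%g >-> {perm sT}}) :=
  [/\ simple S /\ ~~ abelian S,
      'injm phi,
      (conj_aut S @* S)%g <| (phi @* (G / 'Z(G)))%g &
      (phi @* (G / 'Z(G)))%g \subset Aut S].

Definition quasisimple (E : {group gT}) :=
  [/\ ([~: E, E] = E)%g, simple (E / 'Z(E))%g & ~~ abelian (E / 'Z(E))%g].

Definition is_layer (G : {group gT}) (S : {group sT}) (E : {group gT}) :=
  [/\ quasisimple E, E <| G & (E / 'Z(E))%g \isog S].

End AlmostQuasisimple.

Definition simple_spectrum (C : fieldType) (m : nat) (A : 'M[C]_m) :=
  forall a : C, eigenvalue A a -> mup a (char_poly A) = 1%N.

Section WeilModules.
Variables (C : fieldType) (n : nat) (F : finFieldType).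

Definition nzvec := {v : 'rV[F]_n.-1.+1 | v != 0}.

(* Matrix representations act on row vectors from the right, so the basis
   vector indexed by v is sent by x to the one indexed by v *m x. *)
Definition perm_GL_mx (x : {'GL_n[F]}) : 'M[C]_#|{: nzvec}| :=
  \matrix_(i, j) (val (enum_val i) *m GLval x == val (enum_val j))%:R.

Lemma perm_GL_mx_repr : mx_repr 'GL_n[F] perm_GL_mx.
Proof.
split=> [|x y _ _]; apply/matrixP=> i j; rewrite !mxE.
  by rewrite GL_1E mulmx1 (inj_eq val_inj) (inj_eq enum_val_inj).
have nz : val (enum_val i) *m GLval x != 0.
  apply: contra (valP (enum_val i)) => /eqP eq0.
  by rewrite -[val _](mulmxK (GL_unitmx x)) eq0 mul0mx.
pose k := enum_rank (exist (fun v => v != 0) _ nz : nzvec).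
rewrite (bigD1 k) //= big1 ?addr0 => [|l nkl]; rewrite !mxE.
  by rewrite enum_rankK /= eqxx mul1r mulmxA.
case: eqP => [eql|]; last by rewrite mul0r.
case/eqP: nkl; apply: enum_val_inj; apply: val_inj.
by rewrite enum_rankK /= eql.
Qed.

Definition perm_GL_repr := MxRepresentation perm_GL_mx_repr.

(* The permutation module is the sum of the trivial module and of the q - 1
   modules tau^i, pairwise non-isomorphic and irreducible; the trivial
   constituent is not a Weil module. *)
Definition Weil_GL (m : nat) (tau : mx_representation C 'GL_n[F] m) :=
  [/\ mx_irreducible tau,
      ~~ ('GL_n[F] \subset rker tau) &
      exists (U : 'M[C]_#|{: nzvec}|) (modU : mxmodule perm_GL_repr U),
        mx_rsim tau (submod_repr modU)].

Definition Weil_SL (m : nat) (W : mx_representation C (SL n F) m) :=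
  exists2 tau : mx_representation C 'GL_n[F] m,
    Weil_GL tau & mx_rsim W (subg_repr tau (SL_subGL n F)).

End WeilModules.

Section AlgebraicTori.
Variables (K : closedFieldType) (d : nat).
Implicit Types (T A B : 'M[K]_d -> Prop).

Inductive polyfun : ('M[K]_d -> K) -> Prop :=
| polyfun_const c : polyfun (fun=> c)
| polyfun_coef i j : polyfun (fun x => x i j)
| polyfun_add f g : polyfun f -> polyfun g -> polyfun (fun x => f x + g x)
| polyfun_mul f g : polyfun f -> polyfun g -> polyfun (fun x => f x * g x).

Definition GL_closed A :=
  exists2 I : ('M[K]_d -> K) -> Prop,
    forall f, I f -> polyfun f &
    forall x, A x <-> x \in unitmx /\ forall f, I f -> f x = 0.

(* For Zariski-closed T, being closed in T and closed in GL_d amount to the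
   same thing. *)
Definition GL_connected T :=
  forall A B, GL_closed A -> GL_closed B ->
    (forall x, T x <-> A x \/ B x) -> (forall x, ~ (A x /\ B x)) ->
  (forall x, ~ A x) \/ (forall x, ~ B x).

Definition GL_subgroup T :=
  [/\ forall x, T x -> x \in unitmx,
      T 1%:M,
      forall x y, T x -> T y -> T (x *m y) &
      forall x, T x -> T (invmx x)].

Definition GL_diagonalizable T :=
  exists2 h : 'M[K]_d, h \in unitmx &
    forall x, T x -> is_diag_mx (h *m x *m invmx h).

Definition torus T :=
  [/\ GL_subgroup T, GL_closed T, GL_connected T & GL_diagonalizable T].

Definition maximal_torus T :=
  torus T /\
  forall T', torus T' -> (forall x, T x -> T' x) -> forall x, T' x -> T x.

End AlgebraicTori.

(* K (with FtoK) is meant to be an algebraic closure of F.  As the centre of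
   GL_n is a connected group contained in all of its maximal tori, the maximal
   tori of PGL_n(F) are the images of those of GL_n(F), that is, of the groups
   T(F) of fixed points of the #|F|-Frobenius map on a Frobenius-stable maximal
   torus T of GL_n(K). *)
Definition maximal_torus_PGL (n : nat) (F : finFieldType) (K : closedFieldType)
    (FtoK : {rmorphism F -> K}) (T : {set {perm coset_of 'Z(SL_group n F)}}) :=
  exists (TK : 'M[K]_n.-1.+1 -> Prop) (TF : {set {'GL_n[F]}}),
    [/\ maximal_torus TK,
        forall x, TK x <-> TK (map_mx (fun a => a ^+ #|F|) x),
        forall x : {'GL_n[F]}, x \in TF <-> TK (map_mx FtoK (GLval x)) &
        T = PGL_aut_of TF].

(* Main.v *)
Require Import Defs.
From HB Require Import structures.
From mathcomp Require Import all_boot all_order all_fingroup all_algebra.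
From mathcomp Require Import all_solvable all_field all_character.
From mathcomp Require Import reals complex zify ring.
From mathcomp Require boolp.
Set Implicit Arguments.
Unset Strict Implicit.
Unset Printing Implicit Defensive.
Import GroupScope GRing.Theory.
Local Open Scope ring_scope.

(** By Schur's lemma [g ^+ o] acts as a scalar, [o] being the order of [g] modulo the
    centre, so the [m] distinct eigenvalues of [g] are roots of one polynomial [X^o - c],
    whence [o >= m >= (q^n - q)/(q - 1)].  It remains to see which automorphisms of
    [PSL_n(q)] have such a large order.

    An automorphism permutes the nontrivial elements of centres of Sylow p-subgroups, which
    are the (images of) transvections, and the maximal subgroups consisting of
    transvections, which are given by points and hyperplanes.  Following a frame and the
    root subgroups attached to it, one finds that the automorphism is
    [x |-> P^-1 th(x) P], possibly composed with inverse transposition, for a field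
    automorphism [th].  If [th] is nontrivial, with fixed field of [q0] elements, then the
    order is at most about [e (q0^n - 1)/(q0 - 1)] with [q0^e <= q], which is too small.  If
    inverse transposition occurs, the square is conjugation by some [B] that is inverted by
    an anti-automorphism [sg]; the elements [x] with [x sg(x)] scalar then form too
    small a part of [F[B]].  In the remaining linear case the group of units of [F[P]] has
    at least [q^n - q] elements, which forces [F[P]] to be a field of [q^n] elements whose
    units are [F^* <P>].

    The torus is the centraliser of [P], connected because lines in an affine space of
    matrices meet closed sets in finitely many points or entirely.  Conversely a maximal
    torus of the same order is the group of units of a field of [q^n] matrices, which
    contains a root of the minimal polynomial of [P], that is, a conjugate of [P]. *)

(** Two obstacles shape the argument. The geometry needs matrices, but an automorphism acts on
    cosets of the centre. In size at least 3 a nonzero scalar is not a sum of two matrices of rank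
    one, so a coset contains at most one transvection and images can be lifted without choices. The
    other obstacle is the factor 2 lost when a correlation is replaced by its square. All estimates
    start from [q ^ n - q <= (q - 1) * o], in which [(q - 1) * o] is the order of a group [F^* <P>]
    of units of [F[P]]. For the square of a correlation only half of this survives, and size alone
    does not exclude a subgroup of index two in the units of [F[B]]. Hence two explicit units are
    produced which, together with 1, lie in three different cosets, and index three is impossible.
    The excluded pairs mark where the counts fail: (3,4) is a field automorphism with fixed field of
    two elements and [e = 2]; (3,3) and (3,2) come from correlations for which no suitable units
    exist. *)

Lemma det_add1_mul (F : comNzRingType) k (u : 'cV[F]_k) (w : 'rV[F]_k) :
  \det (1%:M + u *m w) = 1 + (w *m u) 0 0.
Proof.
(* The same bordered matrix is factored as lower times upper and as upper times lower; comparing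
   determinants gives the identity. *)
have E1 : block_mx (1%:M : 'M_1) (- w) u 1%:M =
   block_mx 1%:M 0 u 1%:M *m block_mx 1%:M (- w) 0 (1%:M + u *m w).
  by rewrite mulmx_block !mul0mx !mul1mx !mulmx1 !addr0 mulmxN addrCA addNr addr0.
have E2 : block_mx (1%:M : 'M_1) (- w) u 1%:M =
   block_mx (1%:M + w *m u) (- w) 0 1%:M *m block_mx 1%:M 0 u 1%:M.
  by rewrite mulmx_block !mul0mx !mulmx0 !mulmx1 !add0r mul1mx mulNmx addrK.
move/(congr1 determinant): E2; rewrite E1 !det_mulmx !det_lblock !det_ublock.
by rewrite !det1 !mul1r !mulr1 det_mx11 !mxE eqxx.
Qed.

(** Only off-diagonal units are assumed, because they are what commuting with elementary
    transvections provides. *)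
Lemma scalar_mx_comm_delta (F : nzRingType) k (A : 'M[F]_k.+2) :
  (forall i j, i != j -> A *m delta_mx i j = delta_mx i j *m A) -> is_scalar_mx A.
Proof.
move=> cA; have E i j l : i != j -> A l i = (l == i)%:R * A j j.
  move=> ne_ij; have /matrixP/(_ l j) := cA i j ne_ij; rewrite !mxE.
  rewrite (bigD1 i) //= big1 => [|s nsi]; last by rewrite !mxE (negPf nsi) mulr0.
  rewrite (bigD1 j) //= big1 => [|s nsj]; last by rewrite !mxE (negPf nsj) andbF mul0r.
  by rewrite !mxE !eqxx mulr1 andbT !addr0.
apply/is_scalar_mxP; exists (A 0 0); apply/matrixP=> l i; rewrite !mxE.
have [->|ni0] := eqVneq i 0; last by rewrite (E i 0) // mulr_natl.
by rewrite (E 0 1 l) // (E 1 0 1) // eqxx mul1r mulr_natl.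
Qed.

(** * Transvections, and the groups with a common axis or centre *)

Section GLbasics.
Variables (n' : nat) (F : finFieldType).
Local Notation n := n'.+1.
Local Notation gl := {'GL_n[F]}.
Implicit Types (x y : gl) (A : 'M[F]_n) (u : 'cV[F]_n) (w : 'rV[F]_n).

(** Singular matrices are sent to the default 1, so every computation with [mkGL] goes through
    [mkGLK] and a proof of invertibility. *)
Definition mkGL A : gl := insubd (1%g : gl) A.

Lemma mkGLK A : A \in unitmx -> GLval (mkGL A) = A.
Proof. by move=> uA; apply: (insubdK (1%g : gl)). Qed.

Lemma GLval_inj : injective (@GLval n F).
Proof. exact: val_inj. Qed.

Lemma GLunit x : GLval x \in unitmx.
Proof. exact: GL_unitmx. Qed.

Lemma GL_J x y : GLval (x ^ y)%g = invmx (GLval y) *m GLval x *m GLval y.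
Proof. by rewrite conjgE !GL_MxE GL_VxE mulmxA. Qed.

Lemma GL_X x k : GLval (x ^+ k)%g = GLval x ^+ k.
Proof. by elim: k => // k IH; rewrite expgS GL_ME IH exprS. Qed.

Definition scalars : {set gl} := [set x | is_scalar_mx (GLval x)].

Lemma scalarsP x : reflect (exists2 c, c != 0 & GLval x = c%:M) (x \in scalars).
Proof.
rewrite inE; apply: (iffP is_scalar_mxP) => [[c xE]|[c _ ->]]; last by exists c.
exists c => //; have := GL_det x.
by rewrite xE det_scalar expf_eq0.
Qed.

Lemma scalars_group_set : group_set scalars.
Proof.
apply/group_setP; split=> [|x y]; rewrite !inE ?GL_1E ?scalar_mx_is_scalar //.
move=> /is_scalar_mxP[c xE] /is_scalar_mxP[d yE].
by rewrite GL_MxE xE yE -scalar_mxM scalar_mx_is_scalar.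
Qed.
Canonical scalars_group := Group scalars_group_set.

Lemma scalar_unitmx (c : F) : c != 0 -> (c%:M : 'M[F]_n) \in unitmx.
Proof. by move=> nz; rewrite unitmxE det_scalar unitrX ?unitfE. Qed.

Lemma mkGL_scalar c : c != 0 -> GLval (mkGL c%:M) = c%:M.
Proof. by move=> nz; rewrite mkGLK ?scalar_unitmx. Qed.

Lemma card_scalars : #|scalars| = #|F|.-1.
Proof.
have -> : scalars = [set mkGL c%:M | c in [set c : F | c != 0]].
  apply/setP=> x; apply/scalarsP/imsetP => [[c nz xE]|[c]].
    by exists c; rewrite ?inE //; apply: GLval_inj; rewrite mkGL_scalar.
  by rewrite inE => nz ->; exists c => //; rewrite mkGL_scalar.
rewrite card_in_imset => [|c d]; last first.
  rewrite !inE => nzc nzd /(congr1 (@GLval n F)); rewrite !mkGL_scalar //.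
  by move/matrixP/(_ 0 0); rewrite !mxE eqxx.
have -> : [set c : F | c != 0] = [set~ 0] by apply/setP=> c; rewrite !inE.
by rewrite cardsC1.
Qed.

Lemma scalars_cent x y : x \in scalars -> commute x y.
Proof.
case/scalarsP=> c _ xE; apply: GLval_inj.
by rewrite !GL_MxE xE scalar_mxC.
Qed.

Lemma SLE x : (x \in SL n F) = (\det (GLval x) == 1).
Proof. by rewrite inE. Qed.

Lemma SL_J x y : (x ^ y \in SL n F)%g = (x \in SL n F).
Proof.
by rewrite !SLE GL_J !det_mulmx mulrAC -det_mulmx mulVmx ?GLunit // det1 mul1r.
Qed.

Lemma SL_normal : 'GL_n[F] \subset 'N(SL n F).
Proof.
by apply/subsetP=> x _; rewrite inE; apply/subsetP=> z /imsetP[y SLy ->]; rewrite SL_J.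
Qed.

Definition tv u w : 'M[F]_n := 1%:M + u *m w.

Lemma tvM u u' w : w *m u' = 0 -> tv u w *m tv u' w = tv (u + u') w.
Proof.
move=> wu0; rewrite /tv mulmxDl mul1mx mulmxDr mulmx1 -mulmxA (mulmxA w) wu0 mul0mx.
by rewrite mulmx0 addr0 mulmxDl -addrA (addrC (u' *m w)).
Qed.

Lemma tv_unit u w : w *m u = 0 -> tv u w \in unitmx.
Proof. by move=> wu0; rewrite unitmxE det_add1_mul wu0 mxE addr0 unitr1. Qed.

Lemma det_tv u w : w *m u = 0 -> \det (tv u w) = 1.
Proof. by move=> wu0; rewrite det_add1_mul wu0 mxE addr0. Qed.

Definition tvg u w : gl := mkGL (tv u w).

Lemma tvgE u w : w *m u = 0 -> GLval (tvg u w) = tv u w.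
Proof. by move=> wu0; rewrite mkGLK ?tv_unit. Qed.

Definition tvs : {set gl} :=
  [set x : gl | [exists u, exists w, (w *m u == 0) && (GLval x == tv u w)]].

Lemma tvsP x : reflect (exists u w, w *m u = 0 /\ GLval x = tv u w) (x \in tvs).
Proof.
rewrite inE; apply: (iffP existsP) => [[u /existsP[w /andP[/eqP ? /eqP ?]]]|[u [w [e1 e2]]]].
  by exists u, w.
by exists u; apply/existsP; exists w; rewrite e1 e2 !eqxx.
Qed.

Lemma tvg_tvs u w : w *m u = 0 -> tvg u w \in tvs.
Proof. by move=> wu0; apply/tvsP; exists u, w; rewrite tvgE. Qed.

Lemma tvs_SL x : x \in tvs -> x \in SL n F.
Proof. by case/tvsP=> u [w [wu0 xE]]; rewrite SLE xE det_tv. Qed.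

Lemma tvs1 : (1%g : gl) \in tvs.
Proof. by apply/tvsP; exists 0, 0; rewrite mulmx0 /tv mulmx0 addr0. Qed.

Lemma tv_conj A u w : A \in unitmx -> invmx A *m tv u w *m A = tv (invmx A *m u) (w *m A).
Proof.
by move=> uA; rewrite /tv mulmxDr mulmx1 mulmxDl mulVmx // !mulmxA.
Qed.

Lemma tvsJ x y : x \in tvs -> (x ^ y)%g \in tvs.
Proof.
case/tvsP=> u [w [wu0 xE]]; apply/tvsP; exists (invmx (GLval y) *m u), (w *m GLval y).
have uy := GLunit y; split; last by rewrite GL_J xE tv_conj.
by rewrite mulmxA mulmxK.
Qed.

(* Transvections with a common axis (the kernel of w), resp. with a common centre (the
   span of u). *)
Definition Tc w : {set gl} := [set x : gl | [exists u, (w *m u == 0) && (GLval x == tv u w)]].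
Definition Ta u : {set gl} := [set x : gl | [exists w, (w *m u == 0) && (GLval x == tv u w)]].

Lemma TcP w x : reflect (exists2 u, w *m u = 0 & GLval x = tv u w) (x \in Tc w).
Proof.
rewrite inE; apply: (iffP existsP) => [[u /andP[/eqP ? /eqP ?]]|[u e1 e2]]; exists u => //.
by rewrite e1 e2 !eqxx.
Qed.

Lemma TaP u x : reflect (exists2 w, w *m u = 0 & GLval x = tv u w) (x \in Ta u).
Proof.
rewrite inE; apply: (iffP existsP) => [[w /andP[/eqP ? /eqP ?]]|[w e1 e2]]; exists w => //.
by rewrite e1 e2 !eqxx.
Qed.

Lemma Tc_sub w : Tc w \subset tvs.
Proof. by apply/subsetP=> x /TcP[u ? ?]; apply/tvsP; exists u, w. Qed.

Lemma Ta_sub u : Ta u \subset tvs.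
Proof. by apply/subsetP=> x /TaP[w ? ?]; apply/tvsP; exists u, w. Qed.

Lemma Tc_group_set w : group_set (Tc w).
Proof.
apply/group_setP; split.
  by apply/TcP; exists 0; rewrite ?mulmx0 // /tv mul0mx addr0.
move=> x y /TcP[u wu0 xE] /TcP[u' wu0' yE]; apply/TcP; exists (u + u').
  by rewrite mulmxDr wu0 wu0' addr0.
by rewrite GL_MxE xE yE tvM.
Qed.
Canonical Tc_group w := Group (Tc_group_set w).

Lemma tvMa u w w' : w *m u = 0 -> tv u w *m tv u w' = tv u (w + w').
Proof.
move=> wu0; rewrite /tv mulmxDl mul1mx mulmxDr mulmx1 -mulmxA (mulmxA w) wu0 mul0mx.
by rewrite mulmx0 addr0 mulmxDr -addrA (addrC (u *m w')).
Qed.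

Lemma Ta_group_set u : group_set (Ta u).
Proof.
apply/group_setP; split.
  by apply/TaP; exists 0; rewrite ?mul0mx // /tv mulmx0 addr0.
move=> x y /TaP[w wu0 xE] /TaP[w' wu0' yE]; apply/TaP; exists (w + w').
  by rewrite mulmxDl wu0 wu0' addr0.
by rewrite GL_MxE xE yE tvMa.
Qed.
Canonical Ta_group u := Group (Ta_group_set u).

Lemma TcJ w x : (Tc w :^ x)%g = Tc (w *m GLval x).
Proof.
have ux := GLunit x; apply/setP=> y; rewrite mem_conjg.
apply/TcP/TcP=> [[u wu0]|[u wu0]].
  rewrite GL_J GL_VxE invmxK => yE; exists (invmx (GLval x) *m u).
    by rewrite mulmxA mulmxK.
  by rewrite -tv_conj // -yE -mulmxA mulmxKV // mulKmx.
move=> yE; exists (GLval x *m u); first by rewrite mulmxA.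
rewrite GL_J GL_VxE yE tv_conj ?unitmx_inv // invmxK mulmxK //.
Qed.

Lemma TaJ u x : (Ta u :^ x)%g = Ta (invmx (GLval x) *m u).
Proof.
have ux := GLunit x; apply/setP=> y; rewrite mem_conjg.
apply/TaP/TaP=> [[w wu0]|[w wu0]].
  rewrite GL_J GL_VxE invmxK => yE; exists (w *m GLval x).
    by rewrite mulmxA mulmxK.
  by rewrite -tv_conj // -yE -mulmxA mulmxKV // mulKmx.
move=> yE; exists (w *m invmx (GLval x)); first by rewrite -mulmxA.
by rewrite GL_J GL_VxE yE tv_conj ?unitmx_inv // invmxK mulKVmx.
Qed.

End GLbasics.

Lemma rank1_mul (F : fieldType) k (u : 'cV[F]_k) (w : 'rV[F]_k) :
  (\rank (u *m w) <= 1)%N.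
Proof. exact: leq_trans (mxrankM_maxl _ _) (rank_leq_col _). Qed.

Lemma row_transitive (F : finFieldType) k (w : 'rV[F]_k.+1) : w != 0 ->
  exists2 A : 'M[F]_k.+1, A \in unitmx & delta_mx 0 0 *m A = w.
Proof.
move=> nzw; have rw : \rank w = 1%N by apply/eqP; rewrite eqn_leq rank_leq_row lt0n mxrank_eq0.
have := mulmx_ebase w; rewrite rw [col_ebase w]mx11_scalar mul_scalar_mx => wE.
have nz : col_ebase w 0 0 != 0.
  have := col_ebase_unit w; rewrite [X in X \in _]mx11_scalar unitmxE det_scalar expr1.
  by rewrite unitfE.
exists (col_ebase w 0 0 *: row_ebase w); first by rewrite unitmxZ ?unitfE ?row_ebase_unit.
rewrite -{3}wE -scalemxAr -scalemxAl; congr (_ *: (_ *m _)).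
by apply/rowP=> j; rewrite !mxE eqxx /= andbT eq_sym.
Qed.

Lemma col_transitive (F : finFieldType) k (u : 'cV[F]_k.+1) : u != 0 ->
  exists2 A : 'M[F]_k.+1, A \in unitmx & A *m u = delta_mx 0 0.
Proof.
move=> nzu; have [|A uA AE] := @row_transitive F k u^T; first by rewrite trmx_eq0.
exists (invmx A^T); first by rewrite unitmx_inv unitmx_tr.
by rewrite -[u]trmxK -AE trmx_mul mulKmx ?unitmx_tr // trmx_delta.
Qed.

(** * The centre of SL_n, cosets of transvections, inner-diagonal automorphisms *)

Section PSLbasics.
Variables (k : nat) (F : finFieldType).
Local Notation n := k.+3.
Local Notation gl := {'GL_n[F]}.
Local Notation Z := 'Z(SL_group n F).
Local Notation S := (PSL n F).
Implicit Types (x y : gl) (A : 'M[F]_n) (u : 'cV[F]_n) (w : 'rV[F]_n).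

Lemma delta_mul0 i j : i != j -> (delta_mx 0 j : 'rV[F]_n) *m (delta_mx i 0 : 'cV[F]_n) = 0.
Proof. by move=> ne; rewrite mul_delta_mx_0 // eq_sym. Qed.

Lemma center_SL : Z = (SL n F :&: scalars k.+2 F)%g.
Proof.
apply/setP=> x; rewrite !inE; apply: andb_id2l => SLx.
apply/centP/idP => [cx|sx y _]; last by apply: scalars_cent; rewrite inE.
apply: scalar_mx_comm_delta => i j ne_ij.
pose u : 'cV[F]_n := delta_mx i 0; pose w : 'rV[F]_n := delta_mx 0 j.
have wu0 : w *m u = 0 by apply: delta_mul0.
have : commute x (tvg u w) by apply: cx; apply/tvs_SL/tvg_tvs.
move/(congr1 (@GLval n F)); rewrite !GL_MxE tvgE // /tv mulmxDl mulmxDr mulmx1 mul1mx.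
by rewrite mul_delta_mx => /addrI.
Qed.

Lemma center_scalars x : x \in Z -> x \in scalars k.+2 F.
Proof. by rewrite center_SL => /setIP[]. Qed.

Lemma GL_norm_center x : x \in 'N(Z).
Proof.
rewrite inE; apply/subsetP=> _ /imsetP[y Zy ->].
by rewrite conjgE (scalars_cent _ (center_scalars Zy)) mulKg.
Qed.

Lemma cosetM x y : coset Z (x * y)%g = (coset Z x * coset Z y)%g.
Proof. exact: (coset_morphM (GL_norm_center x) (GL_norm_center y)). Qed.

Lemma coset_1 : coset Z (1%g : gl) = 1%g.
Proof. exact: coset_id (group1 _). Qed.

Lemma cosetV x : coset Z x^-1%g = (coset Z x)^-1%g.
Proof. by apply: (mulgI (coset Z x)); rewrite -cosetM !mulgV coset_1. Qed.

Lemma cosetX x i : coset Z (x ^+ i)%g = (coset Z x ^+ i)%g.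
Proof. by elim: i => [|i IH]; rewrite ?coset_1 // !expgS cosetM IH. Qed.

Lemma cosetJ x y : coset Z (x ^ y)%g = (coset Z x ^ coset Z y)%g.
Proof. by rewrite !conjgE !cosetM cosetV. Qed.

Lemma coset_eqE x y : (coset Z x == coset Z y) = (x * y^-1 \in Z)%g.
Proof.
rewrite eq_mulgV1 -cosetV -cosetM; apply/eqP/idP => [|/coset_id//].
exact: coset_idr (GL_norm_center _).
Qed.

Lemma coset_eq_scale x y : coset Z x = coset Z y ->
  exists2 c, c != 0 & GLval x = c *: GLval y.
Proof.
move/eqP; rewrite coset_eqE => /center_scalars/scalarsP[c nz xE]; exists c => //.
by rewrite -[x](mulgKV y) GL_MxE xE mul_scalar_mx.
Qed.

Lemma coset_scale_eq x y c : x \in SL n F -> y \in SL n F ->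
  GLval x = c *: GLval y -> coset Z x = coset Z y.
Proof.
rewrite !SLE => /eqP dx /eqP dy xE; apply/eqP; rewrite coset_eqE center_SL.
apply/setIP; split; first by rewrite SLE GL_MxE GL_VxE det_mulmx det_inv dx dy invr1 mulr1.
by rewrite inE GL_MxE GL_VxE xE -scalemxAl mulmxV ?GLunit // scale_scalar_mx scalar_mx_is_scalar.
Qed.

Lemma PSL_coset x : x \in SL n F -> coset Z x \in S.
Proof. by move=> SLx; apply: mem_quotient. Qed.

Lemma PSLP s : reflect (exists2 x, x \in SL n F & s = coset Z x) (s \in S).
Proof.
apply: (iffP idP) => [/morphimP[x _ SLx ->]|[x SLx ->]]; last exact: PSL_coset.
by exists x.
Qed.

(** If [c != 1], the nonzero scalar [1 - c] would be a sum of two matrices of rank at most one,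
    which size at least 3 forbids. *)
Lemma tvs_scale_inj x y c : x \in tvs k.+2 F -> y \in tvs k.+2 F ->
  GLval x = c *: GLval y -> x = y.
Proof.
move=> /tvsP[u [w [wu0 xE]]] /tvsP[u' [w' [wu0' yE]]] xy.
have [c1|nc1] := eqVneq c 1; first by apply: GLval_inj; rewrite xy c1 scale1r.
have E : (1 - c)%:M = (c *: u') *m w' + (- u) *m w.
  move: xy; rewrite xE yE /tv scalerDr scalemx1 -scalemxAl mulNmx => E.
  by rewrite raddfB /= (canRL (addrK _) E) addrAC [c%:M + _]addrC addrK.
have : (\rank ((1 - c)%:M : 'M[F]_n) <= 1 + 1)%N.
  by rewrite E (leq_trans (mxrank_add _ _)) // leq_add ?rank1_mul.
by rewrite mxrank_unit // scalar_unitmx // subr_eq0 eq_sym.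
Qed.

Lemma tvs_coset_inj : {in tvs k.+2 F &, injective (coset Z)}.
Proof. by move=> x y Tx Ty /coset_eq_scale[c _ /tvs_scale_inj->]. Qed.

(** The axis is moved first; the centre is then moved by a block matrix that fixes the row
    [delta_mx 0 0], so that the axis stays in place. *)
Lemma tv_standard u w : w *m u = 0 -> u != 0 -> w != 0 ->
  exists h : gl, tv u w = invmx (GLval h) *m tv (delta_mx 1 0) (delta_mx 0 0) *m GLval h.
Proof.
move=> wu0 nzu nzw; have [A uA AE] := row_transitive nzw.
pose u1 := A *m u; have nzu1 : u1 != 0.
  by apply: contra nzu => /eqP u10; rewrite -(mulKmx uA u) -/u1 u10 mulmx0.
have u1E : u1 = col_mx (0 : 'M_1) (dsubmx (u1 : 'cV_(1 + k.+2))).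
  rewrite -[LHS](@vsubmxK _ 1 k.+2 1 u1); have -> // : usubmx (u1 : 'cV_(1 + k.+2)) = 0.
  apply/matrixP=> i j; rewrite !ord1 !mxE.
  have /matrixP/(_ 0 0) : delta_mx 0 0 *m u1 = 0 :> 'M_1 by rewrite mulmxA AE wu0.
  rewrite -rowE !mxE => E; rewrite -[RHS]E; apply: eq_bigr => s _; congr (A _ _ * _).
  exact: val_inj.
have [|B uB BE] := @col_transitive F k.+1 (dsubmx (u1 : 'cV_(1 + k.+2))).
  by apply: contra nzu1 => /eqP e0; rewrite u1E e0 col_mx0.
pose M : 'M[F]_n := block_mx (1%:M : 'M_1) 0 0 B.
have uM : M \in unitmx by rewrite unitmxE /M (@det_ublock _ 1 k.+2) det1 mul1r -unitmxE.
exists (mkGL (M *m A)); have uMA : M *m A \in unitmx by rewrite unitmx_mul uM.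
rewrite mkGLK // tv_conj //; congr tv.
  have Mu1 : M *m u1 = col_mx (0 : 'M_1) (delta_mx 0 0 : 'cV_k.+2).
    rewrite u1E /M (@mul_block_col _ 1 k.+2 1 k.+2 1).
    by rewrite !mul0mx mulmx0 addr0 add0r BE.
  apply: (can_inj (mulKmx uMA)); rewrite mulKVmx // -mulmxA -/u1 Mu1.
  apply/matrixP=> i j; rewrite !mxE; case: splitP => s; rewrite !mxE => Es.
    by rewrite -val_eqE /= Es !ord1.
  by rewrite -!val_eqE /= Es.
rewrite mulmxA -AE; congr (_ *m _); rewrite -rowE.
apply/rowP=> j; rewrite !mxE; case: splitP => s //; rewrite !mxE !ord1 eqxx => _.
by case: splitP => t; rewrite mxE => Et; rewrite -!val_eqE /= Et ?ord1.
Qed.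

Lemma tvs_conj x y : x \in tvs k.+2 F -> y \in tvs k.+2 F -> x != 1%g -> y != 1%g ->
  exists h : gl, (x ^ h)%g = y.
Proof.
pose r : gl := tvg (delta_mx 1 0) (delta_mx 0 0).
have st z : z \in tvs k.+2 F -> z != 1%g -> exists h, z = (r ^ h)%g.
  case/tvsP=> u [w [wu0 zE]] nz; have [||h hE] := tv_standard wu0.
  - by apply: contraNneq nz => u0; apply/eqP/GLval_inj; rewrite zE /tv u0 mul0mx addr0.
  - by apply: contraNneq nz => w0; apply/eqP/GLval_inj; rewrite zE /tv w0 mulmx0 addr0.
  exists h; apply: GLval_inj; rewrite zE hE GL_J tvgE //; exact: delta_mul0.
move=> Tx Ty nx ny; have [h xE] := st x Tx nx; have [h' yE] := st y Ty ny.
by exists (h^-1 * h')%g; rewrite xE yE conjgM conjgK.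
Qed.

(** By finiteness [g] maps SL_n onto itself, hence also its centre, and so descends to cosets. It
    serves for field automorphisms and for inverse transposition. *)
Lemma induced_aut (g : gl -> gl) :
  {morph g : x y / (x * y)%g} -> injective g -> (forall x, x \in SL n F -> g x \in SL n F) ->
  exists2 a, a \in Aut S & forall x, x \in SL n F -> a (coset Z x) = coset Z (g x).
Proof.
move=> gM gI gS; have g1 : g 1%g = 1%g by apply: (mulgI (g 1%g)); rewrite -gM !mulg1.
have gV x : g x^-1%g = (g x)^-1%g.
  by apply: (mulgI (g x)); rewrite -gM !mulgV.
have gSE : g @: SL n F = SL n F.
  apply/eqP; rewrite eqEcard card_imset // leqnn andbT.
  by apply/subsetP=> _ /imsetP[x SLx ->]; apply: gS.
have gZ z : z \in Z -> g z \in Z.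
  move=> /centerP[SLz cz]; apply/centerP; split; first exact: gS.
  move=> y SLy; have /imsetP[x SLx ->] : y \in g @: SL n F by rewrite gSE.
  by rewrite /commute -!gM cz.
have gZE z : (g z \in Z) = (z \in Z).
  have gZi : g @: Z = Z.
    apply/eqP; rewrite eqEcard card_imset // leqnn andbT.
    by apply/subsetP=> _ /imsetP[x Zx ->]; apply: gZ.
  by apply/idP/idP=> [|/gZ//]; rewrite -{1}gZi => /imsetP[y Zy /gI->].
pose f (s : coset_of Z) := coset Z (g (repr s)).
have fE x : f (coset Z x) = coset Z (g x).
  apply/eqP; rewrite /f coset_eqE -gV -gM gZE -coset_eqE coset_reprK //.
have fM : {in S &, {morph f : s t / (s * t)%g}}.
  by move=> _ _ /PSLP[x SLx ->] /PSLP[y SLy ->]; rewrite -cosetM !fE gM cosetM.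
pose fm := Morphism fM.
have fI : 'injm fm.
  apply/injmP=> _ _ /PSLP[x SLx ->] /PSLP[y SLy ->] /=; rewrite !fE => /eqP.
  by rewrite coset_eqE -gV -gM gZE -coset_eqE => /eqP.
have fS : fm @* S = S.
  apply/eqP; rewrite eqEcard card_injm // leqnn andbT.
  apply/subsetP=> _ /morphimP[_ _ /PSLP[x SLx ->] ->] /=; rewrite fE.
  by apply/PSL_coset/gS.
exists (aut fI fS); first exact: Aut_aut.
by move=> x SLx; rewrite autE ?PSL_coset //= fE.
Qed.

Lemma GL_norm_PSL x : coset Z x \in 'N(S).
Proof.
have: coset Z x \in ('GL_n[F] / Z)%g by apply: mem_quotient; rewrite inE.
by apply/subsetP; apply: quotient_norms; apply: SL_normal.
Qed.

Definition cj x := conj_aut S (coset Z x).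

Lemma cjE x y : y \in SL n F -> cj x (coset Z y) = coset Z (y ^ x)%g.
Proof. by move=> SLy; rewrite /cj norm_conj_autE ?PSL_coset ?GL_norm_PSL // -cosetJ. Qed.

Lemma cj_Aut x : cj x \in Aut S.
Proof. exact: Aut_aut. Qed.

Lemma Aut_eqP a b : a \in Aut S -> b \in Aut S ->
  (forall x, x \in SL n F -> a (coset Z x) = b (coset Z x)) -> a = b.
Proof. by move=> Aa Ab ab; apply: (eq_Aut Aa Ab) => _ /PSLP[x SLx ->]; apply: ab. Qed.

Lemma cjM : {in 'GL_n[F] &, {morph cj : x y / (x * y)%g}}.
Proof.
move=> x y _ _; apply: Aut_eqP; rewrite ?groupM ?cj_Aut // => z SLz.
by rewrite permM !cjE ?SL_J // conjgM.
Qed.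
Canonical cj_morphism := Morphism cjM.

(** Since a coset determines its transvection, a trivial [cj x] makes [x] commute with elementary
    transvections as matrices, not only modulo scalars. *)
Lemma cj_eq1 x : (cj x == 1%g) = (x \in scalars k.+2 F).
Proof.
apply/eqP/idP=> [cx1|sx]; last first.
  apply: Aut_eqP; rewrite ?group1 ?cj_Aut // => y SLy.
  by rewrite cjE // perm1 conjgE -(scalars_cent y sx) mulKg.
rewrite inE; apply: scalar_mx_comm_delta => i j ne_ij.
pose u : 'cV[F]_n := delta_mx i 0; pose w : 'rV[F]_n := delta_mx 0 j.
have wu0 : w *m u = 0 by apply: delta_mul0.
have : cj x (coset Z (tvg u w)) = coset Z (tvg u w) by rewrite cx1 perm1.
rewrite cjE ?tvs_SL ?tvg_tvs // => /tvs_coset_inj; rewrite ?tvsJ ?tvg_tvs // => /(_ isT isT).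
move=> E; have : commute x (tvg u w) by rewrite /commute [RHS]conjgC E.
move/(congr1 (@GLval n F)); rewrite !GL_MxE tvgE // /tv mulmxDl mulmxDr mulmx1 mul1mx.
by rewrite mul_delta_mx => /addrI.
Qed.

Lemma ker_cj : 'ker cj_morphism = scalars k.+2 F.
Proof. by apply/setP=> x; rewrite !inE /= cj_eq1 inE. Qed.

Lemma PGL_aut_ofE (A : {set gl}) : PGL_aut_of A = (cj_morphism @* A)%g.
Proof.
rewrite /PGL_aut_of; apply/setP=> a; apply/morphimP/morphimP.
  by case=> _ _ /morphimP[x Nx Ax ->] ->; exists x; rewrite ?inE.
by case=> x _ Ax ->; exists (coset Z x) => //; [exact: GL_norm_PSL | exact: (mem_morphim _ (GL_norm_center x))].
Qed.

Lemma cj_PGL x : cj x \in PGL_aut n F.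
Proof.
rewrite /PGL_aut PGL_aut_ofE; apply: (mem_morphim cj_morphism); exact: in_setT.
Qed.

Lemma card_cj_image (A : {group gl}) : scalars k.+2 F \subset A ->
  (#|cj_morphism @* A| * #|F|.-1 = #|A|)%N.
Proof.
by move=> sA; rewrite card_morphim /= setTI ker_cj mulnC -(card_scalars k.+2) Lagrange.
Qed.

End PSLbasics.

Lemma pchar_exp_inj (F : fieldType) p j : p \in [pchar F] -> injective (fun a : F => a ^+ (p ^ j)).
Proof.
move=> chF; elim: j => [|j IH] a b //=; rewrite expnSr !exprM => E.
by apply: IH; apply: (fmorph_inj (pFrobenius_aut chF)); rewrite /= !pFrobenius_autE.
Qed.

(** * Automorphisms preserve transvections *)

Section TransvectionClass.
Variables (k : nat) (F : finFieldType) (p : nat).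
Hypothesis chF : p \in [pchar F].
Local Notation n := k.+3.
Local Notation gl := {'GL_n[F]}.
Local Notation Z := 'Z(SL_group n F).
Local Notation S := (PSL n F).
Implicit Types (x y : gl) (A : 'M[F]_n) (u : 'cV[F]_n) (w : 'rV[F]_n).
Local Notation tvs := (tvs k.+2 F).

Lemma tvX u w i : w *m u = 0 -> tv u w ^+ i = tv (i%:R *: u) w.
Proof.
move=> wu0; elim: i => [|i IH]; first by rewrite /tv scale0r mul0mx addr0.
rewrite exprS IH -[LHS]/(tv u w *m _) tvM; last by rewrite -scalemxAr wu0 scaler0.
by rewrite -{1}[u]scale1r -scalerDl mulrS.
Qed.

Lemma tvs_expp x : x \in tvs -> (x ^+ p)%g = 1%g.
Proof.
case/tvsP=> u [w [wu0 xE]]; apply: GLval_inj; rewrite GL_X xE tvX //.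
by rewrite (pcharf0 chF) scale0r /tv mul0mx addr0.
Qed.

Lemma Tc_pgroup w : p.-group (Tc w).
Proof.
apply/pgroupP=> r pr_r /Cauchy-/(_ pr_r)[x Tx ox].
have /eqP xp := tvs_expp (subsetP (Tc_sub w) _ Tx); move: xp; rewrite -order_dvdn ox.
by rewrite dvdn_prime2 ?(pcharf_prime chF) // => /eqP->; rewrite inE.
Qed.

(** A description purely in terms of the group, hence invariant under every automorphism; it turns
    out to be the set of cosets of nontrivial transvections. *)
Definition sylow_central : {set coset_of Z} :=
  [set s in S | (s != 1%g) && [exists P : {group coset_of Z}, p.-Sylow(S) P && (s \in 'Z(P))]].

Lemma sylow_centralP s : reflect
  (exists2 P : {group coset_of Z}, p.-Sylow(S) P & s \in 'Z(P) /\ s != 1%g) (s \in sylow_central).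
Proof.
rewrite inE; apply: (iffP and3P) => [[_ n1 /existsP[P /andP[sP zP]]]|[P sP [zP n1]]].
  by exists P.
split=> //; last by apply/existsP; exists P; rewrite sP.
by case/setIP: zP => Ps _; apply: (subsetP (pHall_sub sP)).
Qed.

Lemma sylow_central_aut a s : a \in Aut S -> s \in sylow_central -> a s \in sylow_central.
Proof.
move=> Aa /sylow_centralP[P sP [zP n1]]; pose f := autm Aa.
have sPS := pHall_sub sP.
apply/sylow_centralP; exists (f @* P)%G.
  by rewrite -{1}(im_autm Aa); apply: morphim_pHall.
rewrite -injm_center ?injm_autm // -{1}(autmE Aa) mem_morphim //; last first.
  by apply: (subsetP sPS); case/setIP: zP.
split=> //; rewrite -(autmE Aa) morph_injm_eq1 ?injm_autm //.
by apply: (subsetP sPS); case/setIP: zP.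
Qed.

Let e0 : 'rV[F]_n := delta_mx 0 0.
Let d0 : 'cV[F]_n := delta_mx 0 0.
Let u1 : 'cV[F]_n := delta_mx 1 0.

Lemma tvs_nontrivial : exists2 x, x \in tvs & x != 1%g.
Proof.
have e0u1 : e0 *m u1 = 0 by apply: delta_mul0.
exists (tvg u1 e0); first exact: tvg_tvs.
apply/eqP=> /(congr1 (@GLval n F)); rewrite tvgE // /tv GL_1E => /(canRL (addKr _)).
rewrite addNr mul_delta_mx => /matrixP/(_ 1 0); rewrite !mxE !eqxx => /eqP.
by rewrite oner_eq0.
Qed.

Lemma sylow_central_neq0 : exists s, s \in sylow_central.
Proof.
have [P sP] := Sylow_exists p S; have [x Tx nx1] := tvs_nontrivial.
have ntP : P :!=: 1%g.
  apply: contra nx1 => /eqP P1; pose Q := <[coset Z x]>%G.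
  have pQ : p.-group Q.
    apply: (@pnat_dvd _ p); last exact: pnat_id (pcharf_prime chF).
    by rewrite order_dvdn -cosetX tvs_expp // coset_1.
  have [|y _] := Sylow_subJ sP _ pQ; first by rewrite cycle_subG PSL_coset ?tvs_SL.
  rewrite P1 conjs1g cycle_subG => /set1P E; apply/eqP.
  by apply: tvs_coset_inj; rewrite ?tvs1 // coset_1.
have : 'Z(P) != 1%g by rewrite center_nil_eq1 ?(pgroup_nil (pHall_pgroup sP)).
case/trivgPn=> s Zs ns1; exists s; apply/sylow_centralP; exists P => //.
Qed.

(* Commuting with all 1 + u e_0, for u in the kernel of e_0, forces y to be a scalar on
   that kernel. *)
Lemma cent_Tc y : (forall x, x \in Tc e0 -> commute x y) ->
  exists c v, GLval y = c%:M + v *m e0.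
Proof.
move=> cy; pose c := (e0 *m GLval y *m d0) 0 0.
have e0d0 : e0 *m d0 = 1%:M.
  by rewrite mul_delta_mx; apply/matrixP=> i j; rewrite !mxE !ord1.
have yu u : e0 *m u = 0 -> GLval y *m u = c *: u.
  move=> eu0; have /cy/(congr1 (@GLval n F)) : tvg u e0 \in Tc e0.
    by apply/TcP; exists u; rewrite ?tvgE.
  rewrite !GL_MxE tvgE // /tv mulmxDl mulmxDr mulmx1 mul1mx => /addrI/(congr1 (mulmx^~ d0)).
  rewrite -!mulmxA e0d0 mulmx1 => <-; rewrite mulmxA.
  by rewrite -mulmxA [X in u *m X]mx11_scalar mul_mx_scalar /c mulmxA.
exists c, ((GLval y - c%:M) *m d0).
have E : (GLval y - c%:M) *m (1%:M - d0 *m e0) = 0.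
  apply/matrixP=> i j; have /yu/matrixP/(_ i 0) : e0 *m col j (1%:M - d0 *m e0) = 0.
    by rewrite colE mulmxA mulmxBr mulmx1 mulmxA e0d0 mul1mx subrr mul0mx.
  move=> E; rewrite mulmxBl mul_scalar_mx; move: E; rewrite !colE mulmxA scalemxAl -!colE !mxE.
  by move=> ->; rewrite subrr.
move: E; rewrite mulmxBr mulmx1 mulmxA => /subr0_eq <-.
by rewrite addrC subrK.
Qed.

(** After conjugation the Sylow subgroup contains the image of [Tc e0], so a representative [y] of
    [s] centralises [Tc e0] and equals [c + v e0]. Its eigenvalues [c] and [c + e0 v] have the same
    [p ^ j]-th power because [s] has [p]-power order; by injectivity of Frobenius [e0 v = 0], and
    [y] is a scalar times a transvection. *)
Lemma sylow_central_sub s : s \in sylow_central ->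
  exists2 x, x \in tvs & x != 1%g /\ s = coset Z x.
Proof.
case/sylow_centralP=> P sP [zP n1]; pose Q := (Tc e0 / Z)%G.
have sQS : Q \subset S.
  by apply: quotientS; apply/subsetP=> x Tx; apply: tvs_SL (subsetP (Tc_sub _) _ Tx).
have pQ : p.-group Q by apply: quotient_pgroup (Tc_pgroup _).
have [_ /PSLP[x SLx ->] sQP] := Sylow_subJ sP sQS pQ.
have /PSLP[y0 SLy0 sE] : s \in S by apply: (subsetP (pHall_sub sP)); case/setIP: zP.
pose y := (y0 ^ x)%g; have SLy : y \in SL n F by rewrite SL_J.
have yE : coset Z y = (s ^ coset Z x)%g by rewrite cosetJ sE.
have cy t : t \in Tc e0 -> commute t y.
  move=> Tt; have tt : t \in tvs by apply: (subsetP (Tc_sub _) _ Tt).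
  have : coset Z t \in (P :^ coset Z x)%g.
    apply: (subsetP sQP); apply: mem_morphim => //; exact: GL_norm_center.
  case/imsetP=> r Pr tE.
  have : (coset Z t ^ coset Z y = coset Z t)%g.
    rewrite yE tE -conjJg; congr (_ ^ _)%g; apply/conjg_fixP.
    by apply/commgP; apply/commute_sym; case/setIP: zP => _ /centP; apply.
  rewrite -cosetJ => /tvs_coset_inj-/(_ (tvsJ _ tt) tt) E.
  by rewrite /commute [LHS]conjgC E.
have [c [v yv]] := cent_Tc cy.
have nz_c : c != 0.
  apply/eqP=> c0; have : GLval y *m u1 = 0.
    by rewrite yv c0 mulmxDl mul_scalar_mx scale0r add0r -mulmxA delta_mul0 ?mulmx0.
  move/(congr1 (mulmx (invmx (GLval y)))); rewrite mulKmx ?GLunit // mulmx0.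
  by move/matrixP/(_ 1 0); rewrite !mxE !eqxx => /eqP; rewrite oner_eq0.
pose m := (e0 *m v) 0 0.
have e0v : e0 *m v = m%:M by rewrite -mx11_scalar.
have yu1 i : GLval y ^+ i *m u1 = c ^+ i *: u1.
  elim: i => [|i IH]; first by rewrite mul1mx scale1r.
  rewrite exprSr -mulmxA yv mulmxDl mul_scalar_mx -mulmxA delta_mul0 // mulmx0 addr0 -yv.
  by rewrite -scalemxAr IH scalerA -exprS.
have e0y i : e0 *m GLval y ^+ i = (c + m) ^+ i *: e0.
  elim: i => [|i IH]; first by rewrite mulmx1 scale1r.
  rewrite exprS mulmxA yv mulmxDr mul_mx_scalar mulmxA e0v mul_scalar_mx -scalerDl -yv.
  by rewrite -scalemxAl IH scalerA -exprS.
have [j sj] : exists j, (s ^+ (p ^ j) = 1)%g.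
  have : p.-elt s by apply: (mem_p_elt (pHall_pgroup sP)); case/setIP: zP.
  by case/p_natP=> j oj; exists j; rewrite -oj expg_order.
have [d _ yd] : exists2 d, d != 0 & GLval y ^+ (p ^ j) = d%:M.
  have : coset Z (y ^+ (p ^ j))%g = 1%g by rewrite cosetX yE -conjXg sj conj1g.
  move/(coset_idr (GL_norm_center _))/center_scalars/scalarsP => [d nz dE].
  by exists d => //; rewrite -dE GL_X.
have m0 : m = 0.
  have : c ^+ (p ^ j) = (c + m) ^+ (p ^ j).
    have := yu1 (p ^ j)%N; have := e0y (p ^ j)%N; rewrite yd mul_mx_scalar mul_scalar_mx.
    move=> /matrixP/(_ 0 0); rewrite !mxE !eqxx !mulr1 => <-.
    by move=> /matrixP/(_ 1 0); rewrite !mxE !eqxx !mulr1.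
  by move/(pchar_exp_inj chF)/eqP; rewrite -subr_eq0 opprD addNKr oppr_eq0 => /eqP.
have e0v0 : e0 *m (c^-1 *: v) = 0.
  by rewrite -scalemxAr e0v m0 raddf0 scaler0.
pose t := tvg (c^-1 *: v) e0; have Tt : t \in tvs by apply: tvg_tvs.
have yt : coset Z y = coset Z t.
  apply: (coset_scale_eq SLy (tvs_SL Tt) (c := c)).
  rewrite /t tvgE // /tv yv scalerDr.
  by rewrite scalemx1 -scalemxAl scalerA divff // scale1r.
have sE' : s = coset Z (t ^ x^-1)%g by rewrite cosetJ cosetV -yt yE conjgK.
exists (t ^ x^-1)%g; first exact: tvsJ.
split=> //; apply: contra n1 => /eqP t1; rewrite sE' t1; apply/eqP; exact: coset_1.
Qed.

(** One element of the invariant set exists and is a transvection; conjugation by GL_n acts by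
    automorphisms and reaches all the others. *)
Lemma tvs_sylow_central x : x \in tvs -> x != 1%g -> coset Z x \in sylow_central.
Proof.
move=> Tx nx1; have [s cs] := sylow_central_neq0.
have [y Ty [ny1 sE]] := sylow_central_sub cs.
have [h <-] := tvs_conj Ty Tx ny1 nx1.
by rewrite -cjE ?tvs_SL // -sE; apply: sylow_central_aut (cj_Aut _) cs.
Qed.

Section Lift.
Variable a : {perm coset_of Z}.
Hypothesis Aa : a \in Aut S.

Lemma aut_tvs x : x \in tvs -> exists2 y, y \in tvs & coset Z y = a (coset Z x).
Proof.
move=> Tx; have [->|nx1] := eqVneq x 1%g.
  by exists 1%g; rewrite ?tvs1 // coset_1 -(autmE Aa) morph1.
by have [y Ty [_ E]] := sylow_central_sub (sylow_central_aut Aa (tvs_sylow_central Tx nx1)); exists y.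
Qed.

(** The default 1 is itself a transvection, so [lift_tvs] holds for every [x]. *)
Definition lift x : gl := odflt 1%g [pick y in tvs | coset Z y == a (coset Z x)].

Lemma lift_tvs x : lift x \in tvs.
Proof. by rewrite /lift; case: pickP => [y /andP[]|_] //=; rewrite tvs1. Qed.

Lemma liftE x : x \in tvs -> coset Z (lift x) = a (coset Z x).
Proof.
move=> Tx; rewrite /lift; case: pickP => [y /andP[_ /eqP]|no] //=.
by have [y Ty yE] := aut_tvs Tx; have := no y; rewrite Ty yE eqxx.
Qed.

Lemma lift_inj : {in tvs &, injective lift}.
Proof.
move=> x y Tx Ty /(congr1 (coset Z)); rewrite !liftE // => /perm_inj; exact: tvs_coset_inj.
Qed.

Lemma aut_coset_M x y : x \in SL n F -> y \in SL n F ->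
  a (coset Z x * coset Z y)%g = (a (coset Z x) * a (coset Z y))%g.
Proof. by move=> SLx SLy; rewrite -(autmE Aa) morphM ?PSL_coset. Qed.

(* If x, y commute then the product of the lifts is unipotent, so the central factor
   relating it to the lift of xy is 1. *)
Lemma liftM x y : x \in tvs -> y \in tvs -> (x * y)%g \in tvs -> commute x y ->
  lift (x * y)%g = (lift x * lift y)%g.
Proof.
move=> Tx Ty Txy cxy.
have cl : commute (lift x) (lift y).
  have : coset Z (lift y ^ lift x)%g = coset Z (lift y).
    rewrite cosetJ !liftE // conjgE -!aut_coset_M ?tvs_SL //.
    apply: (mulgI (a (coset Z x))); rewrite mulKVg -!aut_coset_M ?tvs_SL //.
    by rewrite -!cosetM cxy.
  move/tvs_coset_inj; rewrite tvsJ ?lift_tvs // => /(_ isT isT) E.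
  by apply/commute_sym; rewrite /commute [LHS]conjgC E.
have E : coset Z (lift x * lift y)%g = coset Z (lift (x * y)%g).
  by rewrite cosetM !liftE // cosetM aut_coset_M ?tvs_SL.
have [c nz cE] := coset_eq_scale E.
have : (GLval (lift x * lift y)%g) ^+ p = 1.
  by rewrite -GL_X expgMn // !tvs_expp ?lift_tvs // mulg1.
rewrite cE exprZn -GL_X tvs_expp ?lift_tvs // GL_1E => /matrixP/(_ 0 0).
rewrite !mxE !eqxx mulr1 => cp1.
have c1 : c = 1.
  by apply: (@pchar_exp_inj F p 1 chF); rewrite /= expn1 cp1 expr1n.
by apply: GLval_inj; rewrite cE c1 scale1r.
Qed.

End Lift.
End TransvectionClass.

(** * Incidence of points and hyperplanes in terms of transvection groups *)

Section Geometry.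
Variables (k : nat) (F : finFieldType).
Local Notation n := k.+3.
Local Notation gl := {'GL_n[F]}.
Implicit Types (x y : gl) (A : 'M[F]_n) (u v : 'cV[F]_n) (w : 'rV[F]_n) (X : {set gl}).
Local Notation tvs := (tvs k.+2 F).

Lemma row_separate w w' : ~~ (w' <= w)%MS ->
  exists2 v, w *m v = 0 & w' *m v = 1%:M.
Proof.
rewrite submxE => /eqP/eqP/rV0Pn[j nz].
have E (z : 'rV[F]_n) : z *m col j (cokermx w) = ((z *m cokermx w) 0 j)%:M.
  apply/matrixP=> a b; rewrite !ord1 !mxE eqxx mulr1n.
  by apply: eq_bigr => l _; rewrite mxE.
exists (((w' *m cokermx w) 0 j)^-1 *: col j (cokermx w)).
  have E0 : (w *m cokermx w) 0 j = 0 by rewrite mulmx_coker mxE.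
  by rewrite -scalemxAr E E0 raddf0 scaler0.
by rewrite -scalemxAr E scale_scalar_mx mulVf.
Qed.

Lemma TcZ c w : c != 0 -> Tc (c *: w) = Tc w.
Proof.
move=> nz; apply/setP=> x; apply/TcP/TcP=> [[u wu0 xE]|[u wu0 xE]].
  exists (c *: u); first by rewrite -scalemxAr scalemxAl.
  by rewrite xE /tv -scalemxAl scalemxAr.
exists (c^-1 *: u); first by rewrite -scalemxAl -scalemxAr wu0 !scaler0.
by rewrite xE /tv -scalemxAl -scalemxAr scalerA mulVf // scale1r.
Qed.

Lemma TaZ c u : c != 0 -> Ta (c *: u) = Ta u.
Proof.
move=> nz; apply/setP=> x; apply/TaP/TaP=> [[w wu0 xE]|[w wu0 xE]].
  exists (c *: w); first by rewrite -scalemxAl scalemxAr.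
  by rewrite xE /tv -scalemxAl scalemxAr.
exists (c^-1 *: w); first by rewrite -scalemxAl -scalemxAr wu0 !scaler0.
by rewrite xE /tv -scalemxAl -scalemxAr scalerA mulfV // scale1r.
Qed.

Lemma tv_eq1 x u w : GLval x = tv u w -> (x == 1%g) = ((u == 0) || (w == 0)).
Proof.
move=> xE; rewrite -(inj_eq (@GLval_inj _ _)) xE GL_1E /tv.
rewrite -[X in _ == X](addr0 (1%:M : 'M[F]_n)) (inj_eq (addrI _)).
apply/eqP/orP=> [|[]/eqP->]; rewrite ?mul0mx ?mulmx0 //.
have [->|nzu] := eqVneq u 0; first by left.
move=> uw0; right; have [i nz] : exists i, u i 0 != 0 by case/cV0Pn: nzu => i; exists i.
apply/eqP/rowP=> j; move/matrixP/(_ i j): uw0; rewrite !mxE big_ord1 => /eqP.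
by rewrite mulf_eq0 (negPf nz) /= => /eqP.
Qed.

Lemma Tc_meet x w w' : x != 1%g -> x \in Tc w -> x \in Tc w' -> Tc w = Tc w'.
Proof.
move=> nx1 /TcP[u wu0 xE] /TcP[u' wu0' xE'].
have := nx1; rewrite (tv_eq1 xE) negb_or => /andP[nzu nzw].
have [i nz] : exists i, u i 0 != 0 by case/cV0Pn: nzu => i; exists i.
have wE : w = (u' i 0 / u i 0) *: w'.
  apply/rowP=> j; move: xE; rewrite xE' => /addrI/matrixP/(_ i j); rewrite !mxE !big_ord1.
  by move=> E; rewrite mulrAC E mulrAC divff // mul1r.
rewrite {1}wE TcZ //; apply: contra nzw => /eqP c0; by rewrite wE c0 scale0r.
Qed.

Lemma Ta_meet x u u' : x != 1%g -> x \in Ta u -> x \in Ta u' -> Ta u = Ta u'.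
Proof.
move=> nx1 /TaP[w wu0 xE] /TaP[w' wu0' xE'].
have := nx1; rewrite (tv_eq1 xE) negb_or => /andP[nzu nzw].
have [i nz] : exists i, w 0 i != 0 by case/rV0Pn: nzw => i; exists i.
have uE : u = (w' 0 i / w 0 i) *: u'.
  apply/colP=> j; move: xE; rewrite xE' => /addrI/matrixP/(_ j i); rewrite !mxE !big_ord1.
  by move=> E; rewrite mulrAC [w' 0 i * _]mulrC E mulfK.
rewrite {1}uE TaZ //; apply: contra nzu => /eqP c0; by rewrite uE c0 scale0r.
Qed.

(** Incidence of a point with a hyperplane is read off from a common nontrivial transvection, a
    condition that [lift] transports. *)
Lemma TcTa_meet x u w : x != 1%g -> x \in Tc w -> x \in Ta u -> w *m u = 0.
Proof.
move=> nx1 /TcP[u' wu0 xE] /TaP[w' wu0' xE'].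
have := nx1; rewrite (tv_eq1 xE) negb_or => /andP[nzu nzw].
have := nx1; rewrite (tv_eq1 xE') negb_or => /andP[nzu' nzw'].
have [i nz] : exists i, w 0 i != 0 by case/rV0Pn: nzw => i; exists i.
have uE : u' = (w' 0 i / w 0 i) *: u.
  apply/colP=> j; move: xE; rewrite xE' => /addrI/matrixP/(_ j i); rewrite !mxE !big_ord1.
  by move=> E; rewrite mulrAC [w' 0 i * _]mulrC E mulfK.
have nzc : w' 0 i / w 0 i != 0 by apply: contra nzu => /eqP c0; rewrite uE c0 scale0r.
move: wu0; rewrite uE -scalemxAr => /(congr1 ( *:%R (w' 0 i / w 0 i)^-1)).
by rewrite scalerA mulVf // scale1r scaler0.
Qed.

Lemma tvg_neq1 u w : w *m u = 0 -> u != 0 -> w != 0 -> tvg u w != 1%g.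
Proof. by move=> wu0 nzu nzw; rewrite (tv_eq1 (tvgE wu0)) negb_or nzu. Qed.

Lemma tvg_Tc u w : w *m u = 0 -> tvg u w \in Tc w.
Proof. by move=> wu0; apply/TcP; exists u; rewrite ?tvgE. Qed.

Lemma tvg_Ta u w : w *m u = 0 -> tvg u w \in Ta u.
Proof. by move=> wu0; apply/TaP; exists w; rewrite ?tvgE. Qed.

(** The product minus 1 is [u w + (u' + u (w u')) w'] and must have rank at most one. If [w] and
    [w'] are independent, vectors dual to them show that both columns are multiples of one column
    [u2], so [u'] is a multiple of [u]. *)
Lemma tvs_mul_tvs x y u w : GLval x = tv u w -> x != 1%g -> y \in tvs ->
  (x * y)%g \in tvs -> y \in Tc w \/ y \in Ta u.
Proof.
move=> xE nx1 /tvsP[u' [w' [wu0' yE]]] /tvsP[u2 [w2 [_ zE]]].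
have := nx1; rewrite (tv_eq1 xE) negb_or => /andP[nzu nzw].
case: (boolP (w' <= w)%MS) => [/sub_rVP[c w'E]|nw'].
  left; apply/TcP; have [c0|nzc] := eqVneq c 0.
    by exists 0; rewrite ?mulmx0 // yE w'E c0 scale0r /tv mulmx0 mul0mx.
  exists (c *: u'); last by rewrite yE w'E /tv -scalemxAl scalemxAr.
  by rewrite -scalemxAr scalemxAl -w'E.
case: (boolP (w <= w')%MS) => [/sub_rVP[c wE]|nw].
  have nzc : c != 0 by apply: contra nzw => /eqP c0; rewrite wE c0 scale0r.
  by case/negP: nw'; apply/sub_rVP; exists c^-1; rewrite wE scalerA mulVf // scale1r.
have [v wv w'v] := row_separate nw'; have [v' w'v' wv'] := row_separate nw.
have E : u *m w + (u' + u *m (w *m u')) *m w' = u2 *m w2.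
  move: zE; rewrite GL_MxE xE yE /tv mulmxDl mul1mx mulmxDr mulmx1 => E.
  apply: (addrI 1%:M); rewrite -E mulmxDl -!mulmxA !addrA.
  by congr (_ + _); rewrite -!addrA; congr (_ + _); rewrite addrC.
have E1 : u = (w2 *m v') 0 0 *: u2.
  move/(congr1 (mulmx^~ v')): E; rewrite mulmxDl -!mulmxA wv' w'v' mulmx1 !mulmx0 addr0.
  by move=> {1}->; rewrite [X in u2 *m X]mx11_scalar mul_mx_scalar.
have E2 : u' + u *m (w *m u') = (w2 *m v) 0 0 *: u2.
  move/(congr1 (mulmx^~ v)): E; rewrite mulmxDl -!mulmxA wv w'v mulmx1 !mulmx0 add0r => ->.
  by rewrite [X in u2 *m X]mx11_scalar mul_mx_scalar.
have nzc : (w2 *m v') 0 0 != 0 by apply: contra nzu => /eqP c0; rewrite E1 c0 scale0r.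
right; pose c := (w2 *m v) 0 0 / (w2 *m v') 0 0 - (w *m u') 0 0.
have uE : u' = c *: u.
  rewrite scalerBl {1}E1 scalerA divfK // -E2.
  by rewrite [X in u *m X]mx11_scalar mul_mx_scalar addrK.
apply/TaP; have [c0|nz] := eqVneq c 0.
  by exists 0; rewrite ?mul0mx // yE uE c0 scale0r /tv mulmx0 mul0mx.
exists (c *: w'); last by rewrite yE uE /tv -scalemxAl scalemxAr.
by rewrite -scalemxAl scalemxAr -uE.
Qed.

Definition isTc X := exists2 w, w != 0 & X = Tc w.
Definition isTa X := exists2 u, u != 0 & X = Ta u.

(** If [y] leaves the axis group of [x], it shares the centre of [x]. An element [z] with the axis
    of [x] must in turn share axis or centre with [y]; the axis is impossible unless [z = 1], and
    the centre is that of [x]. *)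
Lemma group_tvs_sub (Q : {group gl}) : Q \subset tvs ->
  exists2 X, isTc X \/ isTa X & Q \subset X.
Proof.
move=> sQT; case: (boolP (Q :==: 1%g)) => [/eqP->|/trivgPn[x Qx nx1]].
  exists (Tc (delta_mx 0 0 : 'rV[F]_n)); last exact: sub1G.
  by left; exists (delta_mx 0 0) => //; apply/rV0Pn; exists 0; rewrite mxE oner_eq0.
have /tvsP[u [w [wu0 xE]]] := subsetP sQT x Qx.
have := nx1; rewrite (tv_eq1 xE) negb_or => /andP[nzu nzw].
have dich z : z \in Q -> z \in Tc w \/ z \in Ta u.
  by move=> Qz; apply: (tvs_mul_tvs xE nx1); apply: (subsetP sQT); rewrite ?groupM.
case: (boolP (Q \subset Tc w)) => [sQ|/subsetPn[y Qy nTy]].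
  by exists (Tc w) => //; left; exists w.
have Tay : y \in Ta u by case: (dich y Qy) => // Ty; rewrite Ty in nTy.
have ny1 : y != 1%g by apply: contraNneq nTy => ->; apply: group1.
exists (Ta u); first by right; exists u.
apply/subsetP=> z Qz; case: (dich z Qz) => // Tz.
have /tvsP[u' [w' [wu0' yE]]] := subsetP sQT y Qy.
have Tay' : y \in Ta u' by apply/TaP; exists w'.
have Tcy' : y \in Tc w' by apply/TcP; exists u'.
have [Tz'|] : z \in Tc w' \/ z \in Ta u'.
  by apply: (tvs_mul_tvs yE ny1); apply: (subsetP sQT); rewrite ?groupM.
- have [->|nz1] := eqVneq z 1%g; first exact: group1.
  by move: nTy; rewrite (Tc_meet nz1 Tz Tz') Tcy'.
- by rewrite (Ta_meet ny1 Tay Tay').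
Qed.

Definition iota x : gl := mkGL (invmx (GLval x))^T.

Lemma iotaE x : GLval (iota x) = (invmx (GLval x))^T.
Proof. by rewrite mkGLK // unitmx_tr unitmx_inv GLunit. Qed.

Lemma iotaM : {morph iota : x y / (x * y)%g}.
Proof.
move=> x y; apply: GLval_inj; rewrite GL_MxE !iotaE -!GL_VxE invMg GL_MxE.
by rewrite -trmx_mul.
Qed.

Lemma iotaK : involutive iota.
Proof. by move=> x; apply: GLval_inj; rewrite !iotaE -trmx_inv trmxK invmxK. Qed.

Lemma iota_SL x : x \in SL n F -> iota x \in SL n F.
Proof. by rewrite !SLE iotaE det_tr det_inv => /eqP->; rewrite invr1. Qed.

Lemma iota_tv x u w : w *m u = 0 -> GLval x = tv u w -> GLval (iota x) = tv (- w^T) u^T.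
Proof.
move=> wu0 xE; rewrite iotaE xE.
have -> : invmx (tv u w) = tv (- u) w.
  apply: (can_inj (mulKmx (tv_unit wu0))); rewrite mulmxV ?tv_unit // tvM ?mulmxN ?wu0 ?oppr0 //.
  by rewrite subrr /tv mul0mx addr0.
by rewrite /tv linearD /= trmx1 trmx_mul linearN /= mulmxN mulNmx.
Qed.

Lemma iota_Tc w x : x \in Tc w -> iota x \in Ta w^T.
Proof.
case/TcP=> u wu0 xE; apply/TaP; exists (- u^T).
  by rewrite mulNmx -trmx_mul wu0 trmx0 oppr0.
by rewrite (iota_tv wu0 xE) /tv mulmxN mulNmx.
Qed.

Lemma iota_Ta u x : x \in Ta u -> iota x \in Tc u^T.
Proof.
case/TaP=> w wu0 xE; apply/TcP; exists (- w^T).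
  by rewrite mulmxN -trmx_mul wu0 trmx0 oppr0.
by rewrite (iota_tv wu0 xE).
Qed.

Lemma iota_tvs x : x \in tvs -> iota x \in tvs.
Proof.
case/tvsP=> u [w [wu0 xE]]; apply: (subsetP (Ta_sub w^T)); apply: iota_Tc.
by apply/TcP; exists u.
Qed.

Lemma iota_Tc_im w : iota @: Tc w = Ta w^T.
Proof.
apply/setP=> x; apply/imsetP/idP => [[y Ty ->]|Tx]; first exact: iota_Tc.
by exists (iota x); rewrite ?iotaK // -[w]trmxK iota_Ta.
Qed.

Lemma iota_Ta_im u : iota @: Ta u = Tc u^T.
Proof.
apply/setP=> x; apply/imsetP/idP => [[y Ty ->]|Tx]; first exact: iota_Ta.
by exists (iota x); rewrite ?iotaK // -[u]trmxK iota_Tc.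
Qed.

Lemma card_Tc w w' : w != 0 -> w' != 0 -> #|Tc w| = #|Tc w'|.
Proof.
have st (z : 'rV[F]_n) : z != 0 -> #|Tc z| = #|Tc (delta_mx 0 0 : 'rV[F]_n)|.
  by case/row_transitive=> A uA <-; rewrite -[A]mkGLK // -TcJ cardJg.
by move=> /st-> /st->.
Qed.

(** Equality of sizes turns the inclusion from [group_tvs_sub] into an equality; [iota] exchanges
    the two kinds of groups. *)
Lemma card_TcTa X Y : isTc X \/ isTa X -> isTc Y \/ isTa Y -> #|X| = #|Y|.
Proof.
have st X' : isTc X' \/ isTa X' -> #|X'| = #|Tc (delta_mx 0 0 : 'rV[F]_n)|.
  have nz0 : (delta_mx 0 0 : 'rV[F]_n) != 0 by apply/rV0Pn; exists 0; rewrite mxE oner_eq0.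
  case=> [[w nzw ->]|[u nzu ->]]; first exact: card_Tc.
  rewrite -(card_imset _ (inv_inj iotaK)) iota_Ta_im; apply: card_Tc => //.
  by rewrite trmx_eq0.
by move=> /st-> /st->.
Qed.

Lemma tvs_Tc_commute w x y : x \in Tc w -> y \in Tc w -> commute x y.
Proof.
case/TcP=> u wu0 xE /TcP[u' wu0' yE]; apply: GLval_inj.
by rewrite !GL_MxE xE yE !tvM // addrC.
Qed.

Lemma tvs_Ta_commute u x y : x \in Ta u -> y \in Ta u -> commute x y.
Proof.
case/TaP=> w wu0 xE /TaP[w' wu0' yE]; apply: GLval_inj.
by rewrite !GL_MxE xE yE !tvMa // addrC.
Qed.

End Geometry.

(** * Root subgroups and the action of an automorphism on a frame *)

Lemma rmorphism_of_fun (F : fieldType) (f : F -> F) :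
  {morph f : s t / s + t} -> f 1 = 1 -> {morph f : s t / s * t} ->
  exists th : {rmorphism F -> F}, th =1 f.
Proof.
move=> fD f1 fM; have fB : zmod_morphism f.
  have f0 : f 0 = 0 by apply: (addrI (f 0)); rewrite -fD !addr0.
  by move=> s t; apply: (addIr (f t)); rewrite -fD !subrK.
have fm : monoid_morphism f by split.
pose fa := GRing.isZmodMorphism.Build _ _ f fB.
pose fr := GRing.isMonoidMorphism.Build _ _ f fm.
by exists (HB.pack_for {rmorphism F -> F} f fa fr).
Qed.

(** [th i j] is meant as the action on the parameter of the root subgroup [(i, j)], and the first
    hypothesis is the commutator relation. Rescaling by [d i = th 0 i 1] normalises all [th 0 j] at
    1; chains through a third index then identify all rescaled maps with a single multiplicative
    [f]. *)
Lemma chevalley_twist (F : fieldType) k (th : 'I_k.+3 -> 'I_k.+3 -> F -> F) :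
  (forall i j l s t, i != j -> j != l -> i != l -> th i l (s * t) = th i j s * th j l t) ->
  (forall i j, i != j -> th i j 1 != 0) ->
  exists d : 'I_k.+3 -> F, exists f : F -> F,
    [/\ forall i, d i != 0, f 1 = 1, {morph f : s t / s * t}
      & forall i j s, i != j -> th i j s = (d i)^-1 * f s * d j].
Proof.
move=> thM th1; pose d i := if i == 0 then 1 else th 0 i 1.
have nzd i : d i != 0.
  rewrite /d; have [_|ni] := eqVneq i 0; first exact: oner_neq0.
  by apply: th1; rewrite eq_sym.
pose et i j s := d i * th i j s / d j.
have etM i j l s t : i != j -> j != l -> i != l -> et i l (s * t) = et i j s * et j l t.
  move=> ij jl il; rewrite /et (thM i j l) //.
  move: (d i) (d j) (d l) (nzd j) (nzd l) => di dj dl nj nl.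
  by field; rewrite nl nj.
have et1 j : j != 0 -> et 0 j 1 = 1.
  by move=> nj; rewrite /et {1}/d eqxx mul1r /d (negPf nj) divff // th1 // eq_sym.
have etA j l s : j != 0 -> l != 0 -> j != l -> et j l s = et 0 l s.
  by move=> nj nl jl; rewrite -[s in RHS]mul1r (etM 0 j) ?et1 ?mul1r // eq_sym.
have etB j l s : j != 0 -> l != 0 -> et 0 j s = et 0 l s.
  move=> nj nl; have [->//|jl] := eqVneq j l.
  by rewrite -[s in RHS]mulr1 (etM 0 j) // 1?eq_sym // etA // et1 // mulr1.
have oth (i : 'I_k.+3) : exists2 l : 'I_k.+3, l != 0 & l != i.
  have [->|ni] := eqVneq i (inord 1).
    by exists (inord 2); rewrite -val_eqE /= !inordK.
  by exists (inord 1); rewrite 1?eq_sym // -val_eqE /= inordK.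
have etC i j s : i != j -> et i j s = et 0 (inord 1) s.
  have n1 : (inord 1 : 'I_k.+3) != 0 by rewrite -val_eqE /= inordK.
  have [->|ni] := eqVneq i 0; first by rewrite eq_sym => nj; apply: etB.
  have [->|nj] := eqVneq j 0; last by move=> ij; rewrite etA //; apply: etB.
  move=> _; have [l nl li] := oth i.
  by rewrite -(etB l) // -(etA i) // 1?eq_sym // -[s in RHS]mulr1 (etM i 0) // 1?eq_sym // et1 // mulr1.
exists d, (et 0 (inord 1)); split=> //.
- by apply: et1; rewrite -val_eqE /= inordK.
- move=> s t; have n1 : (inord 1 : 'I_k.+3) != 0 by rewrite -val_eqE /= inordK.
  have [l nl nl1] := oth (inord 1).
  by rewrite (etM 0 l) // 1?eq_sym // !etC // eq_sym.
- by move=> i j s ij; rewrite -(etC i j) // /et mulrA mulKf // divfK.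
Qed.

Section RootElements.
Variables (k : nat) (F : finFieldType).
Local Notation n := k.+3.
Local Notation gl := {'GL_n[F]}.
Local Notation Z := 'Z(SL_group n F).
Local Notation S := (PSL n F).
Implicit Types (x y : gl) (A : 'M[F]_n) (u : 'cV[F]_n) (w : 'rV[F]_n).
Local Notation tvs := (tvs k.+2 F).
Local Notation c_ i := (delta_mx 0 i : 'rV[F]_n).
Local Notation d_ i := (delta_mx i 0 : 'cV[F]_n).

Lemma c_neq0 i : c_ i != 0.
Proof. by apply/rV0Pn; exists i; rewrite mxE !eqxx oner_eq0. Qed.

Lemma d_neq0 i : d_ i != 0.
Proof. by apply/cV0Pn; exists i; rewrite mxE !eqxx oner_eq0. Qed.

Lemma cd_neq0 i : c_ i *m d_ i != 0.
Proof.
apply/eqP=> /matrixP/(_ 0 0)/eqP; rewrite mul_delta_mx !mxE !eqxx.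
by rewrite oner_eq0.
Qed.

Definition rt i j s : gl := tvg (s *: d_ i) (c_ j).

Lemma rt0 i j s : i != j -> c_ j *m (s *: d_ i) = 0.
Proof. by move=> ij; rewrite -scalemxAr delta_mul0 // scaler0. Qed.

Lemma rtE i j s : i != j -> GLval (rt i j s) = 1%:M + s *: delta_mx i j.
Proof. by move=> ij; rewrite tvgE ?rt0 // /tv -scalemxAl mul_delta_mx. Qed.

Lemma rt_tvs i j s : i != j -> rt i j s \in tvs.
Proof. by move=> ij; apply: tvg_tvs; apply: rt0. Qed.

Lemma rt_inj i j s t : i != j -> rt i j s = rt i j t -> s = t.
Proof.
move=> ij /(congr1 (@GLval n F)); rewrite !rtE // => /addrI/matrixP/(_ i j).
by rewrite !mxE !eqxx !mulr1.
Qed.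

Lemma rtD i j s t : i != j -> rt i j (s + t) = (rt i j s * rt i j t)%g.
Proof.
move=> ij; apply: GLval_inj.
by rewrite GL_MxE !tvgE ?rt0 // tvM ?rt0 // scalerDl.
Qed.

(** The commutator relation is put in product form so that an automorphism can be applied factor by
    factor. *)
Lemma rt_comm i j l s t : i != j -> j != l -> i != l ->
  (rt i j s * rt j l t = rt j l t * rt i j s * rt i l (s * t))%g.
Proof.
move=> ij jl il; apply: GLval_inj; rewrite !GL_MxE !rtE //.
have M0 (a b c d : 'I_n) (e f : F) : b != c ->
  (e *: delta_mx a b : 'M[F]_n) *m (f *: delta_mx c d) = 0.
  by move=> bc; rewrite -scalemxAl -scalemxAr mul_delta_mx_0 // !scaler0.
rewrite !mulmxDl !mulmxDr !mul1mx !mulmx1 !mulmxDl !mul1mx.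
rewrite (M0 j l i j) 1?eq_sym // (M0 i j i l) 1?eq_sym // (M0 j l i l) 1?eq_sym // mul0mx !addr0.
rewrite -scalemxAl -scalemxAr mul_delta_mx scalerA !addrA.
by rewrite [RHS]addrAC; congr (_ + _); rewrite addrAC.
Qed.

(** A root subgroup is the intersection of an axis group with a centre group, so [lift] preserves it
    once it preserves these. *)
Lemma TcTa_rt i j x : i != j -> x \in Tc (c_ j) -> x \in Ta (d_ i) -> exists s, x = rt i j s.
Proof.
move=> ij /TcP[u u0 xE] /TaP[w w0 xE'].
exists (u i 0); apply: GLval_inj; rewrite rtE // xE; congr (_ + _).
move: xE'; rewrite xE => /addrI E; apply/matrixP=> a b.
have Eu : u a 0 = (a == i)%:R * w 0 j.
  move/matrixP/(_ a j): E; rewrite !mxE !big_ord1 !mxE !eqxx mulr1 => ->.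
  by rewrite andbT.
rewrite !mxE big_ord1 Eu !mxE eqxx /=.
have -> : u i 0 = w 0 j.
  by move/matrixP/(_ i j): E; rewrite !mxE !big_ord1 !mxE !eqxx mulr1 mul1r.
by case: (a == i); case: (b == j); rewrite ?mul0r ?mulr0 ?mul1r ?mulr1.
Qed.

Lemma Tc_neq_Ta i j : Tc (c_ i) <> Ta (d_ j).
Proof.
move=> E; have [l li lj] : exists2 l : 'I_n, l != i & l != j.
  have : (0 < #|~: [set i; j]|)%N.
    rewrite -(ltn_add2l #|[set i; j]|) addn0 cardsC card_ord.
    by rewrite cards2; case: (i == j).
  by case/card_gt0P=> l; rewrite !inE negb_or => /andP[]; exists l.
have T1 : rt l i 1 \in Tc (c_ i) by apply: tvg_Tc; apply: rt0.
have := T1; rewrite E => /TaP[w _]; rewrite rtE // => /addrI/matrixP/(_ l i).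
rewrite !mxE big_ord1 !mxE !eqxx (negPf lj) mul0r mulr1 => /eqP.
by rewrite oner_eq0.
Qed.

Section OneAut.
Variables (p : nat) (a : {perm coset_of Z}).
Hypotheses (chF : p \in [pchar F]) (Aa : a \in Aut S).
Local Notation b := (lift a).

Lemma lift1 : b 1%g = 1%g.
Proof.
apply: tvs_coset_inj; rewrite ?lift_tvs ?tvs1 // (liftE chF Aa) ?tvs1 //.
by rewrite coset_1 -(autmE Aa) morph1.
Qed.

Lemma lift_unique x y : x \in tvs -> y \in tvs -> coset Z y = a (coset Z x) -> b x = y.
Proof. by move=> Tx Ty E; apply: tvs_coset_inj; rewrite ?lift_tvs // E; apply: (liftE chF Aa). Qed.

Lemma lift_eq1 x : x \in tvs -> x != 1%g -> b x != 1%g.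
Proof.
move=> Tx; apply: contra => /eqP bx1; apply/eqP.
by apply: (lift_inj chF Aa); rewrite ?tvs1 // bx1 lift1.
Qed.

Lemma isTcTa_sub X : isTc X \/ isTa X -> X \subset tvs.
Proof. by case=> [[w _ ->]|[u _ ->]]; rewrite ?Tc_sub ?Ta_sub. Qed.

(** These groups are commutative, which is what [liftM] asks for; so the image is a group of
    transvections, lies in one of the maximal ones, and fills it by cardinality. *)
Lemma lift_isTcTa (X : {set gl}) : isTc X \/ isTa X -> isTc (b @: X) \/ isTa (b @: X).
Proof.
move=> TX; have sXT := isTcTa_sub TX.
have [gX cX] : group_set X /\ {in X &, forall x y, commute x y}.
  case: (TX) => [[w _ ->]|[u _ ->]]; split; try exact: groupP.
    by move=> x y; apply: tvs_Tc_commute.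
  by move=> x y; apply: tvs_Ta_commute.
have gbX : group_set (b @: X).
  have /group_setP[X1 XM] := gX; apply/group_setP; split.
    by apply/imsetP; exists 1%g; rewrite ?lift1.
  move=> _ _ /imsetP[x Xx ->] /imsetP[y Xy ->]; apply/imsetP; exists (x * y)%g; first exact: XM.
  by rewrite (liftM chF Aa) //; try apply: (subsetP sXT); rewrite ?XM //; apply: cX.
have [|Y TY sXY] := @group_tvs_sub _ _ (Group gbX).
  by apply/subsetP=> _ /imsetP[x _ ->]; apply: lift_tvs.
suff -> : b @: X = Y by [].
apply/eqP; rewrite eqEcard sXY card_in_imset /= ?(card_TcTa TX TY) //.
by move=> x y Xx Xy; apply: (lift_inj chF Aa); apply: (subsetP sXT).
Qed.

(** The two groups are different but share [rt j i 1]. Groups of the same kind with a common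
    nontrivial element coincide, so the images are of opposite kinds. *)
Lemma lift_TcTa_type i j : i != j ->
  ~ (isTc (b @: Tc (c_ i)) /\ isTc (b @: Ta (d_ j))) /\
  ~ (isTa (b @: Tc (c_ i)) /\ isTa (b @: Ta (d_ j))).
Proof.
move=> ij; have ji : j != i by rewrite eq_sym.
pose z := rt j i 1; have Tz : z \in tvs by apply: rt_tvs.
have nz1 : z != 1%g by apply: tvg_neq1; rewrite ?rt0 ?scale1r ?c_neq0 ?d_neq0.
have zc : b z \in b @: Tc (c_ i) by apply: imset_f; apply: tvg_Tc; apply: rt0.
have zd : b z \in b @: Ta (d_ j).
  by apply: imset_f; rewrite -(TaZ (d_ j) (oner_neq0 F)); apply: tvg_Ta; apply: rt0.
have nbz := lift_eq1 Tz nz1.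
have neq : b @: Tc (c_ i) <> b @: Ta (d_ j).
  move=> E; apply: (@Tc_neq_Ta i j); apply/setP=> x; apply/idP/idP => Tx.
    have /imsetP[y Ty] : b x \in b @: Ta (d_ j) by rewrite -E imset_f.
    by move/(lift_inj chF Aa)->; rewrite ?(subsetP (Tc_sub _) _ Tx) ?(subsetP (Ta_sub _) _ Ty).
  have /imsetP[y Ty] : b x \in b @: Tc (c_ i) by rewrite E imset_f.
  by move/(lift_inj chF Aa)->; rewrite ?(subsetP (Ta_sub _) _ Tx) ?(subsetP (Tc_sub _) _ Ty).
split=> -[[e nze Ee] [f nzf Ef]]; apply: neq; rewrite Ee Ef.
  by apply: (Tc_meet nbz); rewrite -?Ee -?Ef.
by apply: (Ta_meet nbz); rewrite -?Ee -?Ef.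
Qed.

Lemma fam_Tc i : isTc (Tc (c_ i)) \/ isTa (Tc (c_ i)).
Proof. by left; exists (c_ i); rewrite ?c_neq0. Qed.

Lemma fam_Ta i : isTc (Ta (d_ i)) \/ isTa (Ta (d_ i)).
Proof. by right; exists (d_ i); rewrite ?d_neq0. Qed.

Lemma type_cd i j : i != j -> isTc (b @: Tc (c_ i)) -> isTa (b @: Ta (d_ j)).
Proof. by move=> /lift_TcTa_type[no _] ?; case: (lift_isTcTa (fam_Ta j)) => // ?; case: no. Qed.

Lemma type_dc i j : i != j -> isTa (b @: Ta (d_ j)) -> isTc (b @: Tc (c_ i)).
Proof. by move=> /lift_TcTa_type[_ no] ?; case: (lift_isTcTa (fam_Tc i)) => // ?; case: no. Qed.

Lemma type_cd' i j : i != j -> isTa (b @: Tc (c_ i)) -> isTc (b @: Ta (d_ j)).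
Proof. by move=> /lift_TcTa_type[_ no] ?; case: (lift_isTcTa (fam_Ta j)) => // ?; case: no. Qed.

Lemma type_dc' i j : i != j -> isTc (b @: Ta (d_ j)) -> isTa (b @: Tc (c_ i)).
Proof. by move=> /lift_TcTa_type[no _] ?; case: (lift_isTcTa (fam_Tc i)) => // ?; case: no. Qed.

Lemma third (i j : 'I_n) : exists2 l : 'I_n, l != i & l != j.
Proof.
have : (0 < #|~: [set i; j]|)%N.
  rewrite -(ltn_add2l #|[set i; j]|) addn0 cardsC card_ord.
  by rewrite cards2; case: (i == j).
by case/card_gt0P=> l; rewrite !inE negb_or => /andP[]; exists l.
Qed.

Lemma frame_standard : isTc (b @: Tc (c_ 0)) -> exists P : gl,
  forall i, b @: Tc (c_ i) = (Tc (c_ i) :^ P)%g /\ b @: Ta (d_ i) = (Ta (d_ i) :^ P)%g.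
Proof.
move=> T0.
have Ti i : isTc (b @: Tc (c_ i)).
  have [l l0 li] := third 0 i; apply: (@type_dc i l); rewrite 1?eq_sym //.
  by apply: (@type_cd 0 l); rewrite 1?eq_sym.
have Tj j : isTa (b @: Ta (d_ j)).
  by have [l lj _] := third j j; apply: (@type_cd l j).
have [W WE] : exists W : 'I_n -> 'rV[F]_n, forall i, W i != 0 /\ b @: Tc (c_ i) = Tc (W i).
  have H i : exists w, w != 0 /\ b @: Tc (c_ i) = Tc w by have [w] := Ti i; exists w.
  exact: fin_all_exists H.
have [U UE] : exists U : 'I_n -> 'cV[F]_n, forall i, U i != 0 /\ b @: Ta (d_ i) = Ta (U i).
  have H i : exists u, u != 0 /\ b @: Ta (d_ i) = Ta u by have [u] := Tj i; exists u.
  exact: fin_all_exists H.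
have WU i j : i != j -> W i *m U j = 0.
  move=> ij; have ji : j != i by rewrite eq_sym.
  have Tz : rt j i 1 \in tvs by apply: rt_tvs.
  have nz1 : rt j i 1 != 1%g by apply: tvg_neq1; rewrite ?rt0 ?scale1r ?c_neq0 ?d_neq0.
  apply: (TcTa_meet (lift_eq1 Tz nz1)).
    by rewrite -(WE i).2; apply: imset_f; apply: tvg_Tc; apply: rt0.
  rewrite -(UE j).2; apply: imset_f; rewrite -(TaZ (d_ j) (oner_neq0 F)).
  by apply: tvg_Ta; apply: rt0.
(* Otherwise a nontrivial transvection lies in both images; its preimage lies in [Tc (c_ i)] and
   [Ta (d_ i)], which are not incident. *)
have WUii i : W i *m U i != 0.
  apply/eqP=> wu0; have nt := tvg_neq1 wu0 (UE i).1 (WE i).1.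
  have := tvg_Tc wu0; have := tvg_Ta wu0; rewrite -(WE i).2 -(UE i).2.
  case/imsetP=> x Tx xE /imsetP[y Ty yE].
  have xy : x = y.
    apply: (lift_inj chF Aa); rewrite -?xE -?yE //; first exact: (subsetP (Ta_sub _) _ Tx).
    exact: (subsetP (Tc_sub _) _ Ty).
  have nx1 : x != 1%g by apply: contraNneq nt => x1; rewrite xE x1 lift1.
  by case/eqP: (cd_neq0 i); apply: (TcTa_meet nx1); rewrite // xy.
(* The new hyperplanes are the rows of [A] and the new points the columns of [B]. As [A B] is an
   invertible diagonal matrix, [B] is [A^-1] up to column scaling, and conjugation by [A] moves both
   families at once. *)
pose A : 'M[F]_n := \matrix_(i, j) W i 0 j.
have rA i : c_ i *m A = W i by rewrite -rowE; apply/rowP=> j; rewrite !mxE.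
pose D : 'rV[F]_n := \row_i (W i *m U i) 0 0.
pose B : 'M[F]_n := \matrix_(i, j) U j i 0.
have cB j : B *m d_ j = U j by rewrite -colE; apply/colP=> i; rewrite !mxE.
have nzD i : D 0 i != 0.
  rewrite mxE; apply: contra (WUii i) => /eqP e; apply/eqP/matrixP=> r s.
  by rewrite !ord1 e mxE.
have AB : A *m B = diag_mx D.
  apply/matrixP=> i j; rewrite !mxE.
  have <- : (W i *m U j) 0 0 = \sum_l A i l * B l j.
    by rewrite !mxE; apply: eq_bigr => l _; rewrite !mxE.
  have [->|ij] := eqVneq i j; first by rewrite mulr1n mxE.
  by rewrite WU // mxE mulr0n.
have uD : diag_mx D \in unitmx.
  by rewrite unitmxE det_diag unitfE; apply/prodf_neq0 => i _.
have uA : A \in unitmx by move: uD; rewrite -AB unitmx_mul => /andP[].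
exists (mkGL A) => i; rewrite TcJ TaJ mkGLK // rA; split; first by case: (WE i).
rewrite (UE i).2 -(cB i) -[B](mulKmx uA) AB -mulmxA.
have -> : diag_mx D *m d_ i = D 0 i *: d_ i.
  apply/colP=> j; rewrite -colE !mxE andbT.
  by have [->|ij] := eqVneq j i; rewrite ?mulr1n ?mulr1 ?mulr0n ?mulr0.
by rewrite -scalemxAr TaZ.
Qed.

End OneAut.

End RootElements.

(** * The structure of the automorphism group of PSL_n(q) *)

Section AutPSL.
Variables (k : nat) (F : finFieldType).
Local Notation n := k.+3.
Local Notation gl := {'GL_n[F]}.
Local Notation Z := 'Z(SL_group n F).
Local Notation S := (PSL n F).
Implicit Types (x y : gl) (A : 'M[F]_n) (u : 'cV[F]_n) (w : 'rV[F]_n).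
Local Notation tvs := (tvs k.+2 F).
Local Notation c_ i := (delta_mx 0 i : 'rV[F]_n).
Local Notation d_ i := (delta_mx i 0 : 'cV[F]_n).
Local Notation rt := (@rt k F).

Lemma SL_M x y : x \in SL n F -> y \in SL n F -> (x * y)%g \in SL n F.
Proof. by rewrite !SLE GL_MxE det_mulmx => /eqP-> /eqP->; rewrite mulr1. Qed.

Lemma rt_Tc i j s : i != j -> rt i j s \in Tc (c_ j).
Proof. by move=> ij; apply: tvg_Tc; apply: rt0. Qed.

Lemma rt_Ta i j s : i != j -> rt i j s \in Ta (d_ i).
Proof.
move=> ij; apply/TaP; exists (s *: c_ j); first by rewrite -scalemxAl delta_mul0 // scaler0.
by rewrite rtE // /tv -scalemxAr mul_delta_mx.
Qed.

Lemma rt_diag (d : 'rV[F]_n) i j s : (forall i, d 0 i != 0) -> i != j ->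
  (rt i j s ^ mkGL (diag_mx d))%g = rt i j ((d 0 i)^-1 * s * d 0 j).
Proof.
move=> nzd ij; have uD : diag_mx d \in unitmx.
  by rewrite unitmxE det_diag unitfE; apply/prodf_neq0 => l _.
apply: GLval_inj; rewrite GL_J mkGLK // tvgE ?rt0 // tv_conj // tvgE ?rt0 //.
have -> : c_ j *m diag_mx d = d 0 j *: c_ j.
  rewrite -rowE; apply/rowP=> l; rewrite !mxE eqxx /= eq_sym.
  by rewrite mulr_natr.
have -> : invmx (diag_mx d) *m (s *: d_ i) = ((d 0 i)^-1 * s) *: d_ i.
  apply: (can_inj (mulKmx uD)); rewrite mulKVmx // -scalemxAr.
  apply/colP=> l; rewrite -colE !mxE andbT.
  have [->|_] := eqVneq l i; rewrite ?mulr1n ?mulr1 ?mulr0n ?mulr0 //.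
  by rewrite mulrAC mulVf // mul1r.
by rewrite /tv -!scalemxAl -!scalemxAr scalerA.
Qed.

Definition frobg (th : {rmorphism F -> F}) x : gl := mkGL (map_mx th (GLval x)).

Lemma frobgE th x : GLval (frobg th x) = map_mx th (GLval x).
Proof. by rewrite mkGLK // map_unitmx GLunit. Qed.

Lemma frobgM th : {morph frobg th : x y / (x * y)%g}.
Proof. by move=> x y; apply: GLval_inj; rewrite GL_MxE !frobgE GL_MxE map_mxM. Qed.

Lemma frobg_inj th : injective (frobg th).
Proof.
move=> x y /(congr1 (@GLval n F)); rewrite !frobgE => E; apply: GLval_inj.
by apply/matrixP=> i j; move/matrixP/(_ i j): E; rewrite !mxE => /fmorph_inj.
Qed.

Lemma frobg_SL th x : x \in SL n F -> frobg th x \in SL n F.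
Proof. by rewrite !SLE frobgE det_map_mx => /eqP->; rewrite rmorph1. Qed.

Lemma frobg_rt th i j s : i != j -> frobg th (rt i j s) = rt i j (th s).
Proof.
move=> ij; apply: GLval_inj; rewrite frobgE !rtE // map_mxD map_scalar_mx rmorph1.
by rewrite map_mxZ map_delta_mx.
Qed.

Lemma root_aut p a : p \in [pchar F] -> a \in Aut S ->
  (forall i, lift a @: Tc (c_ i) = Tc (c_ i) /\ lift a @: Ta (d_ i) = Ta (d_ i)) ->
  exists D : gl, exists th : {rmorphism F -> F},
    forall i j s, i != j -> lift a (rt i j s) = (rt i j (th s) ^ D)%g.
Proof.
move=> chF Aa fixT; pose th i j s := GLval (lift a (rt i j s)) i j.
have thE i j s : i != j -> lift a (rt i j s) = rt i j (th i j s).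
  move=> ij; have [||t tE] := @TcTa_rt _ _ i j (lift a (rt i j s)) ij.
  - by rewrite -(fixT j).1; apply: imset_f; apply: rt_Tc.
  - by rewrite -(fixT i).2; apply: imset_f; apply: rt_Ta.
  by rewrite /th tE rtE // !mxE (negPf ij) !eqxx add0r mulr1.
have thD i j s t : i != j -> th i j (s + t) = th i j s + th i j t.
  move=> ij; apply: (@rt_inj _ _ i j) => //; rewrite -thE // !rtD // (liftM chF Aa) ?rt_tvs //.
  - by rewrite !thE.
  - by rewrite -rtD // rt_tvs.
  - exact: tvs_Tc_commute (rt_Tc _ _) (rt_Tc _ _).
have th1 i j : i != j -> th i j 1 != 0.
  move=> ij; apply/eqP=> t0; have : lift a (rt i j 1) = 1%g.
    rewrite thE // t0; apply: GLval_inj; rewrite rtE // scale0r addr0 //.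
  move/eqP; apply/negP; apply: (lift_eq1 chF Aa); first exact: rt_tvs.
  by apply: tvg_neq1; rewrite ?rt0 ?scale1r ?c_neq0 ?d_neq0.
(* These root elements do not commute and [liftM] does not apply; the relation is mapped by [a] at
   the level of cosets and the common factor is cancelled there. *)
have thM i j l s t : i != j -> j != l -> i != l -> th i l (s * t) = th i j s * th j l t.
  move=> ij jl il; apply: (@rt_inj _ _ i l) => //; rewrite -thE //.
  apply: (lift_unique chF Aa); rewrite ?rt_tvs //.
  have SLr i' j' s' : i' != j' -> rt i' j' s' \in SL n F by move=> ?; apply/tvs_SL/rt_tvs.
  have /(congr1 (fun x => a (coset Z x))) := rt_comm s t ij jl il.
  have aM x y : x \in SL n F -> y \in SL n F ->
      a (coset Z (x * y)%g) = (a (coset Z x) * a (coset Z y))%g.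
    by move=> ? ?; rewrite cosetM (aut_coset_M Aa).
  have aL i' j' s' : i' != j' -> a (coset Z (rt i' j' s')) = coset Z (rt i' j' (th i' j' s')).
    by move=> ?; rewrite -(liftE chF Aa) ?rt_tvs // thE.
  rewrite (aM _ _ (SLr i j s ij) (SLr j l t jl)).
  rewrite (aM _ _ (SL_M (SLr j l t jl) (SLr i j s ij)) (SLr i l _ il)).
  rewrite (aM _ _ (SLr j l t jl) (SLr i j s ij)) !aL // -!cosetM (rt_comm _ _ ij jl il).
  by rewrite !cosetM => /mulgI.
have [d [f [nzd f1 fM fE]]] := chevalley_twist thM th1.
have i01 : (0 : 'I_n) != 1 by [].
have fD : {morph f : s t / s + t}.
  move=> s t; have := thD 0 1 s t i01; rewrite !fE // => E.
  by apply: (mulfI (invr_neq0 (nzd 0))); apply: (mulIf (nzd 1)); rewrite E mulrDr mulrDl.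
have [g gE] := rmorphism_of_fun fD f1 fM.
pose dr : 'rV[F]_n := \row_i d i.
exists (mkGL (diag_mx dr)), g => i j s ij; rewrite thE // rt_diag //; last by move=> l; rewrite mxE.
by rewrite !mxE gE fE.
Qed.

(** The root elements give all of [Tc (c_ 0)] and [Ta (d_ 0)]. It then suffices that [K] moves
    [c_ 0] to every nonzero row, since every transvection is then a conjugate of an element of
    [Tc (c_ 0)]. *)
Lemma tvs_generated (K : {group gl}) :
  (forall i j s, i != j -> rt i j s \in K) -> tvs \subset K.
Proof.
move=> Krt.
have KTc : Tc (c_ 0) \subset K.
  apply/subsetP=> x /TcP[u u0 xE].
  pose P (v : 'cV[F]_n) := c_ 0 *m v = 0 /\ tvg v (c_ 0) \in K.
  suff [_ K1] : P u by rewrite (_ : x = tvg u (c_ 0)) //; apply: GLval_inj; rewrite tvgE.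
  have -> : u = \sum_i u i 0 *: d_ i.
    apply/colP=> i; rewrite summxE (bigD1 i) //= big1 => [|j ji]; rewrite !mxE ?eqxx ?mulr1 ?addr0 //.
    by rewrite eq_sym (negPf ji) mulr0.
  apply: (big_ind P).
  - split; first by rewrite mulmx0.
    suff -> : tvg 0 (c_ 0) = 1%g :> gl by apply: group1.
    by apply: GLval_inj; rewrite tvgE ?mulmx0 // /tv mul0mx addr0.
  - move=> v v' [v0 Kv] [v0' Kv']; split; first by rewrite mulmxDr v0 v0' addr0.
    suff -> : tvg (v + v') (c_ 0) = (tvg v (c_ 0) * tvg v' (c_ 0))%g :> gl by apply: groupM.
    by apply: GLval_inj; rewrite GL_MxE !tvgE ?tvM // mulmxDr v0 v0' addr0.
  move=> i _; have [->|ni] := eqVneq i 0; last by split; [exact: rt0 | exact: Krt].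
  have -> : u 0 0 = 0.
    by move/matrixP/(_ 0 0): u0; rewrite -rowE !mxE.
  rewrite scale0r; split; first by rewrite mulmx0.
  suff -> : tvg 0 (c_ 0) = 1%g :> gl by apply: group1.
  by apply: GLval_inj; rewrite tvgE ?mulmx0 // /tv mul0mx addr0.
have KTa : Ta (d_ 0) \subset K.
  apply/subsetP=> x /TaP[u u0 xE].
  pose P (v : 'rV[F]_n) := v *m d_ 0 = 0 /\ tvg (d_ 0) v \in K.
  suff [_ K1] : P u by rewrite (_ : x = tvg (d_ 0) u) //; apply: GLval_inj; rewrite tvgE.
  have -> : u = \sum_i u 0 i *: c_ i by exact: row_sum_delta.
  apply: (big_ind P).
  - split; first by rewrite mul0mx.
    suff -> : tvg (d_ 0) 0 = 1%g :> gl by apply: group1.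
    by apply: GLval_inj; rewrite tvgE ?mul0mx // /tv mulmx0 addr0.
  - move=> v v' [v0 Kv] [v0' Kv']; split; first by rewrite mulmxDl v0 v0' addr0.
    suff -> : tvg (d_ 0) (v + v') = (tvg (d_ 0) v * tvg (d_ 0) v')%g :> gl by apply: groupM.
    by apply: GLval_inj; rewrite GL_MxE !tvgE ?tvMa // mulmxDl v0 v0' addr0.
  move=> i _; have [->|ni] := eqVneq i 0.
    have -> : u 0 0 = 0.
      by move/matrixP/(_ 0 0): u0; rewrite -colE !mxE.
    rewrite scale0r; split; first by rewrite mul0mx.
    suff -> : tvg (d_ 0) 0 = 1%g :> gl by apply: group1.
    by apply: GLval_inj; rewrite tvgE ?mul0mx // /tv mulmx0 addr0.
  have z0 : (u 0 i *: c_ i) *m d_ 0 = 0 by rewrite -scalemxAl delta_mul0 1?eq_sym ?scaler0.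
  split=> //; suff -> : tvg (d_ 0) (u 0 i *: c_ i) = rt 0 i (u 0 i) by apply: Krt; rewrite eq_sym.
  apply: GLval_inj; rewrite tvgE // rtE 1?eq_sym // /tv -scalemxAr.
  by rewrite mul_delta_mx.
have tr1 w : w 0 0 = 1 -> exists2 x, x \in K & c_ 0 *m GLval x = w.
  move=> w0; have z0 : (w - c_ 0) *m d_ 0 = 0.
    apply/matrixP=> i j; rewrite -colE !mxE !ord1 w0 !eqxx subrr //.
  exists (tvg (d_ 0) (w - c_ 0)); first by apply: (subsetP KTa); apply: tvg_Ta.
  have cd1 : c_ 0 *m d_ 0 = 1%:M.
    by rewrite mul_delta_mx; apply/matrixP=> i j; rewrite !ord1 !mxE.
  by rewrite tvgE // /tv mulmxDr mulmx1 mulmxA cd1 mul1mx addrC subrK.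
(* The parameter [s] is chosen so that the root element turns the entry 0 of [w] into 1, the case
   already treated. *)
have tr2 w i : i != 0 -> w 0 i != 0 -> exists2 x, x \in K & c_ 0 *m GLval x = w.
  move=> i0 nz; pose s := (1 - w 0 0) / w 0 i.
  have [|x Kx xE] := tr1 (w *m GLval (rt i 0 s)).
    rewrite rtE // mulmxDr mulmx1 -scalemxAr mxE [X in _ + X]mxE.
    rewrite (_ : (w *m delta_mx i 0) 0 0 = w 0 i) ?divfK // 1?addrC ?subrK //.
    rewrite !mxE (bigD1 i) //= big1 => [|j ji]; rewrite !mxE ?eqxx ?mulr1 ?addr0 //.
    by rewrite (negPf ji) mulr0.
  exists (x * (rt i 0 s)^-1)%g; first by apply: groupM => //; rewrite groupV; apply: Krt.
  by rewrite GL_MxE mulmxA xE GL_VxE mulmxK ?GLunit.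
(* If [w] has entry 1 equal to 0 and its nonzero entry at 0, a root element first copies that entry
   to position 1. *)
have tr w : w != 0 -> exists2 x, x \in K & c_ 0 *m GLval x = w.
  case/rV0Pn=> i nz; have [i0|i0] := eqVneq i 0; last exact: (tr2 w i).
  have [w1|w1] := eqVneq (w 0 1) 0; last exact: (tr2 w 1).
  pose r := rt 0 1 1; have Kr : r \in K by apply: Krt.
  have [||x Kx xE] := tr2 (w *m GLval r) 1 => //.
    rewrite rtE // mulmxDr mulmx1 scale1r mxE w1 add0r.
    rewrite !mxE (bigD1 0) //= big1 => [|j ji]; rewrite !mxE ?eqxx ?mulr1 ?addr0 -?i0 //.
    by rewrite i0 (negPf ji) mulr0.
  exists (x * r^-1)%g; first by apply: groupM => //; rewrite groupV.
  by rewrite GL_MxE mulmxA xE GL_VxE mulmxK ?GLunit.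
apply/subsetP=> x /tvsP[u [w [wu0 xE]]]; have [w0|nzw] := eqVneq w 0.
  suff -> : x = 1%g by apply: group1.
  by apply: GLval_inj; rewrite xE w0 /tv mulmx0 addr0.
have [y Ky yE] := tr w nzw.
have : x \in (Tc (c_ 0) :^ y)%g by rewrite TcJ yE; apply/TcP; exists u.
case/imsetP=> z Tz ->; rewrite groupJ //; exact: (subsetP KTc).
Qed.

(** Transvections form a set closed under conjugation, so they generate a nontrivial normal
    subgroup; simplicity replaces an elimination argument. *)
Lemma PSL_generated : simple S -> S \subset <<coset Z @: tvs>>%g.
Proof.
case/simpleP=> ntS simS; pose M := (<<[set coset Z x | x in tvs]>>)%G.
have sMS : M \subset S.
  by rewrite gen_subG; apply/subsetP=> _ /imsetP[x Tx ->]; apply/PSL_coset/tvs_SL.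
have nMS : M <| S.
  rewrite /normal sMS /=; apply: (subset_trans _ (norm_gen _)).
  apply/subsetP=> _ /PSLP[y SLy ->]; rewrite inE; apply/subsetP=> _ /imsetP[_ /imsetP[x Tx ->] ->].
  by rewrite -cosetJ; apply: imset_f; apply: tvsJ.
case: (simS M nMS) => [M1|<-] //.
have [x Tx nx1] := tvs_nontrivial k F.
have : coset Z x \in M by apply: mem_gen; apply: imset_f.
rewrite M1 => /set1P cx1; case/eqP: nx1; apply: tvs_coset_inj; rewrite ?tvs1 //.
by rewrite coset_1.
Qed.

(** The agreement set is a subgroup both in SL_n, where root elements yield all transvections, and
    in PSL_n, where these generate. *)
Lemma Aut_root_eq a a' : simple S -> a \in Aut S -> a' \in Aut S ->
  (forall i j s, i != j -> a (coset Z (rt i j s)) = a' (coset Z (rt i j s))) -> a = a'.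
Proof.
move=> simS Aa Aa' E.
pose K := [set x in SL n F | a (coset Z x) == a' (coset Z x)].
have gK : group_set K.
  apply/group_setP; split=> [|x y]; first by rewrite inE group1 coset_1 -(autmE Aa) -(autmE Aa') !morph1 /=.
  move=> /setIdP[SLx /eqP Ex] /setIdP[SLy /eqP Ey]; apply/setIdP; split.
    exact: SL_M.
  by rewrite cosetM (aut_coset_M Aa) // (aut_coset_M Aa') // Ex Ey.
have KT : tvs \subset Group gK.
  apply: tvs_generated => i j s ij; apply/setIdP; split; last by rewrite E.
  exact/tvs_SL/rt_tvs.
pose M := [set s in S | a s == a' s].
have gM : group_set M.
  apply/group_setP; split=> [|s t]; first by rewrite inE group1 -(autmE Aa) -(autmE Aa') !morph1 /=.
  rewrite !inE => /andP[Ss /eqP Es] /andP[St /eqP Et].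
  rewrite groupM //= -(autmE Aa) -(autmE Aa') !morphM //= !autmE; first by rewrite Es Et.
have SM : S \subset Group gM.
  apply: subset_trans (PSL_generated simS) _; rewrite gen_subG.
  apply/subsetP=> _ /imsetP[x Tx ->]; rewrite inE PSL_coset ?tvs_SL //=.
  by have := subsetP KT x Tx; rewrite inE => /andP[].
by apply: (eq_Aut Aa Aa') => s Ss; have := subsetP SM s Ss; rewrite inE => /andP[_ /eqP].
Qed.

Lemma lift_cj p a h x : p \in [pchar F] -> a \in Aut S -> x \in tvs ->
  lift (a * cj h)%g x = (lift a x ^ h)%g.
Proof.
move=> chF Aa Tx; apply: (lift_unique chF) => //; rewrite ?groupM ?cj_Aut ?tvsJ ?lift_tvs //.
by rewrite permM -(liftE chF Aa) // cjE // tvs_SL ?lift_tvs.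
Qed.

Lemma aut_frame p a : simple S -> p \in [pchar F] -> a \in Aut S -> isTc (lift a @: Tc (c_ 0)) ->
  exists P : gl, exists th : {rmorphism F -> F},
    forall x, x \in SL n F -> a (coset Z x) = coset Z (frobg th x ^ P)%g.
Proof.
move=> simS chF Aa T0; have [P PE] := frame_standard chF Aa T0.
pose a1 := (a * cj P^-1)%g; have Aa1 : a1 \in Aut S by rewrite groupM ?cj_Aut.
have im1 (X : {set gl}) : X \subset tvs -> lift a1 @: X = ((lift a @: X) :^ P^-1)%g.
  move=> sX; apply/setP=> x; apply/imsetP/imsetP.
    by case=> y Xy ->; exists (lift a y); rewrite ?imset_f // /a1 (lift_cj _ chF Aa) ?(subsetP sX).
  by case=> _ /imsetP[y Xy ->] ->; exists y => //; rewrite /a1 (lift_cj _ chF Aa) ?(subsetP sX).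
have [|D [th thE]] := root_aut chF Aa1.
  by move=> i; rewrite !im1 ?Tc_sub ?Ta_sub // (PE i).1 (PE i).2 !conjsgK.
have [ath Aath athE] := induced_aut (frobgM th) (@frobg_inj th) (@frobg_SL th).
have aE : a = (ath * cj (D * P))%g.
  apply: Aut_root_eq; rewrite ?groupM ?cj_Aut // => i j s ij.
  have Tr := rt_tvs s ij; have SLr := tvs_SL Tr.
  rewrite permM athE // cjE ?frobg_SL // frobg_rt // conjgM -thE //.
  by rewrite /a1 (lift_cj _ chF Aa) // conjgKV (liftE chF Aa).
exists (D * P)%g, th => x SLx.
by rewrite aE permM athE // cjE ?frobg_SL.
Qed.

Lemma aut_PSL_structure a : simple S -> a \in Aut S ->
  exists P : gl, exists th : {rmorphism F -> F}, exists d : bool,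
    forall x, x \in SL n F -> a (coset Z x) = coset Z (frobg th (if d then iota x else x) ^ P)%g.
Proof.
move=> simS Aa; have [p _ chF] := finPcharP F.
case: (lift_isTcTa chF Aa (fam_Tc F 0)) => [T0|T0].
  by have [P [th E]] := aut_frame simS chF Aa T0; exists P, th, false.
have [i0 Ai0 i0E] := @induced_aut k F (@iota k F) (@iotaM k F) (inv_inj (@iotaK k F)) (@iota_SL k F).
pose a1 := (i0 * a)%g; have Aa1 : a1 \in Aut S by rewrite groupM.
have lE x : x \in tvs -> lift a1 x = lift a (iota x).
  move=> Tx; apply: (lift_unique chF Aa1); rewrite ?lift_tvs // (liftE chF Aa) ?iota_tvs //.
  by rewrite permM i0E ?tvs_SL.
have T1 : isTc (lift a1 @: Tc (c_ 0)).
  have -> : lift a1 @: Tc (c_ 0) = lift a @: Ta (d_ 0).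
    have -> : d_ 0 = (c_ 0)^T by rewrite trmx_delta.
    rewrite -iota_Tc_im -imset_comp; apply: eq_in_imset => x Tx.
    by rewrite /= lE // (subsetP (Tc_sub _) _ Tx).
  (* Types can only be compared for different indices, so passing from [c_ 0] to [d_ 0] takes the
     chain [c_ 0], [d_ 1], [c_ 2], [d_ 0]. *)
  have [||] := @type_cd' k F p a chF Aa (inord 2) 0 _ _ => //.
  - by rewrite -val_eqE /= inordK.
  - apply: (@type_dc' k F p a chF Aa (inord 2) (inord 1)); first by rewrite -val_eqE /= !inordK.
    apply: (@type_cd' k F p a chF Aa 0 (inord 1)) => //.
    by rewrite -val_eqE /= !inordK.
  by move=> u nzu E; exists u.
have [P [th E]] := aut_frame simS chF Aa1 T1; exists P, th, true => x SLx.
by rewrite -E ?iota_SL // permM i0E ?iota_SL // iotaK.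
Qed.

End AutPSL.

(** * Orders of semilinear automorphisms *)

Lemma finField_generator (F : finFieldType) :
  exists2 w : F, w != 0 & forall x, x != 0 -> exists i, x = w ^+ i.
Proof.
have /cyclicP[u uE] := field_unit_group_cyclic [set: {unit F}]%G.
exists (val u); first by rewrite -unitfE (valP u).
move=> x nzx; have ux : x \is a GRing.unit by rewrite unitfE.
have : FinRing.unit F ux \in <[u]>%g by rewrite -uE inE.
by case/cycleP=> i /(congr1 val) /= ->; exists i; rewrite FinRing.val_unitX.
Qed.

Section FixedField.
Variables (F : finFieldType) (th : {rmorphism F -> F}).

Definition fixf : {set F} := [set c | th c == c].

(* The powers 1, w, ..., w^(e-1) of a generator w, e being the order of th, are linearly
   independent over the fixed field, as w has e conjugates. *)
Lemma fixf_degree : ~ (th =1 id) ->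
  exists2 e, (2 <= e)%N & (#|fixf| ^ e <= #|F|)%N /\ iter e th =1 id.
Proof.
move=> nth; have [w nzw wG] := finField_generator F.
have thI : injective th by apply: fmorph_inj.
have iterX m x i : iter m th (x ^+ i) = (iter m th x) ^+ i.
  by elim: m => //= m ->; rewrite rmorphXn.
have iter0 m : iter m th 0 = 0 by elim: m => //= m ->; rewrite rmorph0.
have itid m : iter m th w = w -> iter m th =1 id.
  move=> mw x; have [->//|/wG[i ->]] := eqVneq x 0; by rewrite iterX mw.
pose e := fingraph.order th w.
have ew : iter e th w = w by apply: iter_order.
exists e; last split; last exact: itid.
  rewrite ltn_neqAle fingraph.order_gt0 andbT eq_sym; apply/eqP=> e1; apply: nth.
  by move=> x; apply: (itid 1%N); move: ew; rewrite e1.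
pose D := ffun_on (mem fixf) : {pred {ffun 'I_e -> F}}.
have -> : (#|fixf| ^ e = #|D|)%N by rewrite card_ffun_on card_ord.
pose g (v : {ffun 'I_e -> F}) := \sum_i v i * w ^+ i.
rewrite -(card_in_image (f := g)) ?max_card // => v v' Dv Dv' gE.
have fixv (z : {ffun 'I_e -> F}) i : z \in D -> th (z i) = z i.
  by move=> /ffun_onP/(_ i); rewrite inE => /eqP.
pose r := \poly_(i < e) (if insub i is Some j then v j - v' j else 0).
have rE x : r.[x] = \sum_(i < e) (v i - v' i) * x ^+ i.
  rewrite horner_poly; apply: eq_bigr => i _.
  by rewrite (valK i).
have rw : r.[w] = 0.
  rewrite rE; move/eqP: gE; rewrite -subr_eq0 -sumrB => /eqP gE; rewrite -[RHS]gE.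
  by apply: eq_bigr => i _; rewrite mulrBl.
have rT x : r.[th x] = th r.[x].
  rewrite !rE rmorph_sum; apply: eq_bigr => i _ /=.
  by rewrite rmorphM rmorphB rmorphXn /= !fixv.
have roots : all (root r) (fingraph.orbit th w).
  apply/allP=> x; rewrite -fconnect_orbit => /iter_findex <-.
  elim: (findex _ _ _) => [|m IH] /=; first by rewrite /root rw.
  by move: IH; rewrite /root rT => /eqP->; rewrite rmorph0.
have r0 : r = 0.
  apply/eqP; apply: contraT => nzr.
  have := max_poly_roots nzr roots (orbit_uniq _ _); rewrite size_orbit ltnNge.
  by rewrite size_poly.
apply/ffunP=> i; apply/eqP; rewrite -subr_eq0; apply/eqP.
by have := congr1 (fun s : {poly F} => s`_i) r0; rewrite coef_poly ltn_ord coef0 (valK i).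
Qed.

Lemma fixf_gt1 : (1 < #|fixf|)%N.
Proof.
have : [set 0; 1] \subset fixf.
  by apply/subsetP=> x /set2P[]->; rewrite inE ?rmorph0 ?rmorph1.
by move/subset_leq_card; rewrite cards2 eq_sym oner_eq0.
Qed.

End FixedField.

(** Here [q0] is the size of the fixed field, [e] the order of the field automorphism and [m] the
    order of the [e]-th power; the factor 2 leaves room for the square of a correlation. From
    [m < 2 * q0 ^ (n - 1)] and [o >= q0 ^ (e * (n - 1))] one gets
    [q0 ^ ((e - 1) * (n - 1)) < 4 * e], which leaves only [q0 = e = 2] and [n = 3]. *)
Lemma semilinear_bound q0 e q n m o :
  (2 <= q0 -> 2 <= e -> q0 ^ e <= q -> 3 <= n -> (n, q) != (3, 4) ->
  q0.-1 * m <= (q0 ^ n).-1 -> o <= 2 * (e * m) -> q ^ n - q <= q.-1 * o -> False)%N.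
Proof.
move=> q0_2 e_2 qe n3 nq mB oB oq.
have [n' nE] : exists n', n = n'.+3 by exists (n - 3)%N; lia.
have m_lt : (m < 2 * q0 ^ n.-1)%N.
  rewrite ltnNge; apply/negP=> h.
  have h1 : (q0.-1 * (2 * q0 ^ n.-1) <= (q0 ^ n).-1)%N.
    by apply: leq_trans mB; rewrite leq_mul2l h orbT.
  have h2 : (q0 ^ n = q0 * q0 ^ n.-1)%N by rewrite nE /= -expnS.
  have h3 : (0 < q0 ^ n.-1)%N by rewrite expn_gt0; lia.
  move: h1; rewrite h2; nia.
have o_ge : (q ^ n.-1 <= o)%N.
  have q1 : (1 < q)%N by apply: leq_trans qe; apply: leq_trans (leq_pexp2l _ (ltnW e_2)); rewrite ?expn1; lia.
  have : (q.-1 * q ^ n.-1 <= q.-1 * o)%N.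
    apply: leq_trans oq; rewrite nE /= (expnS q n'.+2).
    have : (q <= q ^ n'.+2)%N by rewrite -{1}[q]expn1 leq_pexp2l; lia.
    nia.
  by rewrite leq_mul2l => /orP[/eqP|//]; lia.
have big : (q0 ^ (e * n.-1) <= o)%N.
  by apply: leq_trans o_ge; rewrite expnM leq_exp2r //; lia.
have cmp : (4 * e <= q0 ^ (e.-1 * n.-1) -> False)%N.
  move=> h; have : (q0 ^ (e * n.-1) = q0 ^ n.-1 * q0 ^ (e.-1 * n.-1))%N.
    by rewrite -expnD; congr (_ ^ _)%N; case: (e) e_2 => // e' _ /=; rewrite mulSn.
  have h3 : (0 < q0 ^ n.-1)%N by rewrite expn_gt0; lia.
  nia.
have [e2|e3] := eqVneq e 2%N; last first.
  apply: cmp; apply: (@leq_trans (4 ^ e.-1)).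
    have : (2 < e)%N by lia.
    case: (e) => [|[|[|e']]] //= _; elim: e' => // e' IH.
    by rewrite expnS; lia.
  rewrite (_ : 4 = 2 ^ 2)%N // -expnM mulnC.
  apply: (@leq_trans (q0 ^ (e.-1 * 2))); first by rewrite leq_exp2r //; lia.
  by rewrite leq_pexp2l ?leq_mul2l ?nE ?orbT //; lia.
subst e; have [q02|q03] := eqVneq q0 2%N; last first.
  apply: cmp; rewrite /= mul1n; apply: (@leq_trans (3 ^ 2)) => //.
  apply: (@leq_trans (q0 ^ 2)); first by rewrite leq_exp2r //; lia.
  by rewrite leq_pexp2l ?nE //; lia.
subst q0; case: n' nE => [|n'] nE; last first.
  apply: cmp; rewrite nE /= mul1n -[X in (X <= _)%N]/(2 ^ 3)%N.
  by rewrite leq_pexp2l.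
(* In the last case [m <= 7], hence [o <= 28], while [o >= q * (q + 1) >= 30] once [q >= 5]; for
   [q = 4] there is no contradiction. *)
subst n; have q5 : (5 <= q)%N.
  by move: nq qe; rewrite xpair_eqE /=; lia.
have : (q ^ 3 - q = q.-1 * (q * q.+1))%N.
  by rewrite !expnS expn0; case: (q) q5 => // q' _ /=; nia.
move: mB oB oq; rewrite /= => mB oB oq E.
have : (q * q.+1 <= o)%N.
  by move: oq; rewrite E leq_mul2l => /orP[/eqP|//]; lia.
nia.
Qed.

Section Semilinear.
Variables (k : nat) (F : finFieldType).
Local Notation n := k.+3.
Local Notation gl := {'GL_n[F]}.
Local Notation Z := 'Z(SL_group n F).
Local Notation S := (PSL n F).
Implicit Types (x y P : gl).

Lemma cj_mul x y : cj (x * y)%g = (cj x * cj y)%g.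
Proof. by apply: cjM; rewrite inE. Qed.

Lemma cj1 : cj (1 : gl)%g = 1%g.
Proof. by apply/eqP; rewrite cj_eq1; apply: group1. Qed.

Lemma cjX x i : cj (x ^+ i)%g = (cj x ^+ i)%g.
Proof. by elim: i => [|i IH]; rewrite ?cj1 // !expgS cj_mul IH. Qed.

Lemma cjV x : cj x^-1%g = (cj x)^-1%g.
Proof. by apply: (mulgI (cj x)); rewrite -cj_mul !mulgV cj1. Qed.

Lemma cj_eqP x y : reflect (exists2 c, c != 0 & GLval x = c *: GLval y) (cj x == cj y).
Proof.
rewrite eq_mulgV1 -cjV -cj_mul cj_eq1; apply: (iffP (scalarsP _)) => -[c nz E]; exists c => //.
  by rewrite -[x](mulgKV y) GL_MxE E mul_scalar_mx.
by rewrite GL_MxE GL_VxE E -scalemxAl mulmxV ?GLunit // scalemx1.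
Qed.

Lemma aut_iter (a : {perm coset_of Z}) (g : gl -> gl) m :
  (forall x, x \in SL n F -> g x \in SL n F) ->
  (forall x, x \in SL n F -> a (coset Z x) = coset Z (g x)) ->
  forall x, x \in SL n F -> (a ^+ m)%g (coset Z x) = coset Z (iter m g x).
Proof.
move=> gS aE; elim: m => [|m IH] x SLx; first by rewrite perm1.
rewrite expgSr permM IH // aE //.
by elim: (m) => //= i; apply: gS.
Qed.

(** The characteristic polynomial has coefficients in the fixed field [F0], so all powers of [A] lie
    in the [F0]-span of the first [n]. The multiples [c A^i] with nonzero [c] in [F0] and [i < o]
    are distinct nonzero elements of this span. *)
Lemma order_cj_bound (th : {rmorphism F -> F}) (A : gl) :
  map_poly th (char_poly (GLval A)) = char_poly (GLval A) ->
  (#|fixf th|.-1 * #[cj A]%g <= (#|fixf th| ^ n).-1)%N.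
Proof.
move=> chA; set F0 := fixf th; set o := #[cj A]%g; pose M : 'M[F]_n := GLval A.
pose D := ffun_on (mem F0) : {pred {ffun 'I_n -> F}}.
pose X : {set 'M[F]_n} := [set \sum_(i < n) v i *: M ^+ i | v : {ffun 'I_n -> F} in D].
have cX : (#|X| <= #|F0| ^ n)%N.
  apply: leq_trans (leq_imset_card _ _) _.
  by rewrite cardE -cardE card_ffun_on card_ord.
have F00 : 0 \in F0 by rewrite inE rmorph0.
have X0 : 0 \in X.
  apply/imsetP; exists [ffun=> 0]; first by apply/ffun_onP=> i; rewrite ffunE.
  by rewrite big1 // => i _; rewrite ffunE scale0r.
have XM c j : c \in F0 -> c *: M ^+ j \in X.
  rewrite inE => /eqP thc; pose r := 'X^j %% char_poly M.
  have rth : map_poly th r = r by rewrite map_modp chA map_polyXn.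
  have rn : (size r <= n)%N.
    by rewrite -ltnS -(size_char_poly M) ltn_modp monic_neq0 ?char_poly_monic.
  have Mr : M ^+ j = horner_mx M r.
    have := divp_eq 'X^j (char_poly M) => /(congr1 (horner_mx M)).
    rewrite rmorphD rmorphM /= (Cayley_Hamilton M) mulr0 add0r => <-.
    by rewrite rmorphXn /= horner_mx_X.
  apply/imsetP; exists [ffun i : 'I_n => c * r`_i].
    apply/ffun_onP=> i; rewrite ffunE inE rmorphM thc; apply/eqP; congr (_ * _).
    by rewrite -{2}rth coef_map.
  rewrite Mr -[r in LHS](poly_rV_K rn) horner_rVpoly.
  rewrite /powers_mx mulmx_sum_row linear_sum scaler_sumr; apply: eq_bigr => i _.
  by rewrite rowK linearZ /= mxvecK mxE ffunE scalerA.
pose E := [set cj' : F * 'I_o | (cj'.1 \in F0) && (cj'.1 != 0)].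
pose g (z : F * 'I_o) : 'M[F]_n := z.1 *: M ^+ z.2.
have gI : {in E &, injective g}.
  move=> [c i] [d j]; rewrite !inE /g /= => /andP[_ nzc] /andP[_ nzd] E1.
  have : cj (A ^+ i)%g == cj (A ^+ j)%g.
    apply/cj_eqP; exists (c^-1 * d); first by rewrite mulf_neq0 ?invr_eq0.
    by rewrite !GL_X -scalerA -[d *: _]E1 scalerA mulVf // scale1r.
  rewrite !cjX eq_expg_mod_order !modn_small // => /eqP/val_inj eij.
  congr (_, _) => //; move: E1; rewrite eij => /(congr1 (mulmx^~ (invmx (M ^+ j)))).
  have uM : M ^+ j \in unitmx by rewrite /M -GL_X GLunit.
  rewrite -!scalemxAl mulmxV // => /matrixP/(_ 0 0).
  by rewrite !mxE !mulr1.
have cE : #|E| = (#|F0|.-1 * o)%N.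
  have -> : E = setX (F0 :\ 0) [set: 'I_o].
    by apply/setP=> z; rewrite !inE andbT andbC.
  by rewrite cardsX cardsT card_ord (cardsD1 0 F0) F00.
rewrite -cE -(card_in_imset gI) -ltnS.
have F0n : (0 < #|F0| ^ n)%N by rewrite expn_gt0 (cardsD1 0) F00.
rewrite prednK //; apply: leq_trans cX; rewrite (cardsD1 0 X) X0 ltnS subset_leq_card //.
apply/subsetP=> _ /imsetP[[c i]] /[!inE] /andP[cF nzc] -> /=.
rewrite /g /= scaler_eq0 negb_or nzc /=; apply/andP; split; last by apply: XM; rewrite inE.
have : M ^+ i \in unitmx by rewrite /M -GL_X GLunit.
by apply: contraTneq => ->; rewrite unitmxE det0 unitr0.
Qed.

Lemma frobgV th x : frobg th x^-1%g = (frobg th x)^-1%g.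
Proof. by apply: GLval_inj; rewrite GL_VxE !frobgE GL_VxE map_invmx. Qed.

Lemma frobgJ th x y : frobg th (x ^ y)%g = (frobg th x ^ frobg th y)%g.
Proof. by rewrite !conjgE !frobgM frobgV. Qed.

Lemma iter_frobg (th : {rmorphism F -> F}) m x :
  GLval (iter m (frobg th) x) = map_mx (iter m th) (GLval x).
Proof.
elim: m => [|m IH]; first by apply/matrixP=> i j; rewrite !mxE.
by rewrite iterS frobgE IH; apply/matrixP=> i j; rewrite !mxE.
Qed.

Section Norm.
Variables (th : {rmorphism F -> F}) (P : gl).
(** This is [th^(m-1)(P) ... th(P) P], the conjugating factor in the [m]-th iterate of
    [x |-> th(x) ^ P]. *)
Definition snorm m : gl := iter m (fun y => frobg th y * P)%g 1%g.

Lemma iter_semilinear m x :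
  iter m (fun y => frobg th y ^ P)%g x = (iter m (frobg th) x ^ snorm m)%g.
Proof.
elim: m => [|m IH]; first by rewrite /= conjg1.
by rewrite 2!iterS IH frobgJ -conjgM.
Qed.

Lemma snormSr m : snorm m.+1 = (iter m (frobg th) P * snorm m)%g.
Proof.
elim: m => [|m IH].
  rewrite /snorm /= mulg1 (_ : frobg th 1%g = 1%g) ?mul1g //.
  by apply: GLval_inj; rewrite frobgE GL_1E map_mx1.
have -> : snorm m.+2 = (frobg th (snorm m.+1) * P)%g by [].
by rewrite {1}IH frobgM -mulgA.
Qed.

End Norm.

Lemma char_poly_conj (A B : 'M[F]_n) : B \in unitmx ->
  char_poly (B *m A *m invmx B) = char_poly A.
Proof.
move=> uB; pose f := map_mx (@polyC F).
have fB : f n n B *m f n n (invmx B) = 1%:M by rewrite -map_mxM mulmxV // map_mx1.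
rewrite /char_poly (_ : char_poly_mx _ = f n n B *m char_poly_mx A *m f n n (invmx B)).
  by rewrite !det_mulmx mulrAC -det_mulmx fB det1 mul1r.
by rewrite /char_poly_mx mulmxBr mulmxBl scalar_mxC -(mulmxA _ (f n n B)) fB mulmx1 !map_mxM.
Qed.

(** The [e]-th power is conjugation by the norm [A] of [P]. Since [th(A) P = P A], the matrix
    [th(A)] is conjugate to [A], so the characteristic polynomial of [A] is defined over the fixed
    field. *)
Lemma semilinear_order (a : {perm coset_of Z}) (P : gl) (th : {rmorphism F -> F}) :
  a \in Aut S -> ~ (th =1 id) ->
  (forall x, x \in SL n F -> a (coset Z x) = coset Z (frobg th x ^ P)%g) ->
  exists q0 e m, [/\ (2 <= q0)%N, (2 <= e)%N, (q0 ^ e <= #|F|)%N,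
    (q0.-1 * m <= (q0 ^ n).-1)%N & (#[a]%g <= e * m)%N].
Proof.
move=> Aa nth aE; have [e e2 [qe the]] := fixf_degree nth.
pose A := snorm th P e.
have the1 x : iter e (frobg th) x = x.
  by apply: GLval_inj; rewrite iter_frobg; apply/matrixP=> i j; rewrite mxE the.
have aeE : (a ^+ e)%g = cj A.
  apply: Aut_eqP; rewrite ?groupX ?cj_Aut // => x SLx.
  rewrite (aut_iter e _ aE) //; last by move=> y SLy; rewrite SL_J frobg_SL.
  by rewrite iter_semilinear the1 cjE.
have AP : (frobg th A * P = P * A)%g by rewrite -{2}(the1 P) -snormSr.
exists #|fixf th|, e, #[cj A]%g; split=> //; first exact: fixf_gt1.
  apply: order_cj_bound; rewrite map_char_poly -frobgE.
  have -> : frobg th A = (P * A * P^-1)%g by rewrite -AP mulgK.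
  by rewrite !GL_MxE GL_VxE char_poly_conj ?GLunit.
apply: dvdn_leq; first by rewrite muln_gt0 order_gt0 (ltnW e2).
by rewrite order_dvdn expgM aeE expg_order.
Qed.

End Semilinear.

(** * Algebras generated by one matrix *)

Section MinpolyUnits.
Variables (n' : nat) (F : finFieldType).
Local Notation n := n'.+1.
Local Notation gl := {'GL_n[F]}.
Variable B : gl.
Local Notation M := (GLval B : 'M[F]_n).
Local Notation mu := (mxminpoly M).
Local Notation d := (degree_mxminpoly M).
Local Notation q := #|F|.

Definition alg_units : {set gl} := [set x : gl | (GLval x \in powers_mx M d)%MS].

Lemma alg_unitsP (x : gl) : reflect (exists p, GLval x = horner_mx M p) (x \in alg_units).
Proof.
rewrite inE; apply: (iffP idP) => [/mx_inv_hornerK<-|[p ->]]; last exact: horner_mx_mem.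
by exists (mx_inv_horner M (GLval x)).
Qed.

Lemma alg_units_group_set : group_set alg_units.
Proof.
apply/group_setP; split; first by apply/alg_unitsP; exists 1; rewrite rmorph1.
move=> x y /alg_unitsP[p xE] /alg_unitsP[r yE]; apply/alg_unitsP; exists (p * r).
by rewrite GL_ME xE yE rmorphM.
Qed.
Canonical alg_units_group := Group alg_units_group_set.

Lemma card_rV j : #|{: 'rV[F]_j}| = (q ^ j)%N.
Proof. by rewrite card_mx mul1n. Qed.

Lemma degree_le : (d <= n)%N.
Proof.
rewrite -ltnS -size_mxminpoly -(size_char_poly M) dvdp_leq ?mxminpoly_dvd_char //.
by rewrite monic_neq0 ?char_poly_monic.
Qed.

Lemma minpoly_neq0 : mu != 0.
Proof. by rewrite monic_neq0 ?mxminpoly_monic. Qed.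

Lemma horner_mx_small r : horner_mx M r = 0 -> (size r <= d)%N -> r = 0.
Proof.
move=> /mxminpoly_min dv sz; apply/eqP; apply: contraT => nz.
by have := dvdp_leq nz dv; rewrite size_mxminpoly leqNgt ltnS sz.
Qed.

Lemma horner_mx_unit r : coprimep r mu -> horner_mx M r \in unitmx.
Proof.
move/Bezout_eq1_coprimepP=> [[u v] /= E].
have := congr1 (horner_mx M) E; rewrite rmorphD !rmorphM /= mx_root_minpoly mulr0 addr0 rmorph1.
by case/mulmx1_unit.
Qed.

Lemma alg_units_sub : GLval @: alg_units \subset
  [set horner_mx M (rVpoly v) | v : 'rV[F]_d] :\ 0.
Proof.
apply/subsetP=> _ /imsetP[x Rx ->]; rewrite in_setD1; apply/andP; split.
  by apply: contraTneq (GLunit x) => ->; rewrite unitmxE det0 unitr0.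
have [p ->] := alg_unitsP _ Rx; apply/imsetP; exists (poly_rV (p %% mu)) => //.
rewrite poly_rV_K ?size_mod_mxminpoly // {1}(divp_eq p mu) rmorphD rmorphM /=.
by rewrite mx_root_minpoly mulr0 add0r.
Qed.

Lemma card_alg_units : (#|alg_units| < q ^ d)%N.
Proof.
have := subset_leq_card alg_units_sub; rewrite card_imset; last exact: GLval_inj.
move=> h; apply: leq_ltn_trans h _.
have <- : #|[set horner_mx M (rVpoly v) | v : 'rV[F]_d]| = (q ^ d)%N.
  by rewrite card_imset ?card_rV //; apply: horner_rVpoly_inj.
rewrite [X in (_ < X)%N](cardsD1 0) (_ : _ \in _) ?add1n //.
by apply/imsetP; exists 0; rewrite // !linear0.
Qed.

(* If mu = f g, the multiples of f(M) are q^(deg g) non-units. *)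
Lemma card_alg_units_factor f g : mu = f * g -> (1 < size f)%N -> (1 < size g)%N ->
  (#|alg_units| <= q ^ d - q ^ (size g).-1)%N.
Proof.
move=> fg sf sg.
have nzf : f != 0 by rewrite -size_poly_gt0 ltnW.
have nzg : g != 0 by rewrite -size_poly_gt0 ltnW.
have gM : horner_mx M g != 0.
  apply/negP=> /eqP g0; case/negP: (nzg); apply/eqP; apply: (horner_mx_small g0).
  rewrite -ltnS -size_mxminpoly fg size_mul //.
  by move: sf; case: (size f) => [|[|s]] //= _; rewrite ltnS leq_addl.
pose Y := [set horner_mx M (f * rVpoly v) | v : 'rV[F]_(size g).-1].
have cY : #|Y| = (q ^ (size g).-1)%N.
  rewrite card_imset ?card_rV // => v v' E.
  apply: (can_inj (@rVpolyK _ _)); apply/eqP; rewrite -subr_eq0; apply: contraT => nz.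
  have : mu %| f * (rVpoly v - rVpoly v').
    by apply: mxminpoly_min; rewrite mulrBr rmorphB /= E subrr.
  rewrite fg dvdp_mul2l // => /(dvdp_leq nz); rewrite leqNgt => /negP[].
  rewrite -linearB /=; apply: leq_ltn_trans (size_poly _ _) _.
  by rewrite prednK // ltnW.
have disj : [disjoint Y & GLval @: alg_units].
  apply/pred0P=> y /=; apply/negbTE/negP=> /andP[/imsetP[v _ ->] /imsetP[x _ E]].
  have := GLunit x; rewrite -E rmorphM /= => u.
  case/eqP: gM; have : horner_mx M g *m (horner_mx M f * horner_mx M (rVpoly v)) = 0.
    by rewrite -[_ *m _]/(_ * _) mulrA -rmorphM /= mulrC -fg mx_root_minpoly mul0r.
  by move/(congr1 (mulmx^~ (invmx (horner_mx M f * horner_mx M (rVpoly v))))); rewrite mulmxK // mul0mx.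
have sub : Y :|: GLval @: alg_units \subset [set horner_mx M (rVpoly v) | v : 'rV[F]_d].
  rewrite subUset (subset_trans alg_units_sub) ?subsetDl // andbT.
  apply/subsetP=> _ /imsetP[v _ ->]; set r := _ * _; apply/imsetP; exists (poly_rV (r %% mu)) => //.
  rewrite poly_rV_K ?size_mod_mxminpoly // {1}(divp_eq r mu) rmorphD rmorphM /=.
  by rewrite mx_root_minpoly mulr0 add0r.
have := subset_leq_card sub; rewrite cardsU disjoint_setI0 // cards0 subn0 cY.
rewrite card_imset; last exact: GLval_inj.
rewrite card_imset ?card_rV; last exact: horner_rVpoly_inj.
by move=> h; rewrite leq_subRL ?(leq_trans (leq_addr _ _) h).
Qed.

(** If [d < n], there are fewer than [q ^ (n - 1)] units. If [mu] factors, one factor has degree at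
    least 2 because [n >= 3], and this yields [q ^ 2] non-units where at most [q] are allowed. *)
Lemma minpoly_irreducible : (3 <= n)%N -> (q ^ n - q <= #|alg_units|)%N ->
  irreducible_poly mu /\ d = n.
Proof.
move=> n3 big; have q1 : (1 < q)%N := finRing_gt1 F.
have dn : d = n.
  apply/eqP; rewrite eqn_leq degree_le leqNgt; apply/negP; rewrite ltnS => dn.
  have : (q ^ d <= q ^ n')%N by rewrite leq_pexp2l // ltnW.
  have := card_alg_units; move: big; rewrite expnS.
  have : (q <= q ^ n')%N by rewrite -{1}[q]expn1 leq_pexp2l // ltnW.
  nia.
split=> //; split; first by rewrite size_mxminpoly dn.
move=> f sf fmu; have [g muE] := dvdpP _ _ fmu.
have nzfg : (g != 0) /\ (f != 0).
  by have := minpoly_neq0; rewrite muE mulf_eq0 negb_or => /andP[].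
have sf1 : (1 < size f)%N.
  by rewrite ltn_neqAle eq_sym sf size_poly_gt0; case: nzfg.
have [sg|sg] := eqVneq (size g) 1%N.
  by rewrite muE -{1}[f]mul1r eqp_mulr // eqp_sym -size_poly_eq1 sg.
have sg1 : (1 < size g)%N.
  by rewrite ltn_neqAle eq_sym sg size_poly_gt0; case: nzfg.
have szE : (size f + size g = n + 2)%N.
  have := size_mxminpoly M; rewrite muE size_mul; [|by case: nzfg|by case: nzfg].
  by rewrite addnC => E; rewrite -[LHS]prednK ?E ?dn ?addn2 // addn_gt0 ltnW.
have key s : (3 <= s)%N -> (#|alg_units| <= q ^ d - q ^ s.-1)%N -> False.
  move=> s3 h.
  have h2 : (q ^ 2 <= q ^ s.-1)%N by rewrite leq_pexp2l ?(ltnW q1) //; lia.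
  have h3 : (q ^ 3 <= q ^ n)%N by rewrite leq_pexp2l ?(ltnW q1).
  move: big h h2 h3; rewrite dn !expnS expn0; nia.
have [sg3|sg3] := leqP 3 (size g).
  by case: (key (size g)) => //; apply: (card_alg_units_factor (f := f)) => //; rewrite mulrC.
by case: (key (size f)) => //; [lia | exact: (card_alg_units_factor (f := g))].
Qed.

(** All powers of [B ^ s] lie in the translate by 1 of the ideal of [F[M]] generated by [M ^ s - 1],
    which has dimension [d - s]. *)
Lemma order_dvd_minpoly s : (0 < s)%N -> 'X^s - 1 %| mu -> (#[B]%g <= s * q ^ (d - s))%N.
Proof.
move=> s0 /dvdpP[nu muE].
have s1 : size ('X^s - 1 : {poly F}) = s.+1 by rewrite size_XnsubC.
have nz1 : ('X^s - 1 : {poly F}) != 0 by rewrite -size_poly_gt0 s1.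
have nznu : nu != 0 by have := minpoly_neq0; rewrite muE mulf_eq0 negb_or => /andP[].
have szE : (size nu).-1 = (d - s)%N.
  have E : (size nu + s = d.+1)%N by have := size_mxminpoly M; rewrite muE size_mul // s1 addnS.
  by rewrite -[d]/(d.+1.-1) -E -!subn1 subnAC addnK.
pose Y := [set 1 + horner_mx M (rVpoly v * ('X^s - 1)) | v : 'rV[F]_(d - s)].
have cY : (#|Y| <= q ^ (d - s))%N by apply: leq_trans (leq_imset_card _ _) _; rewrite card_rV.
have sub : GLval @: <[(B ^+ s)%g]>%g \subset Y.
  apply/subsetP=> _ /imsetP[_ /cycleP[i ->] ->].
  have [r rE] : exists r, ('X^s) ^+ i = 1 + r * ('X^s - 1) :> {poly F}.
    by exists (\sum_(j < i) 'X^s ^+ j); rewrite mulrC -subrX1 addrC subrK.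
  apply/imsetP; exists (poly_rV (r %% nu)) => //; rewrite poly_rV_K; last first.
    by rewrite -szE -ltnS prednK ?size_poly_gt0 // ltn_modp.
  rewrite !GL_X (_ : (M ^+ s) ^+ i = horner_mx M (('X^s) ^+ i)); last first.
    by rewrite !rmorphXn /= horner_mx_X.
  rewrite rE rmorphD rmorph1 {1}(divp_eq r nu) mulrDl rmorphD -mulrA -muE.
  by rewrite [X in 1 + (X + _)]rmorphM /= mx_root_minpoly mulr0 add0r.
have oB : (#[(B ^+ s)%g]%g <= q ^ (d - s))%N.
  apply: leq_trans cY; apply: leq_trans (subset_leq_card sub); rewrite card_imset //; exact: GLval_inj.
apply: leq_trans (leq_mul (leqnn s) oB); apply: dvdn_leq; first by rewrite muln_gt0 s0 order_gt0.
by rewrite order_dvdn expgM expg_order.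
Qed.

End MinpolyUnits.

Lemma index_ge3 (gT : finGroupType) (H G : {group gT}) x y : H \subset G -> x \in G -> y \in G ->
  x \notin H -> y \notin H -> (x^-1 * y)%g \notin H -> (3 * #|H| <= #|G|)%N.
Proof.
move=> sHG Gx Gy nHx nHy nHxy; rewrite -(Lagrange sHG) mulnC leq_mul2l orbC.
rewrite -card_lcosets (_ : 3 = #|[set (H : {set gT}); (x *: H)%g; (y *: H)%g]|)%N.
  rewrite subset_leq_card //; apply/subsetP=> C /setUP[/set2P[]|/set1P] ->; apply/lcosetsP.
  - by exists 1%g; rewrite ?mul1g ?group1 // lcoset1.
  - by exists x.
  - by exists y.
have n1 : (H : {set gT}) != (x *: H)%g.
  by apply: contraNneq nHx => ->; apply: lcoset_refl.
have n2 : (H : {set gT}) != (y *: H)%g.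
  by apply: contraNneq nHy => ->; apply: lcoset_refl.
have n3 : (x *: H)%g != (y *: H)%g.
  by apply: contraNneq nHxy => E; rewrite -mem_lcoset E lcoset_refl.
rewrite setUC cardsU1 cards2 !inE n1 negb_or /=.
by rewrite eq_sym n2 eq_sym n3.
Qed.

Lemma index_ge2 (gT : finGroupType) (H G : {group gT}) x : H \subset G -> x \in G ->
  x \notin H -> (2 * #|H| <= #|G|)%N.
Proof.
move=> sHG Gx nHx; rewrite -(Lagrange sHG) mulnC leq_mul2l indexg_gt1.
by apply/orP; right; apply/subsetPn; exists x.
Qed.

(** * Orders of correlations *)

Section Correlation.
Variables (k : nat) (F : finFieldType).
Local Notation n := k.+3.
Local Notation gl := {'GL_n[F]}.
Variables (P B : gl) (th : {rmorphism F -> F}).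
Hypothesis Bfix : (frobg th (iota B) ^ P)%g = B.
Local Notation M := (GLval B : 'M[F]_n).
Local Notation Mi := (invmx M : 'M[F]_n).
Local Notation q := #|F|.
Local Notation mu := (mxminpoly M).
Local Notation d := (degree_mxminpoly M).
Local Notation R := (alg_units_group B).
Local Notation kk := #[cj B]%g.

(** The correlation composed with inversion, extended to all matrices: an anti-automorphism,
    semilinear with respect to [th]. By [Bfix] it inverts [B]. *)
Definition sg (A : 'M[F]_n) : 'M[F]_n := invmx (GLval P) *m (map_mx th A)^T *m GLval P.

Lemma sgD A C : sg (A + C) = sg A + sg C.
Proof. by rewrite /sg map_mxD linearD /= mulmxDr mulmxDl. Qed.

Lemma sgM A C : sg (A *m C) = sg C *m sg A.
Proof.
rewrite /sg map_mxM trmx_mul !mulmxA; congr (_ *m _ *m _).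
by rewrite -[RHS]mulmxA mulmxV ?GLunit // mulmx1.
Qed.

Lemma sg_scalar c : sg c%:M = (th c)%:M.
Proof. by rewrite /sg map_scalar_mx tr_scalar_mx mul_mx_scalar -scalemxAl mulVmx ?GLunit // scalemx1. Qed.

Lemma sgZ c A : sg (c *: A) = th c *: sg A.
Proof. by rewrite -mul_scalar_mx sgM sg_scalar mul_mx_scalar. Qed.

Lemma sgN A : sg (- A) = - sg A.
Proof. by rewrite -scaleN1r sgZ rmorphN1 scaleN1r. Qed.

Lemma sg_M : sg M = Mi.
Proof.
have E : sg Mi = M.
  by rewrite -{2}Bfix GL_J frobgE iotaE /sg map_trmx.
have : M *m sg M = 1%:M by rewrite -{1}E -sgM mulmxV ?GLunit // sg_scalar rmorph1.
by move=> E1; rewrite -[RHS]mulmx1 -E1 mulKmx ?GLunit.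
Qed.

Lemma MMi i : M ^+ i *m Mi ^+ i = 1%:M.
Proof.
have := congr1 (@GLval n F) (mulgV (B ^+ i)%g); rewrite GL_MxE -expgVn !GL_X => E.
exact: E.
Qed.

Lemma horner_mxCM c p : horner_mx M (c%:P * p) = c *: horner_mx M p.
Proof. by rewrite rmorphM /= horner_mx_C -[_ * _]/(_ *m _) mul_scalar_mx. Qed.

Lemma sg_MX i : sg (M ^+ i) = Mi ^+ i.
Proof.
elim: i => [|i IH]; first by rewrite expr0 sg_scalar rmorph1.
by rewrite exprS -[_ * _]/(_ *m _) sgM IH sg_M exprSr.
Qed.

(* As sg inverts M, psi takes scalar values on F^* <M>; so units of F[M] whose psi-values
   are not proportional lie in different cosets of F^* <M>. *)
Definition psi (A : 'M[F]_n) := A *m sg A.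

(** This is [F^* <B>]; written as a preimage under [cj], its order is immediate. *)
Definition cyc_scalars := (cj_morphism k F @*^-1 <[cj B]>)%G.
Local Notation H0 := cyc_scalars.

Lemma cyc_scalarsP (x : gl) : reflect (exists c i, c != 0 /\ GLval x = c *: M ^+ i) (x \in H0).
Proof.
have -> : (x \in H0) = (cj x \in <[cj B]>%g).
  by apply/morphpreP/idP => [[]|h] //; split=> //; rewrite inE.
apply: (iffP (cycleP _ _)) => [[i xE]|[c [i [nz xE]]]].
  have /cj_eqP[c nz E] : cj x == cj (B ^+ i)%g by rewrite cjX -xE.
  by exists c, i; rewrite -GL_X.
by exists i; rewrite -cjX; apply/eqP/cj_eqP; exists c; rewrite ?GL_X.
Qed.

Lemma cyc_scalars_sub : H0 \subset R.
Proof.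
apply/subsetP=> x /cyc_scalarsP[c [i [_ xE]]]; apply/alg_unitsP; exists (c *: 'X^i).
by rewrite linearZ /= rmorphXn /= horner_mx_X.
Qed.

Lemma card_cyc_scalars : #|H0| = (kk * q.-1)%N.
Proof.
rewrite -(@card_cj_image k F H0).
  rewrite morphpreK //; apply/subsetP=> _ /cycleP[i ->]; rewrite -cjX.
  by apply: (mem_morphim (cj_morphism k F)); rewrite in_setT.
apply/subsetP=> x /scalarsP[c nz xE]; apply/cyc_scalarsP; exists c, 0%N.
by rewrite expr0 xE scalemx1.
Qed.

Lemma psi_cyc (y : gl) : y \in H0 -> exists2 s, s != 0 & psi (GLval y) = s%:M.
Proof.
case/cyc_scalarsP=> c [i [nz ->]]; exists (c * th c); first by rewrite mulf_neq0 ?fmorph_eq0.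
by rewrite /psi sgZ sg_MX -scalemxAl -scalemxAr MMi scalerA scalemx1.
Qed.

Lemma psi_mul (x y : gl) : y \in H0 -> exists2 s, s != 0 & psi (GLval (x * y)%g) = s *: psi (GLval x).
Proof.
case/psi_cyc=> s nz; rewrite /psi => E; exists s => //.
by rewrite GL_MxE sgM -mulmxA (mulmxA (GLval y)) E mul_scalar_mx -scalemxAr.
Qed.

Lemma psi_notin (x : gl) : ~ (exists s, psi (GLval x) = s%:M) -> x \notin H0.
Proof. by move=> nE; apply/negP=> /psi_cyc[s _ E]; apply: nE; exists s. Qed.

(** As [sg (M - a)] is [M^-1 - th a], multiplication by [M] clears the inverse. What remains is a
    quadratic in [M], whose coefficients are determined when [d >= 3]. *)
Lemma psi_linear a : psi (M - a%:M) *m M =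
  horner_mx M ((- a)%:P + (1 + a * th a)%:P * 'X + (- th a)%:P * 'X^2).
Proof.
have -> : (- a)%:P + (1 + a * th a)%:P * 'X + (- th a)%:P * 'X^2 =
    ('X - a%:P) * (1 - (th a)%:P * 'X).
  by rewrite !(polyCD, polyCN, polyCM); ring.
rewrite rmorphM !rmorphB rmorphM rmorph1 /= horner_mx_X !horner_mx_C.
rewrite -[RHS]/((M - a%:M) *m (1%:M - (th a)%:M *m M)).
by rewrite /psi sgD sgN sg_M sg_scalar -mulmxA; congr (_ *m _); rewrite mulmxBl mulVmx ?GLunit.
Qed.

Lemma quadratic_eq0 c0 c1 c2 : (3 <= d)%N ->
  horner_mx M (c0%:P + c1%:P * 'X + c2%:P * 'X^2) = 0 -> [/\ c0 = 0, c1 = 0 & c2 = 0].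
Proof.
move=> d3 E; have pE : c0%:P + c1%:P * 'X + c2%:P * 'X^2 = Poly [:: c0; c1; c2].
  by rewrite /= !cons_poly_def; ring.
have := horner_mx_small E; rewrite pE => /(_ (leq_trans (size_Poly [:: c0; c1; c2]) d3)) p0.
have c i : nth 0 [:: c0; c1; c2] i = 0 by rewrite -coef_Poly p0 coef0.
by split; [apply: (c 0%N) | apply: (c 1%N) | apply: (c 2%N)].
Qed.

Lemma psi_linear_scalar a : (3 <= d)%N -> a != 0 -> ~ exists s, psi (M - a%:M) = s%:M.
Proof.
move=> d3 nza [s E]; have := psi_linear a; rewrite E mul_scalar_mx => E1.
have [|_ _ /eqP] := @quadratic_eq0 (- a) (1 + a * th a - s) (- th a) d3; last first.
  by rewrite oppr_eq0 fmorph_eq0 (negPf nza).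
rewrite (_ : _ + _ = (- a)%:P + (1 + a * th a)%:P * 'X + (- th a)%:P * 'X^2 - s%:P * 'X).
  by rewrite rmorphB /= -E1 horner_mxCM horner_mx_X subrr.
by rewrite !(polyCD, polyCN, polyCM); ring.
Qed.

(** The outer coefficients give [s = a = th a], and the middle one becomes [(a - 1)^2 = 0]. *)
Lemma psi_linear_prop a s : (3 <= d)%N -> a != 0 ->
  psi (M - a%:M) = s *: psi (M - 1%:M) -> a = 1.
Proof.
move=> d3 nza E.
have E1 := psi_linear a; have E2 := psi_linear 1; move: E1; rewrite E -scalemxAl E2 rmorph1 => E1.
have [|c0 c1 c2] := @quadratic_eq0 (s - a) (1 + a * th a - s * 2) (s - th a) d3.
  pose Q1 : {poly F} := (- 1)%:P + (1 + 1 * 1)%:P * 'X + (- 1)%:P * 'X^2.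
  pose Qa : {poly F} := (- a)%:P + (1 + a * th a)%:P * 'X + (- th a)%:P * 'X^2.
  rewrite (_ : _ + _ = Qa - s%:P * Q1); first by rewrite rmorphB /= horner_mxCM -E1 subrr.
  by rewrite /Q1 /Qa !(polyCD, polyCN, polyCM); ring.
move/subr0_eq: c0 => c0; move/subr0_eq: c2 => c2; move: c1; rewrite -c2 c0 => c1.
have : (a - 1) ^+ 2 = 0 by rewrite -c1; ring.
by move/eqP; rewrite expf_eq0 /= subr_eq0 => /eqP.
Qed.

Lemma linear_unit a : ~~ root mu a -> M - a%:M \in unitmx.
Proof.
move=> nr; have := @horner_mx_unit _ _ B ('X - a%:P); rewrite rmorphB /= horner_mx_X horner_mx_C; apply.
by rewrite coprimep_sym coprimep_XsubC.
Qed.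

Lemma linear_alg a : ~~ root mu a -> exists2 x, x \in R & GLval x = M - a%:M.
Proof.
move=> /linear_unit u; exists (mkGL (M - a%:M)); last by rewrite mkGLK.
apply/alg_unitsP; exists ('X - a%:P).
by rewrite mkGLK // rmorphB /= horner_mx_X horner_mx_C.
Qed.

Lemma irreducible_no_root a : irreducible_poly mu -> (3 <= d)%N -> ~~ root mu a.
Proof.
move=> [_ irr] d3; rewrite root_factor_theorem; apply/negP=> /irr.
rewrite size_XsubC => /(_ isT)/eqp_size; rewrite size_XsubC size_mxminpoly => -[d1].
by rewrite -d1 in d3.
Qed.

(** The factor 2 reflects that [B] induces the square of the correlation, whose order may be half as
    large. *)
Hypothesis big : (q ^ n - q <= 2 * #|H0|)%N.

Lemma R_lt : (#|R| < q ^ d)%N. Proof. exact: card_alg_units. Qed.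

Lemma H0_le : (#|H0| <= #|R|)%N. Proof. exact: subset_leq_card cyc_scalars_sub. Qed.

Lemma qn_ge : (4 * q <= q ^ n)%N.
Proof.
have q1 := finRing_gt1 F; apply: (@leq_trans (q ^ 3)).
  by rewrite expnSr leq_mul2r -[4%N]/(2 ^ 2)%N leq_exp2r // q1 orbT.
by rewrite leq_pexp2l // ltnW.
Qed.

(** A single unit outside [F^* <B>] doubles the lower bound for the unit group, which compensates
    the factor 2 in [big]. *)
Lemma index_irr x : x \in R -> x \notin H0 -> irreducible_poly mu /\ d = n.
Proof.
move=> Rx nHx; apply: minpoly_irreducible => //.
by apply: leq_trans big _; apply: index_ge2 cyc_scalars_sub Rx nHx.
Qed.

Lemma no_index3 x y : x \in R -> y \in R -> x \notin H0 -> y \notin H0 -> (x^-1 * y)%g \notin H0 -> False.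
Proof.
move=> Rx Ry nx ny nxy; have := index_ge3 cyc_scalars_sub Rx Ry nx ny nxy.
have dn : d = n by case: (index_irr Rx nx).
have := R_lt; rewrite dn; have := qn_ge; move: big.
move: (q ^ n)%N #|H0| #|R| q => *; lia.
Qed.

(** If some nonzero scalar is not an eigenvalue of [M], one obtains a field, in which [M - 1] and
    [M - b] give the forbidden index three. Otherwise [mu] vanishes on all of [F^*], and the order
    of [B] is too small. *)
Lemma correlation_ge3 : (3 <= q)%N -> (n, q) != (3, 3) -> False.
Proof.
move=> q3 nq.
have dn : d = n.
  apply/eqP; rewrite eqn_leq degree_le leqNgt; apply/negP; rewrite ltnS => dn.
  have h1 : (q ^ d <= q ^ k.+2)%N by rewrite leq_pexp2l // ltnW // ltnW.
  have h2 : (q <= q ^ k.+2)%N by rewrite -{1}[q]expn1 leq_pexp2l // ltnW // ltnW.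
  have := R_lt; have := H0_le; move: big; rewrite expnS.
  nia.
have d3 : (3 <= d)%N by rewrite dn.
case: (boolP [exists a : F, (a != 0) && ~~ root mu a]) => [/existsP[a /andP[nza nra]]|].
  have [x Rx xE] := linear_alg nra.
  have nHx : x \notin H0 by apply: psi_notin; rewrite xE; apply: psi_linear_scalar.
  have [irr _] := index_irr Rx nHx.
  have [b [nzb nb1]] : exists b : F, b != 0 /\ b != 1.
    have : (0 < #|~: [set (0%R : F); 1%R]|)%N.
      by rewrite -(ltn_add2l #|[set (0%R : F); 1%R]|) addn0 cardsC cards2 eq_sym oner_eq0.
    by case/card_gt0P=> b; rewrite !inE negb_or => /andP[]; exists b.
  have [y Ry yE] := linear_alg (irreducible_no_root b irr d3).
  have [z Rz zE] := linear_alg (irreducible_no_root 1 irr d3).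
  have nHy : y \notin H0 by apply: psi_notin; rewrite yE; apply: psi_linear_scalar.
  have nHz : z \notin H0 by apply: psi_notin; rewrite zE; apply: psi_linear_scalar; rewrite ?oner_neq0.
  apply: (no_index3 Rz Ry nHz nHy); apply/negP=> Hzy; have [s _] := psi_mul z Hzy.
  rewrite mulKVg yE zE => /psi_linear_prop E.
  by case/eqP: nb1; apply: E.
rewrite negb_exists => /forallP allr.
have dv : 'X^(q.-1) - 1 %| mu.
  (* The extra factor ['X] supplies the root 0, so that ['X^q - 'X], the product of all ['X - a],
     can be compared with ['X * mu]. *)
  rewrite -(dvdp_mul2l (r := 'X)) ?polyX_eq0 //.
  rewrite mulrBr mulr1 -exprS prednK; last by rewrite ltnW // ltnW.
  rewrite finField_genPoly -big_enum; apply: uniq_roots_dvdp.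
    apply/allP=> a _; rewrite rootM; have := allr a; rewrite negb_and !negbK => /orP[/eqP->|->].
      by rewrite rootX eqxx.
    by rewrite orbT.
  by rewrite uniq_rootsE enum_uniq.
have qs : (0 < q.-1)%N by lia.
have oB := order_dvd_minpoly qs dv.
have sd : (q.-1 <= n)%N.
  rewrite -dn -ltnS -size_mxminpoly; apply: leq_trans (dvdp_leq (minpoly_neq0 B) dv).
  by rewrite size_XnsubC.
have kB : (kk <= #[B]%g)%N.
  by apply: dvdn_leq; rewrite ?order_gt0 // order_dvdn -cjX expg_order cj1.
move: big; rewrite card_cyc_scalars.
(* For [q = 3] the inequalities reduce to [3 ^ (n - 2) <= 3], a contradiction except for [n = 3]. *)
have [q3'|q4] := eqVneq q 3%N.
  have n4 : (0 < k)%N by move: nq; rewrite xpair_eqE q3' eqxx andbT; case: (k).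
  move: oB; rewrite dn q3' /= (_ : n - 2 = k.+1)%N; last by lia.
  have : (3 <= 3 ^ k)%N by rewrite -{1}[3%N]expn1 leq_pexp2l.
  by rewrite !expnS; move: kB; move: kk #[B]%g (3 ^ k)%N => *; lia.
have h3 : (q ^ (d - q.-1) <= q ^ k)%N by rewrite leq_pexp2l ?dn //; lia.
have : (0 < q ^ k)%N by rewrite expn_gt0; lia.
rewrite !expnS; move: oB kB h3; have : (4 <= q)%N by lia.
move: (q ^ k)%N (q ^ (d - q.-1))%N => u v q4' oB kB vu u0 bg.
have h1 : (kk <= q.-1 * u)%N by apply: leq_trans kB (leq_trans oB _); rewrite leq_mul2l vu orbT.
have h2 : (2 * (kk * q.-1) <= 2 * (q.-1 * u * q.-1))%N by rewrite leq_mul2l leq_mul2r h1 !orbT.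
have [q' qE] : exists q', q = q'.+4 by exists (q - 4)%N; lia.
move: bg h2; rewrite qE /=; nia.
Qed.

(** Over two elements 1 is the only nonzero scalar, so the second test unit is [M^2 + M + 1] instead
    of [M - b]. Proportional values of [psi] would force [M] to have order at most 6. If both test
    elements are singular, ['X^3 - 1] divides [mu]. *)
Lemma correlation_2 : q = 2%N -> (4 <= n)%N -> False.
Proof.
move=> q2 n4.
have F01 (s : F) : s = 0 \/ s = 1.
  have : s \in [set 0%R; 1%R].
    suff -> : [set 0%R; 1%R] = [set: F] by rewrite inE.
    by apply/eqP; rewrite eqEcard subsetT cardsT cards2 eq_sym oner_eq0 q2.
  by case/set2P; [left | right].
have two : 1 + 1 = 0 :> F.
  by case: (F01 (1 + 1)) => // /eqP; rewrite -subr_eq0 addrK oner_eq0.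
have twoP : 1 + 1 = 0 :> {poly F} by rewrite -polyC1 -polyCD two.
have H0k : #|H0| = kk by rewrite card_cyc_scalars q2 muln1.
have big2 : (2 ^ n - 2 <= 2 * kk)%N by rewrite -H0k -{1 2}q2.
have n16 : (16 <= 2 ^ n)%N by rewrite -[16%N]/(2 ^ 4)%N leq_pexp2l.
have kk7 : (7 <= kk)%N by move: big2 n16; move: (2 ^ n)%N kk => *; lia.
(* The constant 7 comes from [2 * kk >= 2 ^ 4 - 2]. *)
have ord j : (0 < j < 7)%N -> horner_mx M ('X^j - 1) = 0 -> False.
  case/andP=> j0 j7; rewrite rmorphB rmorphXn rmorph1 /= horner_mx_X => /subr0_eq E.
  have Bj : (B ^+ j)%g = 1%g by apply: GLval_inj; rewrite GL_X.
  have : (kk <= j)%N by apply: dvdn_leq => //; rewrite order_dvdn -cjX Bj cj1.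
  by move=> h; have := leq_trans (leq_trans kk7 h) j7; rewrite ltnn.
have d3 : (3 <= d)%N.
  rewrite leqNgt; apply/negP; rewrite ltnS => d2.
  have h1 : (2 ^ d <= 2 ^ 2)%N by rewrite leq_pexp2l.
  have := R_lt; have := H0_le; rewrite H0k q2 => h2 h3.
  by have := leq_ltn_trans (leq_trans kk7 h2) (leq_trans h3 h1).
pose c3 : {poly F} := 'X^2 + 'X + 1.
have c3sq : c3 * c3 = 'X^4 + 'X^2 + 1.
  rewrite (_ : c3 * c3 = 'X^4 + 'X^2 + 1 + (1 + 1) * ('X^3 + 'X^2 + 'X)); last by rewrite /c3; ring.
  by rewrite twoP mul0r addr0.
have psi3 : psi (horner_mx M c3) *m (M ^+ 2) = horner_mx M ('X^4 + 'X^2 + 1).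
  rewrite -c3sq rmorphM /= -[RHS]/(_ *m _) /psi -mulmxA; congr (_ *m _).
  have hE : horner_mx M c3 = M ^+ 2 + M + 1%:M.
    by rewrite !rmorphD rmorphXn rmorph1 /= horner_mx_X.
  rewrite {1}hE !sgD sg_scalar rmorph1 sg_MX sg_M !mulmxDl mul1mx hE.
  have -> : Mi ^+ 2 *m M ^+ 2 = 1%:M.
    have := congr1 (@GLval n F) (mulVg (B ^+ 2)%g); rewrite GL_MxE -expgVn !GL_X => E.
    exact: E.
  have -> : Mi *m M ^+ 2 = M by rewrite expr2 -[M * M]/(M *m M) mulKmx ?GLunit.
  by rewrite addrC addrA addrAC.
(* A scalar value 0 would give [M ^ 6 = 1], and a scalar value 1 would give [M ^ 4 = 1]. *)
have psi3_scalar : ~ exists s, psi (horner_mx M c3) = s%:M.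
  case=> s E; move: psi3; rewrite E mul_scalar_mx => E1.
  have E2 : horner_mx M ('X^4 + 'X^2 + 1 - s%:P * 'X^2) = 0.
    by rewrite rmorphB /= -E1 horner_mxCM rmorphXn /= horner_mx_X subrr.
  case: (F01 s) => sE; move: E2; rewrite sE.
    rewrite polyC0 mul0r subr0 => E2; apply: (ord 6%N) => //.
    rewrite (_ : 'X^6 - 1 = ('X^2 - 1) * ('X^4 + 'X^2 + 1)); last by ring.
    by rewrite rmorphM /= E2 mulr0.
  move=> E2; apply: (ord 4%N) => //; rewrite -[RHS]E2; congr horner_mx.
  rewrite polyC1 (_ : 'X^4 - 1 = 'X^4 + 1 - (1 + 1)); last by ring.
  by rewrite twoP; ring.
have nHx3 (x : gl) : GLval x = horner_mx M c3 -> x \notin H0.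
  by move=> xE; apply: psi_notin; rewrite xE.
have alg3 : coprimep c3 mu -> exists2 x, x \in R & GLval x = horner_mx M c3.
  move=> /horner_mx_unit u; exists (mkGL (horner_mx M c3)); last by rewrite mkGLK.
  by apply/alg_unitsP; exists c3; rewrite mkGLK.
have c3irr : irreducible_poly c3.
  have sz : size c3 = 3%N.
    rewrite /c3 -addrA size_polyDl size_polyXn // -polyC1 size_XaddC //.
  apply: cubic_irreducible; first by rewrite sz.
  move=> x; rewrite /root /c3 !hornerE; case: (F01 x) => ->; rewrite ?expr0n ?expr1n ?add0r ?oner_eq0 //.
  by rewrite two add0r oner_eq0.
have c3dv : ~~ coprimep c3 mu -> c3 %| mu.
  move=> nc; have := c3irr.2 (gcdp c3 mu) nc (dvdp_gcdl _ _) => /eqp_dvdl <-.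
  exact: dvdp_gcdr.
case: (boolP (root mu 1)) => r1; last first.
  have [x Rx xE] := linear_alg r1.
  have nHx : x \notin H0 by apply: psi_notin; rewrite xE; apply: psi_linear_scalar; rewrite ?oner_neq0.
  have [irr dn] := index_irr Rx nHx.
  have [|y Ry yE] := alg3.
    apply: contraT => /c3dv dv; have sz := c3irr.1.
    have := irr.2 c3 _ dv; rewrite gtn_eqF // => /(_ isT)/eqp_size.
    rewrite size_mxminpoly dn /c3 -addrA size_polyDl size_polyXn; last by rewrite -polyC1 size_XaddC.
    by move=> [E]; rewrite -E in n4.
  have nHy := nHx3 y yE.
  apply: (no_index3 Rx Ry nHx nHy); apply/negP=> Hxy; have [s nzs] := psi_mul x Hxy.
  rewrite mulKVg yE xE; case: (F01 s) => sE; first by rewrite sE eqxx in nzs.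
  (* Equal values of [psi] give [M^4 + M^3 + M^2 + M + 1 = 0], hence [M ^ 5 = 1]. *)
  rewrite sE scale1r => E; apply: (ord 5%N) => //.
  have E1 : horner_mx M ('X^4 + 'X^2 + 1 - ((- 1)%:P + (1 + 1 * th 1)%:P * 'X + (- th 1)%:P * 'X^2) * 'X) = 0.
    rewrite rmorphB rmorphM /= -psi3 E -psi_linear horner_mx_X.
    by apply/eqP; rewrite subr_eq0 expr2; apply/eqP; exact: mulmxA.
  move: E1; rewrite rmorph1 mulr1 two polyC0 mul0r addr0 polyCN polyC1 => E1.
  rewrite (_ : 'X^5 - 1 = ('X - 1) * ('X^4 + 'X^2 + 1 - (-1 + -1 * 'X^2) * 'X)).
    by rewrite rmorphM /= E1 mulr0.
  by ring.
case: (boolP (coprimep c3 mu)) => [/alg3[y Ry yE]|/c3dv dv3].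
  have [irr _] := index_irr Ry (nHx3 y yE).
  by have := irreducible_no_root 1 irr d3; rewrite r1.
have dv : 'X^3 - 1 %| mu.
  rewrite (_ : 'X^3 - 1 = ('X - 1%:P) * c3); last by rewrite /c3 polyC1; ring.
  rewrite Gauss_dvdp ?dv3 ?andbT -?root_factor_theorem //.
  rewrite coprimep_sym coprimep_XsubC /root /c3 !hornerE expr1n.
  by rewrite two add0r oner_eq0.
(* Now [kk <= 3 * 2 ^ (n - 3)], against [2 * kk >= 2 ^ n - 2] as soon as [n >= 4]. *)
have oB := order_dvd_minpoly (isT : (0 < 3)%N) dv.
have kB : (kk <= #[B]%g)%N.
  by apply: dvdn_leq; rewrite ?order_gt0 // order_dvdn -cjX expg_order cj1.
have h3 : (2 ^ (d - 3) <= 2 ^ k)%N.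
  by rewrite leq_pexp2l // leq_subLR; apply: leq_trans (degree_le B) _; rewrite addnC addn3.
have k1 : (2 <= 2 ^ k)%N by rewrite -{1}[2%N]expn1 leq_pexp2l //.
move: big2 oB kB h3 k1; rewrite q2 !expnS; move: (2 ^ k)%N (2 ^ (d - 3))%N kk #[B]%g => *; lia.
Qed.

End Correlation.

(** * Matrices annihilated by an irreducible polynomial of degree n *)

Section IrreducibleUnits.
Variables (n' : nat) (F : finFieldType).
Local Notation n := n'.+1.
Local Notation gl := {'GL_n[F]}.
Variables (mu : {poly F}).
Hypotheses (irr : irreducible_poly mu) (size_mu : size mu = n.+1).

Lemma irreducible_coprime (r : {poly F}) : r != 0 -> (size r <= n)%N -> coprimep r mu.
Proof.
move=> nzr sr; apply: contraT => nc.
have := irr.2 (gcdp r mu) nc (dvdp_gcdr _ _) => /eqp_dvdl dv.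
have : mu %| r by rewrite -dv dvdp_gcdl.
by move/(dvdp_leq nzr); rewrite size_mu leqNgt ltnS sr.
Qed.

Lemma irreducible_horner_unit (A : 'M[F]_n) (r : {poly F}) : horner_mx A mu = 0 -> r != 0 ->
  (size r <= n)%N -> horner_mx A r \in unitmx.
Proof.
move=> A0 nzr sr; have /Bezout_eq1_coprimepP[[u v] /= E] := irreducible_coprime nzr sr.
have := congr1 (horner_mx A) E; rewrite rmorphD !rmorphM /= A0 mulr0 addr0 rmorph1.
by case/mulmx1_unit.
Qed.

(** The change of basis to [e_0, e_0 A, e_0 A^2, ...]; it turns [A] into [krylov_companion], which
    depends on [mu] only, so two matrices killed by [mu] are conjugate over [F]. *)
Definition krylov (A : 'M[F]_n) : 'M[F]_n := \matrix_(i < n) (delta_mx 0 0 *m A ^+ i).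

Lemma krylov_rVpoly A (u : 'rV[F]_n) :
  u *m krylov A = delta_mx 0 0 *m horner_mx A (rVpoly u).
Proof.
rewrite horner_rVpoly /powers_mx mulmx_sum_row [u *m \matrix_i _]mulmx_sum_row linear_sum mulmx_sumr.
by apply: eq_bigr => i _; rewrite !rowK linearZ /= mxvecK -scalemxAr.
Qed.

(** A linear relation between the rows is [e_0 r(A) = 0] with [deg r < n], and [r(A)] is invertible
    for nonzero [r]. *)
Lemma krylov_unit (A : 'M[F]_n) : horner_mx A mu = 0 -> krylov A \in unitmx.
Proof.
move=> A0; rewrite -row_free_unit; apply: inj_row_free => u; rewrite krylov_rVpoly => E.
apply/eqP; apply: contraT => nzu.
have nzr : rVpoly u != 0 by apply: contra nzu => /eqP r0; rewrite -[u]rVpolyK r0 linear0.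
have uA := irreducible_horner_unit A0 nzr (size_poly _ _).
move/(congr1 (mulmx^~ (invmx (horner_mx A (rVpoly u))))): E; rewrite mulmxK // mul0mx.
by move/matrixP/(_ 0 0)/eqP; rewrite !mxE oner_eq0.
Qed.

Definition krylov_companion : 'M[F]_n := \matrix_(i < n) poly_rV ('X^(i.+1) %% mu).

Lemma krylov_comm (A : 'M[F]_n) : horner_mx A mu = 0 -> krylov A *m A = krylov_companion *m krylov A.
Proof.
move=> A0; apply/row_matrixP=> i; rewrite !row_mul !rowK krylov_rVpoly.
have nzmu : mu != 0 by rewrite -size_poly_gt0 size_mu.
rewrite poly_rV_K; last by rewrite -ltnS -size_mu ltn_modp.
have := congr1 (horner_mx A) (divp_eq 'X^(i.+1) mu).
rewrite rmorphD rmorphM /= A0 mulr0 add0r rmorphXn /= horner_mx_X => <-.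
by rewrite -mulmxA exprSr.
Qed.

Lemma same_minpoly_conj (A C : 'M[F]_n) : horner_mx A mu = 0 -> horner_mx C mu = 0 ->
  exists x : gl, invmx (GLval x) *m A *m GLval x = C.
Proof.
move=> A0 C0; have uA := krylov_unit A0; have uC := krylov_unit C0.
have uAC : invmx (krylov A) *m krylov C \in unitmx by rewrite unitmx_mul unitmx_inv uA.
exists (mkGL (invmx (krylov A) *m krylov C)); rewrite mkGLK //.
have E : A *m invmx (krylov A) = invmx (krylov A) *m krylov_companion.
  by apply: (can_inj (mulKmx uA)); rewrite mulmxA krylov_comm // mulmxK // mulKVmx.
apply: (can_inj (mulKmx uAC)); rewrite -mulmxA mulKVmx // mulmxA E -!mulmxA.
by rewrite krylov_comm.
Qed.

(** A matrix commuting with [A] is determined by the image of the cyclic vector [e_0], and some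
    [r(A)] has the same image. *)
Lemma cent_horner (A C : 'M[F]_n) : horner_mx A mu = 0 -> C *m A = A *m C -> exists r, C = horner_mx A r.
Proof.
move=> A0 CA; have uA := krylov_unit A0.
pose r := rVpoly ((delta_mx 0 0 : 'rV[F]_n) *m C *m invmx (krylov A)); exists r.
have cr : horner_mx A r *m C = C *m horner_mx A r.
  by apply/esym; apply: comm_mx_horner.
have E0 : (delta_mx 0 0 : 'rV[F]_n) *m C = delta_mx 0 0 *m horner_mx A r.
  by rewrite /r -krylov_rVpoly mulmxKV.
apply: (can_inj (mulKmx uA)); apply/row_matrixP=> i; rewrite !row_mul !rowK.
have cX B : B *m A = A *m B -> A ^+ i *m B = B *m A ^+ i.
  move=> cB; have /esym := comm_mx_horner ('X^i) cB.
  by rewrite rmorphXn /= horner_mx_X.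
rewrite -!mulmxA cX // cX ?mulmxA ?E0 //.
by rewrite -[LHS]/(_ * _) -{2}(horner_mx_X A) -rmorphM mulrC rmorphM /= horner_mx_X.
Qed.

End IrreducibleUnits.

(** * Automorphisms of large order come from field generators *)

Section LargeOrder.
Variables (k : nat) (F : finFieldType).
Local Notation n := k.+3.
Local Notation gl := {'GL_n[F]}.
Local Notation Z := 'Z(SL_group n F).
Local Notation S := (PSL n F).
Local Notation q := #|F|.

Lemma card_alg_units_irr (B : gl) : irreducible_poly (mxminpoly (GLval B : 'M[F]_n)) ->
  degree_mxminpoly (GLval B : 'M[F]_n) = n -> #|alg_units B| = (q ^ n).-1.
Proof.
move=> irr dn; pose M : 'M[F]_n := GLval B.
have szm : size (mxminpoly M) = n.+1 by rewrite size_mxminpoly dn.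
have -> : #|alg_units B| = #|[set u : 'rV[F]_n | u != 0]|.
  rewrite -(card_imset _ (@GLval_inj _ _)).
  rewrite -(card_in_imset (f := fun u : 'rV[F]_n => horner_mx M (rVpoly u))); last first.
    move=> u v _ _ E; apply: (can_inj (@rVpolyK _ _)); apply/eqP; rewrite -subr_eq0; apply/eqP.
    apply: (@horner_mx_small _ _ B); first by rewrite rmorphB /= E subrr.
    by rewrite dn -linearB size_poly.
  apply: eq_card => A; apply/imsetP/imsetP => [[x /alg_unitsP[r rE] ->]|[u nzu ->]].
    have sr : (size (r %% mxminpoly M)%R <= n)%N by rewrite -dn size_mod_mxminpoly.
    have rE2 : GLval x = horner_mx M (r %% mxminpoly M).
      by rewrite rE {1}(divp_eq r (mxminpoly M)) rmorphD rmorphM /= mx_root_minpoly mulr0 add0r.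
    exists (poly_rV (r %% mxminpoly M)); last by rewrite poly_rV_K.
    rewrite inE; apply: contraTneq (GLunit x) => p0.
    by rewrite rE2 -(poly_rV_K sr) p0 !linear0 unitmxE det0 unitr0.
  rewrite inE in nzu; have nzr : rVpoly u != 0.
    by apply: contra nzu => /eqP r0; rewrite -[u]rVpolyK r0 linear0.
  have uA := irreducible_horner_unit irr szm (mx_root_minpoly M) nzr (size_poly _ _).
  exists (mkGL (horner_mx M (rVpoly u))); last by rewrite mkGLK.
  by apply/alg_unitsP; exists (rVpoly u); rewrite mkGLK.
have -> : [set u : 'rV[F]_n | u != 0] = [set~ 0] by apply/setP=> u; rewrite !inE.
by rewrite cardsC1 card_rV.
Qed.

Lemma iota_frobg th (x : gl) : iota (frobg th x) = frobg th (iota x).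
Proof.
by apply: GLval_inj; rewrite iotaE !frobgE iotaE -map_invmx map_trmx.
Qed.

Lemma iotaJ (x y : gl) : iota (x ^ y)%g = (iota x ^ iota y)%g.
Proof.
have iV : iota y^-1%g = (iota y)^-1%g.
  by apply: GLval_inj; rewrite GL_VxE !iotaE GL_VxE invmxK trmx_inv invmxK.
by rewrite !conjgE !iotaM iV.
Qed.

(** The square of [a] is [x |-> th^2(x) ^ B]. Either [th^2] is nontrivial and the semilinear bound
    applies, or the square is [cj B] and the correlation fixes [B], which is [Bfix]. *)
Lemma no_correlation (a : {perm coset_of Z}) (P : gl) th :
  a \in Aut S -> (n, q) \notin [:: (3, 2); (3, 3); (3, 4)]%N ->
  (q ^ n - q <= q.-1 * #[a]%g)%N ->
  (forall x, x \in SL n F -> a (coset Z x) = coset Z (frobg th (iota x) ^ P)%g) -> False.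
Proof.
move=> Aa nq big aE; pose B := (frobg th (iota P) * P)%g.
have gS x : x \in SL n F -> (frobg th (iota x) ^ P)%g \in SL n F.
  by move=> SLx; rewrite SL_J frobg_SL ?iota_SL.
have a2E x : x \in SL n F -> (a ^+ 2)%g (coset Z x) = coset Z (frobg th (frobg th x) ^ B)%g.
  move=> SLx; rewrite (aut_iter 2 gS aE) //=; congr (coset _ _).
  by rewrite iotaJ frobgJ iota_frobg iotaK conjgM.
have Aa2 : (a ^+ 2)%g \in Aut S by rewrite groupX.
have o2 : (#[a]%g <= 2 * #[(a ^+ 2)%g]%g)%N.
  by apply: dvdn_leq; rewrite ?muln_gt0 ?order_gt0 // order_dvdn expgM expg_order.
pose th2 : {rmorphism F -> F} := th \o th.
case: (boolP [forall c, th2 c == c]) => [/forallP th2id|nth2]; last first.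
  have a2E' x : x \in SL n F -> (a ^+ 2)%g (coset Z x) = coset Z (frobg th2 x ^ B)%g.
    move=> SLx; rewrite a2E //; have -> // : frobg th (frobg th x) = frobg th2 x.
    by apply: GLval_inj; rewrite !frobgE; apply/matrixP=> i j; rewrite !mxE.
  have [|q0 [e [m [q02 e2 qe mB oB]]]] := semilinear_order Aa2 _ a2E'.
    by move=> th2id; case/negP: nth2; apply/forallP=> c; rewrite th2id.
  apply: (@semilinear_bound q0 e q n m #[a]%g) => //.
    by apply: contra nq => /eqP->; rewrite !inE eqxx !orbT.
  by apply: leq_trans o2 _; rewrite leq_mul2l oB.
have thth x : frobg th (frobg th x) = x.
  by apply: GLval_inj; rewrite !frobgE; apply/matrixP=> i j; rewrite !mxE; apply/eqP; exact: th2id.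
have a2B : (a ^+ 2)%g = cj B.
  by apply: Aut_eqP; rewrite ?cj_Aut // => x SLx; rewrite a2E // cjE // thth.
have Bfix : (frobg th (iota B) ^ P)%g = B.
  rewrite /B iotaM iota_frobg iotaK frobgM thth conjgE.
  by rewrite -mulgA mulKg.
have bigB : (q ^ n - q <= 2 * #|cyc_scalars B|)%N.
  rewrite card_cyc_scalars -a2B; apply: leq_trans big _.
  by rewrite mulnA mulnC leq_mul2r o2 orbT.
have [q2|q2] := eqVneq q 2%N.
  apply: (correlation_2 Bfix bigB q2).
  by rewrite ltnS; move: nq; rewrite q2 !inE !xpair_eqE; case: (k).
apply: (correlation_ge3 Bfix bigB).
  by rewrite ltn_neqAle eq_sym q2 finRing_gt1.
by apply: contra nq => /eqP->; rewrite !inE eqxx !orbT.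
Qed.

Lemma aut_large_order (a : {perm coset_of Z}) : simple S ->
  a \in Aut S -> (n, q) \notin [:: (3, 2); (3, 3); (3, 4)]%N ->
  (q ^ n - q <= q.-1 * #[a]%g)%N ->
  exists P : gl, [/\ a = cj P, irreducible_poly (mxminpoly (GLval P : 'M[F]_n)),
    degree_mxminpoly (GLval P : 'M[F]_n) = n, cyc_scalars P = alg_units_group P
    & (#[a]%g * q.-1 = (q ^ n).-1)%N].
Proof.
move=> simS Aa nq big; have [P [th [[] aE]]] := aut_PSL_structure simS Aa.
  by case: (no_correlation Aa nq big aE).
case: (boolP [forall c, th c == c]) => [/forallP thid|nth]; last first.
  have [|q0 [e [m [q02 e2 qe mB oB]]]] := semilinear_order Aa _ aE.
    by move=> thid; case/negP: nth; apply/forallP=> c; rewrite thid.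
  case: (@semilinear_bound q0 e q n m #[a]%g) => //.
    by apply: contra nq => /eqP->; rewrite !inE eqxx !orbT.
  by apply: leq_trans oB _; rewrite leq_pmull.
have aP : a = cj P.
  apply: Aut_eqP; rewrite ?cj_Aut // => x SLx; rewrite aE // cjE //; have -> // : frobg th x = x.
  by apply: GLval_inj; rewrite frobgE; apply/matrixP=> i j; rewrite !mxE; apply/eqP; exact: thid.
have cH := card_cyc_scalars P; have sHR := cyc_scalars_sub P.
have bigR : (q ^ n - q <= #|alg_units P|)%N.
  apply: leq_trans (subset_leq_card sHR); rewrite cH -aP mulnC //.
have [irr dn] := minpoly_irreducible (isT : (3 <= k.+3)%N) bigR.
have cR := card_alg_units_irr irr dn.
have HR : cyc_scalars P = alg_units_group P.
  (* A proper subgroup would give [2 * (q ^ n - q) <= q ^ n - 1], against [4 * q <= q ^ n]. *)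
  apply/val_inj/eqP; rewrite eqEsubset sHR /=; apply/subsetP=> x Rx; apply: contraT => nHx.
  have := index_ge2 sHR Rx nHx; rewrite cH -aP /= cR.
  have := qn_ge k F; have := finRing_gt1 F; move: big.
  move: (q ^ n)%N #[a]%g => Q o h1 h2 h3 h4.
  have : (2 * (Q - q) <= Q.-1)%N by apply: leq_trans h4; rewrite leq_mul2l /= mulnC.
  by move: h2 h3; clear; move: q => *; lia.
exists P; split=> //; by rewrite aP -cH HR -cR.
Qed.

End LargeOrder.

(** * Maximal tori *)

Section Tori.
Variables (K : closedFieldType) (d : nat).
Implicit Types (x y z A B h : 'M[K]_d) (T : 'M[K]_d -> Prop).

Lemma polyfun_line f x z : polyfun f -> exists p : {poly K}, forall t, f (x + t *: z) = p.[t].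
Proof.
elim=> [c|i j|f1 f2 _ [p1 E1] _ [p2 E2]|f1 f2 _ [p1 E1] _ [p2 E2]].
- by exists c%:P => t; rewrite hornerC.
- by exists ((x i j)%:P + (z i j)%:P * 'X) => t; rewrite !mxE !hornerE mulrC.
- by exists (p1 + p2) => t; rewrite hornerD E1 E2.
- by exists (p1 * p2) => t; rewrite hornerM E1 E2.
Qed.

Lemma polyfun_sum (I : Type) (s : seq I) (G : I -> 'M[K]_d -> K) :
  (forall i, exists2 f, polyfun f & forall x, f x = G i x) ->
  exists2 f, polyfun f & forall x, f x = \sum_(i <- s) G i x.
Proof.
move=> pG; elim: s => [|i s [f pf fE]].
  by exists (fun=> 0) => [|x]; [apply: polyfun_const | rewrite big_nil].
have [g pg gE] := pG i; exists (fun x => g x + f x); first exact: polyfun_add.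
by move=> x; rewrite big_cons gE fE.
Qed.

Lemma polyfun_mulmx A B i j : exists2 f, polyfun f & forall x, f x = (A *m x *m B) i j.
Proof.
have [f pf fE] : exists2 f, polyfun f & forall x, f x = \sum_l (A *m x) i l * B l j.
  apply: polyfun_sum => l.
  have [g pg gE] : exists2 g, polyfun g & forall x, g x = \sum_m A i m * x m l.
    apply: polyfun_sum => m; exists (fun x => A i m * x m l) => //.
    by apply: polyfun_mul; [apply: polyfun_const | apply: polyfun_coef].
  exists (fun x => g x * B l j); last by move=> x; rewrite gE !mxE.
  by apply: polyfun_mul => //; apply: polyfun_const.
by exists f => // x; rewrite fE !mxE.
Qed.

Lemma det_line x z : exists p : {poly K}, forall t, \det (x + t *: z) = p.[t].
Proof.
exists (\det (map_mx polyC x + 'X *: map_mx polyC z)) => t.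
rewrite -[RHS]/(horner_eval t _) -det_map_mx; congr determinant.
by apply/matrixP=> i j; rewrite !mxE /= /horner_eval !hornerE.
Qed.

(* A line through two points of an affine space of matrices meets a closed set either
   everywhere or in finitely many points, and all but finitely many of its points are
   invertible. *)
Lemma affine_connected (Q : 'M[K]_d -> Prop) :
  (forall x y t, Q x -> Q y -> Q (x + t *: (y - x))) ->
  GL_connected (fun x => x \in unitmx /\ Q x).
Proof.
move=> Qaff A B [IA pA AE] [IB pB BE] cov dis.
case: (boolp.EM (exists x, A x)) => [[x Ax]|nA]; last first.
  by left=> x Ax; apply: nA; exists x.
case: (boolp.EM (exists y, B y)) => [[y By]|nB]; last first.
  by right=> y By; apply: nB; exists y.
have [ux Qx] : x \in unitmx /\ Q x by apply/cov; left.
have [uy Qy] : y \in unitmx /\ Q y by apply/cov; right.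
have sep (C : 'M[K]_d -> Prop) (I : ('M[K]_d -> K) -> Prop) (z : 'M[K]_d) : z \in unitmx -> ~ C z ->
    (forall z, C z <-> z \in unitmx /\ forall f, I f -> f z = 0) -> exists2 f, I f & f z != 0.
  move=> uz nCz CE; apply: boolp.contrapT => nf; apply: nCz; apply/CE; split=> // f If.
  by apply/eqP; apply: boolp.contrapT => /negP nz; apply: nf; exists f.
have [f If fy] := sep A IA y uy (fun Ay => dis y (conj Ay By)) AE.
have [g Ig gx] := sep B IB x ux (fun Bx => dis x (conj Ax Bx)) BE.
have [pf pfE] := polyfun_line x (y - x) (pA f If).
have [pg pgE] := polyfun_line x (y - x) (pB g Ig).
have [pd pdE] := det_line x (y - x).
have nz : pf * pg * pd != 0.
  rewrite !mulf_neq0 //.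
  - by apply: contraNneq fy => p0; have := pfE 1; rewrite p0 horner0 scale1r addrC subrK => ->.
  - by apply: contraNneq gx => p0; have := pgE 0; rewrite p0 horner0 scale0r addr0 => ->.
  - move: ux; rewrite unitmxE unitfE; apply: contraNneq => p0.
    by have := pdE 0; rewrite p0 horner0 scale0r addr0 => ->.
have /closed_nonrootP[t] := nz; rewrite !rootM !negb_or -!andbA => /and3P[tf tg td].
have : (x + t *: (y - x)) \in unitmx /\ Q (x + t *: (y - x)).
  by split; [rewrite unitmxE unitfE pdE | apply: Qaff].
by case/cov => [/AE[_ /(_ f If)]|/BE[_ /(_ g Ig)]]; rewrite ?pfE ?pgE => /eqP e; move: tf tg; rewrite /root e.
Qed.

Definition diag_torus h x := x \in unitmx /\ is_diag_mx (h *m x *m invmx h).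

Lemma diag_torus_torus h : h \in unitmx -> torus (diag_torus h).
Proof.
move=> uh; split.
- split=> [x []||x y [ux dx] [uy dy]|x [ux dx]] //.
  + by split; rewrite ?unitmx1 // mulmx1 mulmxV // scalar_mx_is_diag.
  + split; first by rewrite unitmx_mul ux.
    have -> : h *m (x *m y) *m invmx h = (h *m x *m invmx h) *m (h *m y *m invmx h).
      by rewrite !mulmxA mulmxKV.
    move/diag_mxP: dx => [D ->]; move/diag_mxP: dy => [D' ->].
    by rewrite mulmx_diag diag_mx_is_diag.
  + split; first by rewrite unitmx_inv.
    move/diag_mxP: dx => [D DE]; apply/is_diag_mxP => i j ij.
    have uD : diag_mx D \in unitmx by rewrite -DE !unitmx_mul uh ux unitmx_inv.
    have nzD : D 0 i != 0.
      by move: uD; rewrite unitmxE det_diag unitfE => /prodf_neq0/(_ i isT).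
    have E : diag_mx D *m (h *m invmx x *m invmx h) = 1%:M.
      by rewrite -DE !mulmxA mulmxKV // mulmxK // mulmxV.
    move/matrixP/(_ i j): E; rewrite mul_diag_mx !mxE -val_eqE (negPf ij) => /eqP.
    by rewrite mulf_eq0 (negPf nzD) /= => /eqP.
- exists (fun f => polyfun f /\ exists i j, i != j /\ forall x, f x = (h *m x *m invmx h) i j).
    by move=> f [].
  move=> x; split=> [[ux dx]|[ux fx]]; split=> //.
    move=> f [_ [i [j [ij ->]]]]; apply: (is_diag_mxP dx); by rewrite val_eqE.
  apply/is_diag_mxP => i j ij; have [f pf fE] := polyfun_mulmx h (invmx h) i j.
  by rewrite -fE; apply: fx; split=> //; exists i, j; split.
- apply: affine_connected => x y t /is_diag_mxP dx /is_diag_mxP dy; apply/is_diag_mxP => i j ij.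
  rewrite mulmxDr mulmxDl -scalemxAr -scalemxAl mulmxBr mulmxBl.
  have := dx i j ij; have := dy i j ij; move: (h *m x *m invmx h) (h *m y *m invmx h) => X Y EY EX.
  by rewrite !mxE EX EY subr0 mulr0 addr0.
- by exists h => // x [].
Qed.

Lemma torus_ext T T' : (forall x, T x <-> T' x) -> torus T -> torus T'.
Proof.
move=> TT' [[Tu T1 TM TV] [I pI TE] conn [h uh dh]]; split.
- split=> [x /TT'||x y /TT' Tx /TT' Ty|x /TT' Tx]; rewrite -?TT'; auto; by apply/TT'; auto.
- by exists I => // x; rewrite -TT'.
- move=> A B cA cB cov; apply: conn => // x; rewrite TT'; exact: cov.
- by exists h => // x /TT'; apply: dh.
Qed.

Lemma diag_torus_comm h x y : h \in unitmx -> is_diag_mx (h *m x *m invmx h) ->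
  is_diag_mx (h *m y *m invmx h) -> x *m y = y *m x.
Proof.
move=> uh /diag_mxP[D DE] /diag_mxP[D' DE'].
have := @diag_mx_comm _ _ D D'; rewrite /comm_mx -DE -DE' !mulmxA !mulmxKV //.
move/(congr1 (mulmx (invmx h))); rewrite -!mulmxA !mulKmx // !mulmxA.
by move/(can_inj (mulmxKV uh)).
Qed.

(** All invertible matrices diagonalised by a given [h] form a torus, so a maximal torus equals the
    one that contains it. *)
Lemma maximal_torus_diag T : maximal_torus T ->
  exists2 h, h \in unitmx & forall x, T x <-> diag_torus h x.
Proof.
move=> [[[Tu T1 TM TV] cT coT [h uh dh]] maxT]; exists h => // x; split=> [Tx|].
  by split; [apply: Tu | apply: dh].
by apply: maxT; [apply: diag_torus_torus | move=> y Ty; split; [apply: Tu | apply: dh]].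
Qed.

Definition cent_torus A x := x \in unitmx /\ x *m A = A *m x.

(** Distinct eigenvalues make the centraliser of [A] the full diagonal torus in an eigenbasis; a
    larger torus contains [A] and is commutative, so it centralises [A]. *)
Lemma cent_torus_maximal A h (D : 'rV[K]_d) : A \in unitmx -> h \in unitmx ->
  injective (D 0) -> h *m A *m invmx h = diag_mx D -> maximal_torus (cent_torus A).
Proof.
move=> uA uh injD AE; split.
  apply: torus_ext (diag_torus_torus uh) => x; split=> -[ux] => [dx|xA]; split=> //.
    by apply: (diag_torus_comm uh dx); rewrite AE diag_mx_is_diag.
  apply/is_diag_mxP => i j ij; have E : (h *m x *m invmx h) *m diag_mx D = diag_mx D *m (h *m x *m invmx h).
    by rewrite -AE !mulmxA !mulmxKV // -!(mulmxA h) xA.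
  move/matrixP/(_ i j): E; rewrite mul_mx_diag mul_diag_mx !mxE => /eqP.
  rewrite [X in _ == X]mulrC -subr_eq0 -mulrBr mulf_eq0 subr_eq0 => /orP[/eqP//|/eqP/injD ji].
  by rewrite ji eqxx in ij.
move=> T' [[Tu _ _ _] _ _ [g ug dg]] sub x T'x; split; first exact: Tu.
apply: (diag_torus_comm ug); apply: dg => //; apply: sub; split=> //.
Qed.

End Tori.

Lemma finField_card_pchar (F : finFieldType) :
  exists p e, [/\ prime p, p \in [pchar F] & #|F| = (p ^ e.+1)%N].
Proof.
have /is_abelemP[p pr_p abF] := finField_is_abelem F.
have /p_natP[e cardF] : p.-nat #|F| by rewrite -cardsT; apply: abelem_pgroup abF.
exists p, e.-1; split=> //; first exact: card_finPcharP cardF pr_p.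
by rewrite prednK //; move: (finRing_gt1 F); rewrite cardF; case: (e).
Qed.

Lemma Frobenius_card (F : finFieldType) (K : fieldType) (FtoK : {rmorphism F -> K}) :
  exists fr : {rmorphism K -> K}, fr =1 (fun a => a ^+ #|F|).
Proof.
have [p [e [pr_p chF cardF]]] := finField_card_pchar F.
have chK : p \in [pchar K] by rewrite (fmorph_pchar FtoK).
apply: rmorphism_of_fun => [a b||a b]; last exact: exprMn; last exact: expr1n.
by apply: exprDn_pchar; rewrite cardF pnatX pnatE ?chK.
Qed.

(** The number equals -1 in [K]; this makes ['X^(q ^ n - 1) - 1] separable. *)
Lemma card_pred_neq0 (F : finFieldType) (K : fieldType) (FtoK : {rmorphism F -> K}) m :
  (((#|F| ^ m.+1).-1)%:R : K) != 0.
Proof.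
have [p [e [pr_p chF cardF]]] := finField_card_pchar F.
have chK : p \in [pchar K] by rewrite (fmorph_pchar FtoK).
have E : ((#|F| ^ m.+1).-1)%:R + 1 = 0 :> K.
  rewrite natr1 prednK; last by rewrite expn_gt0 cardF expn_gt0 prime_gt0.
  by rewrite cardF -expnM mulSn expnD expnS -mulnA natrM (pcharf0 chK) mul0r.
by apply/eqP=> E0; move: E; rewrite E0 add0r => /eqP; rewrite oner_eq0.
Qed.

(** * The units of [F[P]] give a maximal torus *)

Section SingerTorus.
Variables (k : nat) (F : finFieldType) (K : closedFieldType) (FtoK : {rmorphism F -> K}).
Local Notation n := k.+3.
Local Notation gl := {'GL_n[F]}.
Local Notation q := #|F|.
Variable P : gl.
Local Notation M := (GLval P : 'M[F]_n).
Local Notation mu := (mxminpoly M).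
Hypotheses (irr : irreducible_poly mu) (dn : degree_mxminpoly M = n).

Lemma size_mu : size mu = n.+1. Proof. by rewrite size_mxminpoly dn. Qed.

Lemma mu_dvd : mu %| 'X^((q ^ n).-1) - 1.
Proof.
apply: mxminpoly_min; rewrite rmorphB rmorphXn rmorph1 /= horner_mx_X.
have RP : P \in alg_units P by apply/alg_unitsP; exists 'X; rewrite horner_mx_X.
have E : (P ^+ (q ^ n).-1)%g = 1%g.
  by apply/eqP; rewrite -order_dvdn -(card_alg_units_irr irr dn); apply: order_dvdG.
move/(congr1 (@GLval n F)): E; rewrite GL_X GL_1E => ->.
by apply/eqP; rewrite subr_eq0.
Qed.

(** [mu] divides a separable polynomial, so [M] is diagonalisable over [K]; its minimal polynomial
    still has degree [n], which forces [n] distinct diagonal entries. *)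
Lemma singer_diag : exists h : 'M[K]_n, exists2 D : 'rV[K]_n, injective (D 0) &
  h \in unitmx /\ h *m map_mx FtoK M *m invmx h = diag_mx D.
Proof.
set A := map_mx FtoK M.
have muA : mxminpoly A = map_poly FtoK mu by rewrite mxminpoly_map.
have [h uh] : exists2 h, h \in unitmx & similar_diag h A.
  apply/diagonalizableP; have [rs rsE] := closed_field_poly_normal ('X^((q ^ n).-1) - 1 : {poly K}).
  have q1 : (0 < (q ^ n).-1)%N.
    by rewrite -ltnS prednK ?expn_gt0 ?(ltnW (finRing_gt1 F)) // (leq_trans (finRing_gt1 F)) // -{1}[q]expn1 leq_pexp2l ?(ltnW (finRing_gt1 F)).
  have mon : lead_coef ('X^((q ^ n).-1) - 1 : {poly K}) = 1.
    by rewrite lead_coefDl ?lead_coefXn // size_polyN size_poly1 size_polyXn ltnS.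
  move: rsE; rewrite mon scale1r => rsE; exists rs.
    by rewrite -separable_prod_XsubC -rsE; apply: separable_Xn_sub_1; apply: card_pred_neq0 FtoK _.
  have mE : map_poly FtoK ('X^((q ^ n).-1) - 1) = 'X^((q ^ n).-1) - 1.
    by rewrite rmorphB rmorph1 /= map_polyXn.
  by rewrite muA -rsE -mE dvdp_map mu_dvd.
move=> dg; exists h; move: (dg); rewrite -[similar_diag _ _]/(is_diag_mx (conjmx h A)) => /diag_mxP[D DE].
exists D; last by split=> //; rewrite -conjumx.
have AE : A = invmx h *m diag_mx D *m h by rewrite -DE conjumx // -!mulmxA mulKmx // mulVmx // mulmx1.
have szD : (n < size (mxminpoly (diag_mx D)))%N.
  rewrite -size_mu -(size_map_poly FtoK) -muA; apply: dvdp_leq.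
    by rewrite monic_neq0 ?mxminpoly_monic.
  by apply: mxminpoly_min; rewrite AE horner_mx_uconjC // mx_root_minpoly mulmx0 mul0mx.
apply/injectiveP; rewrite /injectiveb /dinjectiveb; apply: contraT.
rewrite -ltn_size_undup size_map size_enum_ord => lt; move: szD.
by rewrite mxminpoly_diag size_prod_XsubC ltnS leqNgt lt.
Qed.

Lemma cent_alg_units (x : gl) :
  GLval x *m M = M *m GLval x <-> x \in alg_units P.
Proof.
split=> [xM|/alg_unitsP[r ->]]; last by apply: comm_horner_mx; apply: comm_mx_refl.
have [r rE] := cent_horner irr size_mu (mx_root_minpoly M) xM.
by apply/alg_unitsP; exists r.
Qed.

(** The Frobenius map fixes [M], whose entries come from [F]; so the centraliser is stable, and its
    rational points are the units of [F[P]]. *)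
Lemma singer_maximal_torus : maximal_torus_PGL FtoK (cj_morphism k F @* alg_units P)%g.
Proof.
have [h [D injD [uh DE]]] := singer_diag.
pose A := map_mx FtoK M; have uA : A \in unitmx by rewrite map_unitmx GLunit.
exists (cent_torus A), (alg_units P); split.
- exact: (cent_torus_maximal uA uh injD DE).
- have [fr frE] := Frobenius_card FtoK => x.
  have -> : map_mx (fun a => a ^+ #|F|) x = map_mx fr x.
    by apply/matrixP=> i j; rewrite !mxE frE.
  have frA : map_mx fr A = A.
    by apply/matrixP=> i j; rewrite !mxE frE -rmorphXn expf_card.
  split=> -[ux xA]; split; rewrite ?map_unitmx // in ux *.
    by rewrite -{1}frA -{2}frA -!map_mxM xA.
  by apply: (map_mx_inj (f := fr)); rewrite !map_mxM frA.
- move=> x; rewrite -cent_alg_units; split=> [xM|[_ xA]].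
    by split; [rewrite map_unitmx GLunit | rewrite -!map_mxM xM].
  by apply: (map_mx_inj (f := FtoK)); rewrite !map_mxM.
- by rewrite PGL_aut_ofE.
Qed.

End SingerTorus.

(** * Conjugacy of maximal tori of this order *)

Section TorusUniqueness.
Variables (k : nat) (F : finFieldType) (K : closedFieldType) (FtoK : {rmorphism F -> K}).
Local Notation n := k.+3.
Local Notation gl := {'GL_n[F]}.
Local Notation q := #|F|.

Section Algebra.
Variables (h : 'M[K]_n) (uh : h \in unitmx).

Definition dconj (y : 'M[F]_n) : 'M[K]_n := h *m map_mx FtoK y *m invmx h.

Definition diag_alg : {set 'M[F]_n} := [set y | is_diag_mx (dconj y)].

Lemma dconjD y z : dconj (y + z) = dconj y + dconj z.
Proof. by rewrite /dconj map_mxD mulmxDr mulmxDl. Qed.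

Lemma dconjM y z : dconj (y *m z) = dconj y *m dconj z.
Proof. by rewrite /dconj map_mxM !mulmxA mulmxKV. Qed.

Lemma dconj_scalar c : dconj c%:M = (FtoK c)%:M.
Proof. by rewrite /dconj map_scalar_mx mul_mx_scalar -scalemxAl mulmxV // scalemx1. Qed.

Lemma dconj_horner y r : dconj (horner_mx y r) = horner_mx (dconj y) (map_poly FtoK r).
Proof. by rewrite /dconj map_horner_mx horner_mx_uconj. Qed.

Lemma dconj_unit y : (dconj y \in unitmx) = (y \in unitmx).
Proof. by rewrite !unitmx_mul uh unitmx_inv uh andbT map_unitmx. Qed.

(** Rank does not change under extension of scalars, and over [K] the algebra lies in the
    [n]-dimensional space of matrices diagonalised by [h]. *)
Lemma card_diag_alg : (#|diag_alg| <= q ^ n)%N.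
Proof.
pose E : 'M[F]_(#|diag_alg|, n * n) := \matrix_i mxvec (enum_val i).
pose D : 'M[K]_(n, n * n) := \matrix_i mxvec (invmx h *m delta_mx i i *m h).
have rE : (\rank E <= n)%N.
  rewrite -(mxrank_map FtoK); apply: leq_trans (rank_leq_row D); apply: mxrankS.
  apply/row_subP=> i; rewrite -map_row rowK map_mxvec.
  have := enum_valP i; rewrite inE => /diag_mxP[v vE].
  have -> : map_mx FtoK (enum_val i) = invmx h *m diag_mx v *m h.
    by rewrite -vE /dconj !mulmxA mulVmx // mul1mx mulmxKV.
  rewrite diag_mx_sum_delta mulmx_sumr mulmx_suml linear_sum; apply: summx_sub => j _.
  rewrite -scalemxAr -scalemxAl linearZ; apply: scalemx_sub.
  have DE : row j D = mxvec (invmx h *m delta_mx j j *m h) by rewrite rowK.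
  by apply: submx_trans (row_sub j D); rewrite DE.
pose g (v : 'rV[F]_(\rank E)) : 'M[F]_n := vec_mx (v *m row_base E).
have sub : diag_alg \subset [set g v | v : 'rV[F]_(\rank E)].
  apply/subsetP=> y Ly; have : (mxvec y <= row_base E)%MS.
    have EE : row (enum_rank_in Ly y) E = mxvec y by rewrite rowK enum_rankK_in.
    by rewrite eq_row_base -EE row_sub.
  by case/submxP=> v vE; apply/imsetP; exists v; rewrite // /g -vE mxvecK.
apply: leq_trans (subset_leq_card sub) _; apply: leq_trans (leq_imset_card _ _) _.
by rewrite card_rV leq_pexp2l // ltnW // finRing_gt1.
Qed.

Lemma diag_algM y z : y \in diag_alg -> z \in diag_alg -> y *m z \in diag_alg.
Proof.
rewrite !inE dconjM => /diag_mxP[v ->] /diag_mxP[w ->].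
by rewrite mulmx_diag diag_mx_is_diag.
Qed.

Lemma diag_alg_scalar c : c%:M \in diag_alg.
Proof. by rewrite inE dconj_scalar scalar_mx_is_diag. Qed.

Lemma diag_algD y z : y \in diag_alg -> z \in diag_alg -> y + z \in diag_alg.
Proof.
rewrite !inE dconjD => /is_diag_mxP dy /is_diag_mxP dz; apply/is_diag_mxP => i j ij.
by rewrite mxE dy ?dz ?addr0.
Qed.

Lemma diag_alg_horner y r : y \in diag_alg -> horner_mx y r \in diag_alg.
Proof.
move=> Ly; elim/poly_ind: r => [|r c IH]; first by rewrite rmorph0 -(raddf0 (@scalar_mx F n)) diag_alg_scalar.
rewrite rmorphD rmorphM /= horner_mx_X horner_mx_C; apply: diag_algD; last exact: diag_alg_scalar.
exact: diag_algM.
Qed.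

Definition diag_grp : {set gl} := [set x : gl | GLval x \in diag_alg].

Lemma diag_grpE (x : gl) : (x \in diag_grp) = (GLval x \in diag_alg).
Proof. by rewrite in_set. Qed.

Lemma qn_gt0 : (0 < q ^ n)%N.
Proof. by rewrite expn_gt0 (ltnW (finRing_gt1 F)). Qed.

Lemma diag_grp_group_set : group_set diag_grp.
Proof.
apply/group_setP; split; first by rewrite diag_grpE; apply: diag_alg_scalar.
by move=> x y; rewrite !diag_grpE GL_MxE; apply: diag_algM.
Qed.
Canonical diag_grp_group := Group diag_grp_group_set.

Hypothesis card_grp : #|diag_grp| = (q ^ n).-1.

(** At most [q ^ n] elements, of which [q ^ n - 1] are invertible, leave 0 as the only non-unit. *)
Lemma diag_alg_field y : y \in diag_alg -> y != 0 -> exists2 x, x \in diag_grp & GLval x = y.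
Proof.
move=> Ly nzy; have sub : GLval @: diag_grp \subset diag_alg :\ 0.
  apply/subsetP=> _ /imsetP[x Gx ->]; rewrite in_setD1; rewrite diag_grpE in Gx; rewrite Gx andbT.
  by apply: contraTneq (GLunit x) => ->; rewrite unitmxE det0 unitr0.
have L0 : 0 \in diag_alg by rewrite -(raddf0 (@scalar_mx F n)) diag_alg_scalar.
have E : GLval @: diag_grp = diag_alg :\ 0.
  apply/eqP; rewrite eqEcard sub card_imset; last exact: GLval_inj.
  rewrite card_grp -ltnS (prednK qn_gt0).
  by apply: leq_trans card_diag_alg; rewrite (cardsD1 0 diag_alg) L0.
have : y \in GLval @: diag_grp by rewrite E in_setD1 nzy.
by case/imsetP=> x Gx ->; exists x.
Qed.

Lemma card_diag_alg_eq : #|diag_alg| = (q ^ n)%N.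
Proof.
apply/eqP; rewrite eqn_leq card_diag_alg /=.
have L0 : 0 \in diag_alg by rewrite -(raddf0 (@scalar_mx F n)) diag_alg_scalar.
have sub : GLval @: diag_grp \subset diag_alg :\ 0.
  apply/subsetP=> _ /imsetP[x Gx ->]; rewrite in_setD1; rewrite diag_grpE in Gx; rewrite Gx andbT.
  by apply: contraTneq (GLunit x) => ->; rewrite unitmxE det0 unitr0.
rewrite (cardsD1 0) L0; have := subset_leq_card sub; rewrite card_imset; last exact: GLval_inj.
by rewrite card_grp -ltnS add1n (prednK qn_gt0).
Qed.

(* The first eigenvalue; as diag_alg turns out to be a field, chi embeds it into K. *)
Definition chi (y : 'M[F]_n) : K := dconj y 0 0.

Lemma chi_eq0 y : y \in diag_alg -> chi y = 0 -> y = 0.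
Proof.
move=> Ly; move/eqP=> c0; apply/eqP; apply: contraT => nzy; case/negP: (isT : ~~ false).
have [x Gx xE] := diag_alg_field Ly nzy.
have : dconj y \in unitmx by rewrite dconj_unit -xE GLunit.
move: Ly; rewrite inE => /diag_mxP[v vE]; rewrite vE unitmxE det_diag unitfE => /prodf_neq0/(_ 0 isT).
by move: c0; rewrite /chi vE mxE eqxx mulr1n => ->.
Qed.

Lemma chi_horner y r : y \in diag_alg -> chi (horner_mx y r) = (map_poly FtoK r).[chi y].
Proof.
rewrite inE /chi dconj_horner => /diag_mxP[v ->].
by rewrite horner_mx_diag !mxE eqxx !mulr1n.
Qed.

Lemma chi_inj : {in diag_alg &, injective chi}.
Proof.
move=> y z Ly Lz E; apply/eqP; rewrite -subr_eq0; apply/eqP; apply: chi_eq0.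
  apply: diag_algD => //; rewrite -scaleN1r -mul_scalar_mx.
  by apply: diag_algM => //; apply: diag_alg_scalar.
have : dconj (y - z) = dconj y - dconj z by rewrite /dconj map_mxB mulmxBr mulmxBl.
rewrite /chi => ->; move: E; rewrite /chi; move: (dconj y) (dconj z) => Y Z E.
by rewrite !mxE E subrr.
Qed.

Lemma chi_root y : y \in diag_alg -> root ('X^(q ^ n) - 'X) (chi y).
Proof.
move=> Ly; rewrite /root !hornerE subr_eq0.
have [->|nzy] := eqVneq y 0.
  rewrite /chi /dconj map_mx0 mulmx0 mul0mx mxE expr0n.
  by rewrite (gtn_eqF qn_gt0).
have [x Gx xE] := diag_alg_field Ly nzy.
have : (x ^+ (q ^ n).-1)%g = 1%g by apply/eqP; rewrite -order_dvdn -card_grp order_dvdG.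
move/(congr1 (@GLval n F)); rewrite GL_X xE GL_1E => E.
have := chi_horner 'X^((q ^ n).-1) Ly; rewrite map_polyXn hornerXn rmorphXn /= horner_mx_X E.
rewrite {1}/chi dconj_scalar rmorph1 mxE eqxx => E1.
by rewrite -(prednK qn_gt0) exprS -E1 mulr1.
Qed.

(** The [q ^ n] distinct values of [chi] are already all the roots; one more would exceed the
    degree. *)
Lemma chi_surj t : root ('X^(q ^ n) - 'X) t -> exists2 y, y \in diag_alg & chi y = t.
Proof.
move=> rt; case: (boolP (t \in [seq chi y | y in diag_alg])) => [/imageP[y Ly ->]|nt].
  by exists y.
have qn1 : (1 < q ^ n)%N.
  by apply: leq_trans (finRing_gt1 F) _; rewrite -{1}[q]expn1 leq_pexp2l // ltnW // finRing_gt1.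
have sz : size ('X^(q ^ n) - 'X : {poly K}) = (q ^ n).+1.
  by rewrite size_polyDl ?size_polyXn // size_polyN size_polyX ltnS.
have nz : ('X^(q ^ n) - 'X : {poly K}) != 0 by rewrite -size_poly_gt0 sz.
have := @max_poly_roots _ _ (t :: [seq chi y | y in diag_alg]) nz; rewrite /= rt nt sz.
rewrite size_map -cardE card_diag_alg_eq !ltnn => no; suff : false by [].
apply: no; first by apply/allP=> _ /imageP[y Ly ->]; apply: chi_root.
by apply/dinjectiveP; apply: chi_inj.
Qed.

End Algebra.

Variable P : gl.
Local Notation M := (GLval P : 'M[F]_n).
Local Notation mu := (mxminpoly M).
Hypotheses (irr : irreducible_poly mu) (dn : degree_mxminpoly M = n).
Hypothesis cycE : cyc_scalars P = alg_units_group P.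

(** A root of [mu] in [K] has the form [chi y]; then [chi (mu(y)) = 0], so [mu(y) = 0] and [y] is
    conjugate to [M]. The conjugated unit group lies in [diag_grp h] and has the same order. *)
Lemma diag_grp_conj h : h \in unitmx -> #|diag_grp h| = (q ^ n).-1 ->
  exists x : gl, diag_grp h = (alg_units P :^ x)%g.
Proof.
move=> uh cG; have szm := size_mu dn.
have [t rt] : exists t : K, root (map_poly FtoK mu) t.
  by apply/closed_rootP; rewrite size_map_poly szm.
have rt2 : root ('X^(q ^ n) - 'X) t.
  have : map_poly FtoK mu %| 'X^(q ^ n) - 'X.
    have -> : 'X^(q ^ n) - 'X = map_poly FtoK (('X^((q ^ n).-1) - 1) * 'X).
      rewrite mulrBl mul1r -exprSr (prednK qn_gt0).
      by rewrite rmorphB /= map_polyXn map_polyX.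
    by rewrite dvdp_map dvdp_mulr // mu_dvd.
  by move/dvdpP=> [r ->]; rewrite rootM rt orbT.
have [y Ly yt] := chi_surj uh cG rt2.
have y0 : horner_mx y mu = 0.
  apply: (chi_eq0 uh cG); first exact: diag_alg_horner.
  by rewrite chi_horner // yt; apply/eqP.
have [x xE] := same_minpoly_conj irr szm (mx_root_minpoly M) y0.
exists x; apply/esym/eqP; rewrite eqEcard cardJg cG (card_alg_units_irr irr dn) leqnn andbT.
apply/subsetP=> z; rewrite -[alg_units P]/(val (alg_units_group P)) -cycE.
case/imsetP=> r /cyc_scalarsP[c [i [nz rE]]] ->; rewrite diag_grpE GL_J rE.
rewrite (_ : _ *m _ *m _ = horner_mx y (c *: 'X^i)); first exact: diag_alg_horner.
have -> : horner_mx y (c *: 'X^i) = c *: y ^+ i by rewrite linearZ /= rmorphXn /= horner_mx_X.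
have -> : y ^+ i = horner_mx y 'X^i by rewrite rmorphXn /= horner_mx_X.
by rewrite -xE horner_mx_uconjC ?GLunit // rmorphXn /= horner_mx_X -scalemxAr -scalemxAl.
Qed.

Lemma maximal_torus_PGL_conj (T : {set {perm coset_of 'Z(SL_group n F)}}) :
  maximal_torus_PGL FtoK T -> (#|T| * q.-1 = (q ^ n).-1)%N ->
  exists2 a, a \in PGL_aut n F & T = ((cj_morphism k F @* alg_units P) :^ a)%g.
Proof.
move=> [TK [TF [mT _ TFE ->]]] cT.
have [h uh TKE] := maximal_torus_diag mT.
have TFG : TF = diag_grp h.
  apply/setP=> x; rewrite !inE; apply/idP/idP => [/TFE/TKE[]//|dx].
  by apply/TFE/TKE; split=> //; rewrite map_unitmx GLunit.
have sG : scalars k.+2 F \subset diag_grp_group uh.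
  apply/subsetP=> x /scalarsP[c nz xE]; rewrite diag_grpE xE; exact: diag_alg_scalar.
move: cT; rewrite PGL_aut_ofE TFG (card_cj_image sG) => cG.
have [x ->] := diag_grp_conj uh cG.
by exists (cj x); [apply: cj_PGL | rewrite morphimJ // inE].
Qed.

End TorusUniqueness.

(** * From simple spectrum to the order and the torus *)

Lemma simple_spectrum_order (C : closedFieldType) (gT : finGroupType) (G : {group gT})
  m (rG : mx_representation C G m) (g : gT) :
  mx_irreducible rG -> g \in G -> simple_spectrum (rG g) ->
  (m <= #[coset 'Z(G) g]%g)%N.
Proof.
move=> irrG Gg spec; set o := #[_]%g.
have Zgo : (g ^+ o \in 'Z(G))%g.
  have nZ : g \in 'N('Z(G))%g by apply: subsetP (normal_norm (center_normal G)) _ Gg.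
  apply: coset_idr; first by rewrite groupX.
  by rewrite morphX // expg_order.
have [c cE] : exists c, rG (g ^+ o)%g = c%:M.
  apply/is_scalar_mxP; apply: (mx_abs_irr_cent_scalar (group_closure_closed_field irrG)).
  apply/centgmxP=> x Gx; move/centerP: Zgo => [Ggo /(_ x Gx) com].
  by rewrite -!repr_mxM // com.
have [rs rsE] := closed_field_poly_normal (char_poly (rG g)).
move: rsE; rewrite (eqP (char_poly_monic _)) scale1r => rsE.
have szrs : size rs = m.
  by have := size_char_poly (rG g); rewrite rsE size_prod_XsubC => -[].
have eig r : r \in rs -> eigenvalue (rG g) r.
  by rewrite eigenvalue_root_char rsE root_prod_XsubC.
have urs : uniq rs.
  apply: count_mem_uniq => r; rewrite -mu_prod_XsubC -rsE.
  have [/eig/spec -> //|nr] := boolP (r \in rs).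
  by rewrite mupNroot // rsE root_prod_XsubC.
have o_gt0 : (0 < o)%N by apply: order_gt0.
have sz : size ('X^o - c%:P : {poly C}) = o.+1 by apply: size_XnsubC.
rewrite -szrs -ltnS -sz; apply: max_poly_roots => //; first by rewrite -size_poly_gt0 sz.
apply/allP=> r /eig/eigenvalueP[v vE nz].
have vX i : v *m (rG (g ^+ i)%g) = r ^+ i *: v.
  elim: i => [|i IH]; first by rewrite expg0 repr_mx1 mulmx1 expr0 scale1r.
  by rewrite expgSr repr_mxM ?groupX // mulmxA IH -scalemxAl vE scalerA exprSr.
have := vX o; rewrite cE mul_mx_scalar => /eqP.
rewrite -subr_eq0 -scalerBl scaler_eq0 (negPf nz) orbF subr_eq0 eq_sym => rc.
by rewrite /root !hornerE subr_eq0.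
Qed.

Lemma cycle_cj (k : nat) (F : finFieldType) (P : {'GL_k.+3[F]}) :
  cyc_scalars P = alg_units_group P -> <[cj P]>%g = (cj_morphism k F @* alg_units P)%g.
Proof.
move=> cycE; rewrite -[alg_units P]/(val (alg_units_group P)) -cycE morphpreK //.
apply/subsetP=> _ /cycleP[i ->]; rewrite -cjX.
by apply: (mem_morphim (cj_morphism k F)); rewrite in_setT.
Qed.

Theorem theorem8p1 (R : realType) (n q : nat) (F : finFieldType)
    (K : closedFieldType) (FtoK : {rmorphism F -> K})
    (gT : finGroupType) (G E : {group gT})
    (phi : {morphism (G / 'Z(G))%g >-> {perm coset_of 'Z(SL_group n F)}})
    (m : nat) (rG : mx_representation R[i] G m)
    (f : {morphism SL n F >-> gT}) (W : mx_representation R[i] (SL n F) m)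
    (g : gT)
    (card_F : #|F| = q)
    (n_ge3 : (3 <= n)%N)
    (nq : (n, q) \notin [:: (3, 2); (3, 3); (3, 4)]%N)
    (K_alg : integralRange FtoK)
    (G_aqs : almost_quasisimple (PSL n F) phi)
    (E_layer : is_layer G (PSL n F) E)
    (V_irr : mx_irreducible rG)
    (V_faithful : mx_faithful rG)
    (Gg : g \in G)
    (g_simple : simple_spectrum (rG g))
    (E_quo : (f @* SL n F)%g = E)
    (VE_W : forall x, x \in SL n F -> W x = rG (f x))
    (W_weil : Weil_SL W)
    (dimV : (m = (q ^ n - 1) %/ (q - 1) \/ m = (q ^ n - q) %/ (q - 1))%N) :
  let gbar := phi (coset 'Z(G) g) in
  let N := ((q ^ n - 1) %/ (q - 1))%N in
  [/\ #[coset 'Z(G) g]%g = N,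
      gbar \in PGL_aut n F,
      maximal_torus_PGL FtoK <[gbar]>%g,
      #|<[gbar]>%g| = N &
      forall T : {set {perm coset_of 'Z(SL_group n F)}},
        maximal_torus_PGL FtoK T -> #|T| = N ->
        exists2 x, x \in PGL_aut n F & T = (<[gbar]> :^ x)%g].
Proof.
move=> gbar N; clear K_alg E_layer V_faithful E_quo VE_W W_weil f W.
case: G_aqs => -[simS _] injphi _ subA.
have Gq : coset 'Z(G) g \in (G / 'Z(G))%g by rewrite mem_quotient.
have Sgbar : gbar \in Aut (PSL n F) by rewrite (subsetP subA) // mem_morphim.
have ordE : #[coset 'Z(G) g]%g = #[gbar]%g := esym (order_injm injphi Gq).
have m_le : (m <= #[gbar]%g)%N by rewrite -ordE; exact: (simple_spectrum_order V_irr Gg g_simple).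
case: n n_ge3 nq simS @N dimV phi @gbar injphi subA Sgbar ordE m_le => [|[|[|k]]] // _ nq simS N dimV phi gbar _ _ Sgbar ordE m_le.
subst q.
have q_gt1 := finRing_gt1 F.
have dvdN : (#|F|.-1 %| (#|F| ^ k.+3).-1)%N := dvdn_pred_predX _ _.
have NE : (N * #|F|.-1 = (#|F| ^ k.+3).-1)%N by rewrite /N !subn1 divnK.
(* [(q - 1) * m] is [q ^ n - 1] or [q ^ n - q]; the smaller value is the bound used throughout. *)
have large : (#|F| ^ k.+3 - #|F| <= #|F|.-1 * #[gbar]%g)%N.
  apply: leq_trans (leq_mul (leqnn _) m_le); rewrite mulnC.
  case: dimV => ->; first by rewrite NE -subn1 leq_sub2l // ltnW.
  have -> : (#|F| ^ k.+3 - #|F| = #|F| * (#|F| ^ k.+2).-1)%N by rewrite -subn1 mulnBr muln1 expnS.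
  by rewrite subn1 divnK // dvdn_mull // dvdn_pred_predX.
have [P [aP irr dn cycE oE]] := aut_large_order simS Sgbar nq large.
have oN : #[gbar]%g = N.
  apply/eqP; rewrite -(eqn_pmul2r (m := #|F|.-1)) ?oE ?NE //.
  by rewrite -ltnS prednK // ltnW.
have cycP : <[gbar]>%g = (cj_morphism k F @* alg_units P)%g by rewrite aP cycle_cj.
split; first by rewrite ordE oN.
- by rewrite aP cj_PGL.
- by rewrite cycP; apply: singer_maximal_torus irr dn.
- exact: oN.
move=> T mT cT; rewrite cycP.
by apply: (maximal_torus_PGL_conj irr dn cycE mT); rewrite cT NE.
Qed.
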